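(* Let $B=\varepsilon B_1$ and $C=\varepsilon C_1$ with fixed $B_1,C_1\in\mathbb{R}$ (independent of $\varepsilon$), let $0<A<2/3$ be fixed, let $D>1$ and let $L>0$. Then there is some $\varepsilon_0>0$ such that for all $0<\varepsilon<\varepsilon_0$ the three-component reaction-diffusion system $$U_t=\varepsilon^2U_{xx}+U-U^3-(AV+BW+C),\qquad \tau V_t=V_{xx}+U-V,\qquad \theta W_t=D^2W_{xx}+U-W$$ has, for each choice of the sign $\pm$ (the same choice throughout), a stationary $2L$-periodic solution $(U,V,W)(x,t)=(u,v,w)(x)$ with one fast transition. The slow solutions are given by $$v_s(x)=\pm\sqrt{1-A}+\mathcal{O}(\varepsilon),\qquad w_s(x)=\pm\sqrt{1-A}+\mathcal{O}(\varepsilon),\qquad x\in[-L,L],$$ and the fast solution by $$u_f(\xi)=\pm u_h(\xi;\sqrt{1-A})+\mathcal{O}(\varepsilon),\qquad \xi=\frac{x}{\varepsilon}\in\left[-\frac{L}{\varepsilon},\frac{L}{\varepsilon}\right].$$ Here $u_h(\xi;\sqrt{1-A})$ is the solution homoclinic to $\sqrt{1-A}$ of $u_{\xi\xi}+u-u^3-A\sqrt{1-A}=0$.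
   Context: The system is posed for $x\in\mathbb{R}$, with $\tau,\theta>0$; stationary solutions do not depend on $\tau,\theta$. The components $v,w$ are called slow and $u$ is called fast; $\xi=x/\varepsilon$ is the fast spatial variable. The subscripts denote the $v,w$ components as functions of $x$ ($v_s,w_s$) and the $u$ component as a function of $\xi$ ($u_f$), on one period $x\in[-L,L]$. A $2L$-periodic solution has one fast transition if on each period the fast component makes a single excursion on the fast scale $\xi$, near $x=0$ after translation, leaving a neighbourhood of a constant state of the fast equation and returning to it. The homoclinic solution $u_h$ is the nonconstant solution with $u_h(\xi)\to\sqrt{1-A}$ as $\xi\to\pm\infty$, normalised by translation to be even in $\xi$. *)

(* Defs.v *)
From Stdlib Require Import Reals.
From Coquelicot Require Import Coquelicot.
Open Scope R_scope.

(* [Derive_n] is total, so differentiability of order 1 and 2 must be required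
   separately. *)
Definition twice_derivable (f : R -> R) : Prop :=
  forall x, ex_derive_n f 1 x /\ ex_derive_n f 2 x.

(* Functions of space and time take their arguments in the order [x t]. *)
Definition classical (F : R -> R -> R) : Prop :=
  (forall t, twice_derivable (fun x => F x t)) /\
  (forall x t, ex_derive (fun s => F x s) t).

Definition d_t (F : R -> R -> R) (x t : R) : R := Derive (fun s => F x s) t.
Definition d_xx (F : R -> R -> R) (x t : R) : R :=
  Derive_n (fun y => F y t) 2 x.

Definition rd_solution (eps A B C D tau theta : R) (U V W : R -> R -> R)
    : Prop :=
  classical U /\ classical V /\ classical W /\
  forall x t,
    d_t U x t = eps ^ 2 * d_xx U x t + U x t - U x t ^ 3
                - (A * V x t + B * W x t + C) /\
    tau * d_t V x t = d_xx V x t + U x t - V x t /\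
    theta * d_t W x t = D ^ 2 * d_xx W x t + U x t - W x t.

(* The solution does not depend on [tau] and [theta]: one profile serves all of
   their positive values. *)
Definition stationary_solution (eps A B C D : R) (u v w : R -> R) : Prop :=
  forall tau theta, 0 < tau -> 0 < theta ->
    rd_solution eps A B C D tau theta
      (fun x _ => u x) (fun x _ => v x) (fun x _ => w x).

Definition periodic (T : R) (f : R -> R) : Prop := forall x, f (x + T) = f x.

(* Stationary [U]-equation in [xi = x / eps], with [A V + B W + C] frozen at
   the value [mu]. *)
Definition fast_equation (mu : R) (u : R -> R) : Prop :=
  twice_derivable u /\
  forall xi, Derive_n u 2 xi + u xi - u xi ^ 3 - mu = 0.

Definition constant_state (mu c : R) : Prop := fast_equation mu (fun _ => c).

Definition even_homoclinic (mu a : R) (uh : R -> R) : Prop :=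
  fast_equation mu uh /\
  (exists xi eta, uh xi <> uh eta) /\
  is_lim uh m_infty a /\ is_lim uh p_infty a /\
  (forall xi, uh (- xi) = uh xi).

(* Over the period [-L, L] the profile lies outside the [delta]-neighbourhood
   of a constant state [c] exactly on one interval [xi1, xi2] of the fast
   variable. That neighbourhood isolates [c] among the constant states. Having
   [delta] and [M] as parameters allows them to be chosen independently of
   [eps], so that the excursion has size of order 1 and takes place for [xi] of
   order 1, that is, near x = 0. As [M < L / eps], the profile starts and ends
   the period inside the neighbourhood. *)
Definition one_fast_transition (mu delta M eps L : R) (u : R -> R) : Prop :=
  M < L / eps /\
  exists c xi1 xi2,
    constant_state mu c /\
    (forall c', constant_state mu c' -> Rabs (c' - c) < delta -> c' = c) /\
    - M <= xi1 /\ xi1 < xi2 /\ xi2 <= M /\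
    forall xi, - (L / eps) <= xi <= L / eps ->
      (delta <= Rabs (u (eps * xi) - c) <-> xi1 <= xi <= xi2).

(* Main.v *)
Require Import Defs.
From Stdlib Require Import Reals ZArith Lra Lia Psatz.
From Stdlib Require Import ClassicalEpsilon FunctionalExtensionality.
From Coquelicot Require Import Coquelicot.
Open Scope R_scope.

(* In the fast variable [xi = x / eps] the stationary problem on a half period
   [[0, l]], [l = L / eps], with Neumann conditions is a perturbation of size
   [eps] of (homoclinic, sqrt (1 - A), sqrt (1 - A)), and the solution is found
   by contraction in a ball of radius [O(eps)] around that state. The
   homoclinic is explicit, with [hom - sqrt (1 - A)] a multiple of
   [1 / (2 sqrt (1 - A) + sqrt (2 A) cosh (m xi))], [m^2 = 2 - 3 A].

   Two linear bounds, uniform in [l], drive the contraction. The linearisation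
   of the fast equation at the homoclinic is invertible on even functions,
   since its bounded kernel [hom'] is odd, and it turns exponentially localised
   forcing into exponentially localised responses. The slow equations turn
   bounded forcing into bounded responses, and localised forcing into responses
   of size [O(eps)]. The coupling [A v] is not small, but after the change of
   unknown [z = u + A v / (2 - 3 A)] it enters the fast equation only through a
   localised term, so that a full cycle fast -> slow -> fast gains [eps]. *)

(** * Comparison principles *)

(** The interval length [l] tends to infinity as [eps] tends to 0, so every constant must be uniform
    in [l]. Exponential growth of Gronwall type is affordable only on a fixed interval near the
    pulse; beyond it explicit barriers and a maximum principle take over. Forcing is split as
    [S + T * zeta], a uniform part and a part decaying away from the pulse. The two are tracked
    separately, because merging them would lose the factor [eps] at the slow stage. The coefficient
    in [z] comes from the far field: the potential of the linearised fast equation tends to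
    [2 - 3 A] there, and [(2 - 3 A) u + A v] equals [(2 - 3 A) z]. Since [z] depends on [v] with a
    constant of order 1, one step need not contract in the plain supremum norm; hence the weight
    [Lam], and slow equations fed with the already updated [z]. The fixed point is close to the base
    state only in the supremum norm, which would not exclude several crossings of the level bounding
    the excursion. Closeness of the slopes near the crossing is recovered from the equation. *)

Definition derivs2 (f f1 f2 : R -> R) : Prop :=
  forall x, is_derive f x (f1 x) /\ is_derive f1 x (f2 x).

Lemma mvt_strict (f df : R -> R) (x y : R) :
  x < y -> (forall t, x <= t <= y -> is_derive f t (df t)) ->
  exists c, x < c < y /\ f y - f x = df c * (y - x).
Proof.
intros hxy hd.
destruct (MVT_cor2 f df x y hxy) as [c [hc hi]].
- intros t ht. apply is_derive_Reals, hd, ht.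
- exists c. split; assumption.
Qed.

Lemma derive_ge0_le (f df : R -> R) (x y : R) :
  x <= y -> (forall t, x <= t <= y -> is_derive f t (df t)) ->
  (forall t, x <= t <= y -> 0 <= df t) -> f x <= f y.
Proof.
intros hxy hd hp.
destruct (Req_dec x y) as [->|hne]; [lra|].
destruct (mvt_strict f df x y) as [c [hc e]]; [lra|exact hd|].
assert (0 <= df c) by (apply hp; lra). nra.
Qed.

Lemma abs_increment_le (f df g dg : R -> R) (x y : R) :
  x <= y -> (forall t, x <= t <= y -> is_derive f t (df t)) ->
  (forall t, x <= t <= y -> is_derive g t (dg t)) ->
  (forall t, x <= t <= y -> Rabs (df t) <= dg t) ->
  Rabs (f y - f x) <= g y - g x.
Proof.
intros hxy hf hg hle.
apply Rabs_le. split.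
- enough (g x + f x <= g y + f y) by lra.
  apply (derive_ge0_le (fun t => g t + f t) (fun t => dg t + df t)); auto.
  + intros t ht. apply (is_derive_plus g f t (dg t) (df t)); auto.
  + intros t ht. generalize (hle t ht). unfold Rabs. destruct Rcase_abs; lra.
- enough (g x - f x <= g y - f y) by lra.
  apply (derive_ge0_le (fun t => g t - f t) (fun t => dg t - df t)); auto.
  + intros t ht. apply (is_derive_minus g f t (dg t) (df t)); auto.
  + intros t ht. generalize (hle t ht). unfold Rabs. destruct Rcase_abs; lra.
Qed.

Lemma is_derive_continuity_pt (f : R -> R) (x d : R) :
  is_derive f x d -> continuity_pt f x.
Proof.
intros h. apply derivable_continuous_pt. exists d. apply is_derive_Reals, h.
Qed.

(** A positive maximum is impossible because [f] is strictly convex around it. The slope conditions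
    at the ends keep the argument valid when the maximum sits on the boundary. *)
Lemma max_principle (f f1 f2 : R -> R) (x0 l : R) :
  x0 < l ->
  (forall x, x0 <= x <= l -> is_derive f x (f1 x) /\ is_derive f1 x (f2 x)) ->
  (forall x, x0 <= x <= l -> 0 < f x -> 0 < f2 x) ->
  (f x0 <= 0 \/ 0 <= f1 x0) -> f1 l <= 0 ->
  forall x, x0 <= x <= l -> f x <= 0.
Proof.
intros hl hd hpos h0 h1 x hx.
destruct (Rle_dec (f x) 0) as [h|h]; [exact h|exfalso].
assert (hcont : forall c, x0 <= c <= l -> continuity_pt f c).
{ intros c hc. apply is_derive_continuity_pt with (f1 c). apply hd, hc. }
destruct (continuity_ab_maj f x0 l) as [M [hM hMi]]; [lra|exact hcont|].
assert (hfM : 0 < f M) by (generalize (hM x hx); lra).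
assert (hnear : exists d, 0 < d /\
   forall y, Rabs (y - M) < d -> 0 < f y).
{ destruct (hcont M hMi (f M) hfM) as [d [hd0 hd1]].
  exists d. split; [exact hd0|]. intros y hy.
  destruct (Req_dec M y) as [<-|hne]; [exact hfM|].
  specialize (hd1 y). simpl in hd1. unfold R_dist, D_x, no_cond in hd1.
  assert (hlt : Rabs (f y - f M) < f M) by (apply hd1; auto).
  apply Rabs_def2 in hlt. lra. }
destruct hnear as [d [hd0 hd1]].
(* The sign of [f1 M] selects the side to inspect: with nonpositive slope at [M], strict convexity
   makes the slope negative just to the left, so [f] exceeds its maximum there. [caseB] is the
   mirror image. *)
assert (caseA : x0 < M -> f1 M <= 0 -> False).
{ intros hxM hfM1.
  set (y := Rmax x0 (M - d / 2)).
  assert (hy : x0 <= y /\ M - d / 2 <= y /\ y < M).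
  { unfold y, Rmax. destruct Rle_dec; lra. }
  destruct (mvt_strict f f1 y M) as [c [hc e]]; [lra| |].
  { intros t ht. apply hd. lra. }
  destruct (mvt_strict f1 f2 c M) as [c' [hc' e']]; [lra| |].
  { intros t ht. apply hd. lra. }
  assert (0 < f2 c').
  { apply hpos; [lra|]. apply hd1. rewrite Rabs_left; lra. }
  assert (f y <= f M) by (apply hM; lra).
  assert (f1 c < 0) by nra. nra. }
assert (caseB : M < l -> 0 <= f1 M -> False).
{ intros hxM hfM1.
  set (y := Rmin l (M + d / 2)).
  assert (hy : y <= l /\ y <= M + d / 2 /\ M < y).
  { unfold y, Rmin. destruct Rle_dec; lra. }
  destruct (mvt_strict f f1 M y) as [c [hc e]]; [lra| |].
  { intros t ht. apply hd. lra. }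
  destruct (mvt_strict f1 f2 M c) as [c' [hc' e']]; [lra| |].
  { intros t ht. apply hd. lra. }
  assert (0 < f2 c').
  { apply hpos; [lra|]. apply hd1. rewrite Rabs_right; lra. }
  assert (f y <= f M) by (apply hM; lra).
  assert (0 < f1 c) by nra. nra. }
destruct (Req_dec M l) as [->|hMl].
{ apply caseA; lra. }
destruct (Req_dec M x0) as [->|hMx].
{ destruct h0; [lra|]. apply caseB; lra. }
destruct (Rle_dec (f1 M) 0); [apply caseA|apply caseB]; lra.
Qed.

(** Gronwall's inequality: [F t * exp (- k * t)] is nonincreasing. *)
Lemma exp_growth (F F1 : R -> R) (k X : R) :
  (forall x, 0 <= x <= X -> is_derive F x (F1 x)) ->
  (forall x, 0 <= x <= X -> F1 x <= k * F x) ->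
  forall x, 0 <= x <= X -> F x <= F 0 * exp (k * x).
Proof.
intros hd hle x hx.
assert (h : - (F 0 * exp (- k * 0)) <= - (F x * exp (- k * x))).
{ apply (derive_ge0_le (fun t => - (F t * exp (- k * t)))
   (fun t => - (F1 t * exp (- k * t) + F t * (- k * exp (- k * t))))).
  - lra.
  - intros t ht.
    assert (ht' : 0 <= t <= X) by lra. specialize (hd t ht').
    assert (he : is_derive (fun t => exp (- k * t)) t (- k * exp (- k * t))).
    { auto_derive; [trivial|]. ring. }
    apply (is_derive_opp (fun t => F t * exp (- k * t))).
    apply (is_derive_mult F (fun t => exp (- k * t)) t (F1 t)
      (- k * exp (- k * t))); auto.
    intros; apply Rmult_comm.
  - intros t ht. assert (ht' : 0 <= t <= X) by lra.
    generalize (hle t ht') (exp_pos (- k * t)). nra. }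
rewrite Rmult_0_r, exp_0 in h.
assert (he : exp (- k * x) * exp (k * x) = 1).
{ rewrite <- exp_plus. replace (- k * x + k * x) with 0 by ring. apply exp_0. }
generalize (exp_pos (k * x)). intros hp.
assert (F x * (exp (- k * x) * exp (k * x)) <= F 0 * exp (k * x)) by nra.
rewrite he in H. lra.
Qed.

Lemma convex_nonneg (E E1 E2 : R -> R) :
  derivs2 E E1 E2 -> (forall x, 0 <= E2 x) -> E 0 = 0 -> E1 0 = 0 ->
  forall x, 0 <= E x.
Proof.
intros hd h2 h0 h1 x.
assert (hp : forall t, 0 <= t -> 0 <= E1 t).
{ intros t ht. rewrite <- h1.
  apply (derive_ge0_le E1 E2); auto. intros; apply hd. }
assert (hn : forall t, t <= 0 -> E1 t <= 0).
{ intros t ht. rewrite <- h1.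
  apply (derive_ge0_le E1 E2); auto. intros; apply hd. }
destruct (Rle_dec 0 x).
- rewrite <- h0. apply (derive_ge0_le E E1); auto.
  + intros; apply hd.
  + intros; apply hp; lra.
- enough (- E x <= - E 0) by lra.
  apply (derive_ge0_le (fun t => - E t) (fun t => - E1 t)); [lra| |].
  + intros t _. apply (is_derive_opp E). apply hd.
  + intros t ht. generalize (hn t). lra.
Qed.

(** * Fixed points and initial value problems *)

Lemma le_of_le_eps_mult (x w : R) :
  0 <= w -> (forall e, 0 < e -> x <= e * w) -> x <= 0.
Proof.
intros hw h. destruct (Rle_dec x 0) as [|hx]; [assumption|exfalso].
assert (hx' : 0 < x) by lra.
assert (he : 0 < x / (2 * (w + 1))) by (apply Rdiv_lt_0_compat; lra).
specialize (h _ he).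
assert (e : x / (2 * (w + 1)) * (2 * (w + 1)) = x) by (field; lra).
nra.
Qed.

(* [Rel] stands for the graph of the map: the values of the maps below are only
   known to exist. *)
Lemma weighted_banach (T : Type) (wt : T -> R) (P : (T -> R) -> Prop)
    (Rel : (T -> R) -> (T -> R) -> Prop) (F0 : T -> R) (d0 k : R) :
  0 <= k < 1 -> 0 <= d0 -> (forall t, 0 <= wt t) -> P F0 ->
  (forall F, P F -> exists G, P G /\ Rel F G) ->
  (forall G, Rel F0 G -> forall t, Rabs (G t - F0 t) <= d0 * wt t) ->
  (forall s F, (forall n : nat, P (s n)) ->
    (forall e, 0 < e -> exists N : nat, forall n, (N <= n)%nat ->
      forall t, Rabs (s n t - F t) <= e * wt t) -> P F) ->
  (forall F F' G G' d, P F -> P F' -> Rel F G -> Rel F' G' -> 0 <= d ->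
    (forall t, Rabs (F t - F' t) <= d * wt t) ->
    forall t, Rabs (G t - G' t) <= k * d * wt t) ->
  exists F, P F /\ Rel F F.
Proof.
intros hk hd0 hwt hF0 hex hinit hclosed hcontr.
assert (hnext : forall F : {F | P F}, {G : {F | P F} | Rel (proj1_sig F) (proj1_sig G)}).
{ intros [F hF]. apply constructive_indefinite_description.
  destruct (hex F hF) as [G [hG1 hG2]]. exists (exist _ G hG1). exact hG2. }
set (s := fix s n := match n with O => exist P F0 hF0
  | S n => proj1_sig (hnext (s n)) end).
set (u := fun n => proj1_sig (s n)).
assert (huP : forall n, P (u n)) by (intros n; exact (proj2_sig (s n))).
assert (huR : forall n, Rel (u n) (u (S n))).
{ intros n. exact (proj2_sig (hnext (s n))). }
assert (hkn : forall n, 0 <= k ^ n) by (intros; apply pow_le; lra).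
assert (hstep : forall n t, Rabs (u (S n) t - u n t) <= k ^ n * d0 * wt t).
{ induction n as [|n IH]; intros t.
  - simpl. rewrite Rmult_1_l. apply (hinit (u 1%nat)). apply (huR 0%nat).
  - replace (k ^ S n * d0 * wt t) with (k * (k ^ n * d0) * wt t)
      by (simpl; ring).
    apply (hcontr (u (S n)) (u n) (u (S (S n))) (u (S n))); auto.
    generalize (hkn n). nra. }
(* Tail of the geometric series: [b n - b (S n)] is exactly [k ^ n * d0], the bound on the [n]-th
   increment, so the increments telescope. *)
set (b := fun n => k ^ n * (d0 / (1 - k))).
assert (hdk : 0 <= d0 / (1 - k)).
{ apply Rmult_le_pos; [lra|]. left. apply Rinv_0_lt_compat. lra. }
assert (hcau : forall n p t, Rabs (u (n + p)%nat t - u n t) <=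
   (b n - b (n + p)%nat) * wt t).
{ intros n p t. induction p as [|p IH].
  - rewrite Nat.add_0_r, !Rminus_diag, Rabs_R0, Rmult_0_l. lra.
  - rewrite Nat.add_succ_r.
    replace (u (S (n + p)) t - u n t) with
      ((u (S (n + p)%nat) t - u (n + p)%nat t) + (u (n + p)%nat t - u n t)) by ring.
    eapply Rle_trans; [apply Rabs_triang|].
    specialize (hstep (n + p)%nat t).
    assert (e : b (n + p)%nat - b (S (n + p)) = k ^ (n + p) * d0).
    { unfold b. simpl. field. lra. }
    assert (e' : (b n - b (S (n + p))) * wt t =
      k ^ (n + p) * d0 * wt t + (b n - b (n + p)%nat) * wt t).
    { rewrite <- e. ring. }
    lra. }
assert (hbpos : forall n, 0 <= b n).
{ intros n. unfold b. generalize (hkn n). nra. }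
assert (hcau2 : forall n q t, (n <= q)%nat -> Rabs (u q t - u n t) <= b n * wt t).
{ intros n q t hnq. replace q with (n + (q - n))%nat by lia.
  eapply Rle_trans; [apply hcau|].
  generalize (hbpos (n + (q - n))%nat) (hwt t). nra. }
assert (hbsmall : forall e, 0 < e -> exists N, forall n, (N <= n)%nat -> b n <= e).
{ intros e he.
  assert (he' : 0 < e / (d0 / (1 - k) + 1)) by (apply Rdiv_lt_0_compat; lra).
  destruct (pow_lt_1_zero k) with (y := e / (d0 / (1 - k) + 1)) as [N hN].
  - rewrite Rabs_right; lra.
  - exact he'.
  - exists N. intros n hn. specialize (hN n hn).
    rewrite Rabs_right in hN by (apply Rle_ge, hkn).
    unfold b.
    assert (ee : e / (d0 / (1 - k) + 1) * (d0 / (1 - k) + 1) = e) by (field; lra).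
    generalize (hkn n). nra. }
assert (hlim : forall t, {l : R | Un_cv (fun n => u n t) l}).
{ intros t. apply Rcomplete.R_complete. intros e he.
  destruct (hbsmall (e / (4 * (wt t + 1)))) as [N hN].
  { generalize (hwt t). intros. apply Rdiv_lt_0_compat; lra. }
  exists N. intros n q hn hq. unfold R_dist.
  replace (u n t - u q t) with ((u n t - u N t) - (u q t - u N t)) by ring.
  eapply Rle_lt_trans; [apply Rabs_triang|]. rewrite Rabs_Ropp.
  generalize (hcau2 N n t hn) (hcau2 N q t hq) (hN N (le_n _)) (hwt t).
  intros h1 h2 h3 h4.
  assert (e / (4 * (wt t + 1)) * (4 * (wt t + 1)) = e) by (field; lra).
  assert (b N * wt t <= e / (4 * (wt t + 1)) * wt t) by nra.
  nra. }
set (F := fun t => proj1_sig (hlim t)).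
assert (hF : forall n t, Rabs (u n t - F t) <= b n * wt t).
{ intros n t. apply Rnot_lt_le. intros hlt.
  destruct (proj2_sig (hlim t) (Rabs (u n t - F t) - b n * wt t)) as [N hN]; [lra|].
  specialize (hN (n + N)%nat ltac:(lia)). unfold R_dist in hN. fold (F t) in hN.
  generalize (hcau2 n (n + N)%nat t ltac:(lia)). intros h.
  replace (u n t - F t) with (- (u (n + N)%nat t - u n t) + (u (n + N)%nat t - F t)) in hN by ring.
  generalize (Rabs_triang (- (u (n + N)%nat t - u n t)) (u (n + N)%nat t - F t)).
  rewrite Rabs_Ropp. lra. }
assert (hunif : forall e, 0 < e -> exists N : nat, forall n, (N <= n)%nat ->
      forall t, Rabs (u n t - F t) <= e * wt t).
{ intros e he. destruct (hbsmall e he) as [N hN]. exists N. intros n hn t.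
  eapply Rle_trans; [apply hF|]. apply Rmult_le_compat_r; auto. }
assert (hPF : P F) by (apply (hclosed u); assumption).
destruct (hex F hPF) as [G [hG1 hG2]].
(* Any image [G] of the limit is [F] itself: [u (S N)] is close to [F] by convergence, and close to
   [G] by contraction applied to [u N] and [F]. *)
assert (e : G = F).
{ apply functional_extensionality. intros t.
  assert (hz : Rabs (G t - F t) <= 0).
  { apply le_of_le_eps_mult with (wt t); [apply hwt|]. intros e he.
    destruct (hunif (e / 2)) as [N hN]; [lra|].
    assert (h1 : Rabs (u (S N) t - G t) <= k * (e / 2) * wt t).
    { apply (hcontr (u N) F); auto. lra. }
    generalize (hN (S N) ltac:(lia) t). intros h2.
    replace (G t - F t) with (- (u (S N) t - G t) + (u (S N) t - F t)) by ring.
    eapply Rle_trans; [apply Rabs_triang|]. rewrite Rabs_Ropp.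
    assert (k * (e / 2) * wt t <= e / 2 * wt t).
    { generalize (hwt t). intros. apply Rmult_le_compat_r; nra. }
    lra. }
  generalize (Rabs_pos (G t - F t)). intros.
  apply Rminus_diag_uniq. destruct (Req_dec (G t - F t) 0) as [|hne]; [assumption|].
  apply Rabs_no_R0 in hne. lra. }
subst G. exists F. split; assumption.
Qed.

Definition cont (f : R -> R) : Prop := forall x, continuous f x.

Lemma double_antiderivative (h : R -> R) (y0 : R) : cont h ->
  exists f f1, derivs2 f f1 h /\ f 0 = y0 /\ f1 0 = 0.
Proof.
assert (hanti : forall g y, cont g -> exists f, (forall x, is_derive f x (g x)) /\ f 0 = y).
{ intros g y hg. exists (fun x => y + RInt g 0 x). split.
  - intros x. rewrite <- (Rplus_0_l (g x)).
    apply (is_derive_plus (fun _ => y) (RInt g 0) x 0 (g x)).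
    + apply is_derive_Reals, derivable_pt_lim_const.
    + apply (is_derive_RInt g (RInt g 0) 0 x); [|apply hg].
      apply filter_forall. intros z. apply (@RInt_correct R_CompleteNormedModule).
      apply (ex_RInt_continuous (V := R_CompleteNormedModule)). intros; apply hg.
  - rewrite RInt_point. unfold zero; simpl. ring. }
intros hh. destruct (hanti h 0 hh) as [f1 [hf1 hf10]].
destruct (hanti f1 y0) as [f [hf hf0]].
- intros x. apply (ex_derive_continuous f1). exists (h x). apply hf1.
- exists f, f1. split; [|split; assumption].
  intros x. split; [apply hf|apply hf1].
Qed.

Lemma derivs2_cont (f f1 f2 : R -> R) : derivs2 f f1 f2 -> cont f.
Proof.
intros hd x. apply (ex_derive_continuous f). exists (f1 x). apply hd.
Qed.

Lemma derivs2_comb (a b : R) (f f1 f2 g g1 g2 : R -> R) :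
  derivs2 f f1 f2 -> derivs2 g g1 g2 ->
  derivs2 (fun x => a * f x + b * g x) (fun x => a * f1 x + b * g1 x)
    (fun x => a * f2 x + b * g2 x).
Proof.
intros hf hg x. destruct (hf x), (hg x). split.
- apply (is_derive_plus (fun x => a * f x) (fun x => b * g x) x (a * f1 x) (b * g1 x));
  apply is_derive_scal; assumption.
- apply (is_derive_plus (fun x => a * f1 x) (fun x => b * g1 x) x (a * f2 x) (b * g2 x));
  apply is_derive_scal; assumption.
Qed.

Lemma derivs2_ext (f f1 f2 g g1 g2 : R -> R) :
  (forall x, f x = g x) -> (forall x, f1 x = g1 x) -> (forall x, f2 x = g2 x) ->
  derivs2 f f1 f2 -> derivs2 g g1 g2.
Proof.
intros e0 e1 e2. apply functional_extensionality in e0, e1, e2. now subst.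
Qed.

Lemma derivs2_const (c : R) : derivs2 (fun _ => c) (fun _ => 0) (fun _ => 0).
Proof.
intros x. split; apply is_derive_Reals, derivable_pt_lim_const.
Qed.

Lemma derivs2_minus (f f1 f2 g g1 g2 : R -> R) :
  derivs2 f f1 f2 -> derivs2 g g1 g2 ->
  derivs2 (fun x => f x - g x) (fun x => f1 x - g1 x) (fun x => f2 x - g2 x).
Proof.
intros hf hg. generalize (derivs2_comb 1 (-1) _ _ _ _ _ _ hf hg).
apply derivs2_ext; intros; ring.
Qed.

Lemma derivs2_twice_derivable (f f1 f2 : R -> R) : derivs2 f f1 f2 ->
  twice_derivable f /\ forall x, Derive_n f 2 x = f2 x.
Proof.
intros hd.
assert (e : Derive f = f1).
{ apply functional_extensionality. intros x. apply is_derive_unique, hd. }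
assert (hd2 : forall x, is_derive (Derive f) x (f2 x)) by (rewrite e; apply hd).
split.
- intros x. split.
  + exists (f1 x). apply hd.
  + exists (f2 x). apply hd2.
- intros x. exact (is_derive_unique _ _ _ (hd2 x)).
Qed.

Lemma cosh_derivs2 (k : R) :
  derivs2 (fun x => cosh (k * x)) (fun x => k * sinh (k * x))
    (fun x => k ^ 2 * cosh (k * x)).
Proof.
intros x. unfold cosh, sinh. split; auto_derive; trivial; field.
Qed.

Lemma cosh_ge1 (x : R) : 1 <= cosh x.
Proof.
unfold cosh. generalize (exp_pos x) (exp_pos (- x)). intros h1 h2.
assert (e : exp x * exp (- x) = 1).
{ rewrite <- exp_plus, Rplus_opp_r. apply exp_0. }
generalize (pow2_ge_0 (exp x - exp (- x))). nra.
Qed.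

(** The functions [d / k ^ 2 * (cosh (k * x) - 1)] plus or minus [f] are convex and vanish to first
    order at [0]. The gain [1 / k ^ 2] is what makes the Picard map contract for large [k]. *)
Lemma double_integral_bound (f f1 f2 : R -> R) (d k : R) :
  0 < k -> derivs2 f f1 f2 -> f 0 = 0 -> f1 0 = 0 ->
  (forall x, Rabs (f2 x) <= d * cosh (k * x)) ->
  forall x, Rabs (f x) <= d / k ^ 2 * cosh (k * x).
Proof.
intros hk hf h0 h1 h2 x.
assert (hd : 0 <= d).
{ generalize (h2 0) (Rabs_pos (f2 0)). rewrite Rmult_0_r, cosh_0. lra. }
assert (hdk : 0 <= d / k ^ 2).
{ apply Rmult_le_pos; [exact hd|]. left. apply Rinv_0_lt_compat. nra. }
assert (hcancel : forall c, d / k ^ 2 * (k ^ 2 * c) = d * c).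
{ intros c. field. lra. }
assert (hone := derivs2_const (d / k ^ 2)).
generalize (derivs2_comb 1 (-1) _ _ _ _ _ _ 
  (derivs2_comb (d / k ^ 2) 1 _ _ _ _ _ _ (cosh_derivs2 k) hf) hone). intros hp.
generalize (derivs2_comb 1 (-1) _ _ _ _ _ _ 
  (derivs2_comb (d / k ^ 2) (-1) _ _ _ _ _ _ (cosh_derivs2 k) hf) hone). intros hm.
apply convex_nonneg with (x := x) in hp; [apply convex_nonneg with (x := x) in hm|..].
- apply Rabs_le. lra.
- intros y. generalize (h2 y) (hcancel (cosh (k * y))). unfold Rabs.
  destruct Rcase_abs; lra.
- rewrite Rmult_0_r, cosh_0, h0. ring.
- rewrite Rmult_0_r, sinh_0, h1. ring.
- intros y. generalize (h2 y) (hcancel (cosh (k * y))). unfold Rabs.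
  destruct Rcase_abs; lra.
- rewrite Rmult_0_r, cosh_0, h0. ring.
- rewrite Rmult_0_r, sinh_0, h1. ring.
Qed.

(** The weight may be unbounded, but it is continuous, hence below [w x + 1] near [x]; convergence
    is therefore uniform near each point. *)
Lemma cont_locally_uniform_limit (s : nat -> R -> R) (f w : R -> R) :
  (forall n, cont (s n)) -> cont w -> (forall x, 0 <= w x) ->
  (forall e, 0 < e -> exists N : nat, forall n, (N <= n)%nat ->
      forall x, Rabs (s n x - f x) <= e * w x) -> cont f.
Proof.
intros hs hw hw0 hlim x.
apply continuity_pt_filterlim. 
intros e he.
destruct (proj2 (continuity_pt_filterlim w x) (hw x) 1) as [d1 [hd1 hd1']]; [lra|].
destruct (hlim (e / (4 * (w x + 1)))) as [N hN].
{ generalize (hw0 x). intros. apply Rdiv_lt_0_compat; lra. }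
specialize (hN N (le_n _)).
destruct (proj2 (continuity_pt_filterlim (s N) x) (hs N x) (e / 4)) as [d2 [hd2 hd2']]; [lra|].
exists (Rmin d1 d2). split; [apply Rmin_pos; lra|].
intros y [hy1 hy2]. simpl in *. unfold R_dist in *.
generalize (hd1' y (conj hy1 (Rlt_le_trans _ _ _ hy2 (Rmin_l _ _)))). intros g1.
generalize (hd2' y (conj hy1 (Rlt_le_trans _ _ _ hy2 (Rmin_r _ _)))). intros g2.
generalize (hN x) (hN y) (hw0 x) (hw0 y). intros g3 g4 g5 g6.
assert (ee : e / (4 * (w x + 1)) * (4 * (w x + 1)) = e) by (field; lra).
apply Rabs_def2 in g1.
assert (hc : 0 < e / (4 * (w x + 1))) by (apply Rdiv_lt_0_compat; lra).
set (c := e / (4 * (w x + 1))) in *.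
assert (g7 : c * w x < e / 4) by nra.
assert (g8 : c * w y < e / 4) by nra.
replace (f y - f x) with ((s N y - s N x) + (s N x - f x) + - (s N y - f y)) by ring.
eapply Rle_lt_trans; [apply Rabs_triang|]. rewrite Rabs_Ropp.
generalize (Rabs_triang (s N y - s N x) (s N x - f x)). lra.
Qed.

(* In the norm weighted by [cosh (k * x)], [k] large, the Picard map contracts on
   all of [R]. *)
Lemma linear_ivp_exists (Q g : R -> R) (q0 g0 y0 : R) :
  cont Q -> cont g -> (forall x, Rabs (Q x) <= q0) -> (forall x, Rabs (g x) <= g0) ->
  exists p p1, derivs2 p p1 (fun x => Q x * p x + g x) /\ p 0 = y0 /\ p1 0 = 0.
Proof.
intros hQ hg hq0 hg0.
assert (hq0' : 0 <= q0) by (generalize (hq0 0) (Rabs_pos (Q 0)); lra).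
assert (hg0' : 0 <= g0) by (generalize (hg0 0) (Rabs_pos (g 0)); lra).
(* Large enough for the contraction factor [q0 / k ^ 2] to be at most [1 / 2]. *)
set (k := 2 * (q0 + 1)).
assert (hk : 0 < k) by (unfold k; lra).
assert (hkq : q0 / k ^ 2 <= 1 / 2).
{ apply Rmult_le_reg_r with (k ^ 2); [nra|]. unfold k.
  replace (q0 / (2 * (q0 + 1)) ^ 2 * (2 * (q0 + 1)) ^ 2) with q0 by (field; lra). nra. }
assert (hwc : cont (fun x => cosh (k * x))) by apply (derivs2_cont _ _ _ (cosh_derivs2 k)).
assert (hw1 : forall x, 1 <= cosh (k * x)) by (intros; apply cosh_ge1).
assert (hrhs : forall F, cont F -> cont (fun x => Q x * F x + g x)).
{ intros F hF x. apply (continuous_plus (fun x => Q x * F x) g).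
  - apply (continuous_mult Q F); auto.
  - apply hg. }
destruct (weighted_banach R (fun x => cosh (k * x)) cont
  (fun F G => exists G1, derivs2 G G1 (fun x => Q x * F x + g x) /\ G 0 = y0 /\ G1 0 = 0)
  (fun _ => 0) (Rabs y0 + g0 / k ^ 2) (1 / 2)) as [F [hF [F1 hF1]]].
- lra.
- apply Rplus_le_le_0_compat; [apply Rabs_pos|].
  apply Rmult_le_pos; [lra|]. left; apply Rinv_0_lt_compat; nra.
- intros x. generalize (hw1 x). lra.
- intros x. apply continuous_const.
- intros F hF. destruct (double_antiderivative _ y0 (hrhs F hF)) as [G [G1 [h1 h2]]].
  exists G. split; [exact (derivs2_cont _ _ _ h1)|]. exists G1. split; assumption.
- intros G [G1 [h1 [h2 h3]]] x.
  assert (hone := derivs2_const y0).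
  generalize (derivs2_comb 1 (-1) _ _ _ _ _ _ h1 hone). intros h4.
  apply double_integral_bound with (d := g0) (k := k) (x := x) in h4; try assumption.
  + rewrite Rminus_0_r.
    replace (G x) with (y0 + (1 * G x + -1 * y0)) by ring.
    eapply Rle_trans; [apply Rabs_triang|].
    generalize (hw1 x) (Rabs_pos y0). nra.
  + rewrite h2. ring.
  + rewrite h3. ring.
  + intros y. rewrite Rmult_0_r, Rplus_0_l, Rmult_0_r, Rplus_0_r, Rmult_1_l.
    generalize (hg0 y) (hw1 y). nra.
- intros s F hs hlim. apply cont_locally_uniform_limit with (s := s) (w := fun x => cosh (k * x)); auto.
  intros x. generalize (hw1 x). lra.
- intros F F' G G' d hF hF' [G1 [h1 [h2 h3]]] [G1' [h1' [h2' h3']]] hd hle x.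
  generalize (derivs2_comb 1 (-1) _ _ _ _ _ _ h1 h1'). intros h4.
  apply double_integral_bound with (d := q0 * d) (k := k) (x := x) in h4; try assumption.
  + replace (G x - G' x) with (1 * G x + -1 * G' x) by ring.
    eapply Rle_trans; [apply h4|]. apply Rmult_le_compat_r; [generalize (hw1 x); lra|].
    replace (q0 * d / k ^ 2) with (q0 / k ^ 2 * d) by (field; lra).
    apply Rmult_le_compat_r; assumption.
  + rewrite h2, h2'. ring.
  + rewrite h3, h3'. ring.
  + intros y.
    replace (1 * (Q y * F y + g y) + -1 * (Q y * F' y + g y)) with (Q y * (F y - F' y)) by ring.
    rewrite Rabs_mult, Rmult_assoc.
    apply Rmult_le_compat; auto using Rabs_pos.
- exists F, F1. exact hF1.
Qed.

(** * Even periodic boundary value problems *)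

(** Distance from [x] to the nearest multiple of [2 * l], the integer part of [y + 1 / 2] being a
    rounding of [y]. Composition with it extends a function on [[0, l]] to an even periodic one, and
    reduces estimates for even periodic functions to [[0, l]]. *)
Definition fold (l x : R) : R :=
  Rabs (x - 2 * l * IZR (Int_part (x / (2 * l) + 1 / 2))).

Lemma fold_bounds (l x : R) : 0 < l -> 0 <= fold l x <= l.
Proof.
intros hl. split; [apply Rabs_pos|].
destruct (base_Int_part (x / (2 * l) + 1 / 2)) as [h1 h2].
unfold fold. set (n := IZR (Int_part _)) in *.
assert (e : x = 2 * l * (x / (2 * l))) by (field; lra).
set (y := x / (2 * l)) in *. rewrite e.
assert (0 <= 2 * l * (y + 1 / 2 - n)) by (apply Rmult_le_pos; lra).
assert (0 <= 2 * l * (1 - (y + 1 / 2 - n))) by (apply Rmult_le_pos; lra).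
apply Rabs_le. lra.
Qed.

(** This minimality over all multiples is what yields evenness, periodicity and the Lipschitz
    continuity of [fold]: each follows by choosing a suitable [n]. *)
Lemma fold_le (l x : R) (n : Z) : 0 < l -> fold l x <= Rabs (x - 2 * l * IZR n).
Proof.
intros hl. generalize (proj2 (fold_bounds l x hl)). unfold fold.
set (k := Int_part _). intros hk.
destruct (Z.eq_dec n k) as [->|hne]; [lra|].
assert (h : l <= Rabs (x - 2 * l * IZR n)); [|lra].
apply Rabs_le_between in hk.
destruct (Z_lt_le_dec n k) as [hlt|hle].
- assert (hz : IZR n <= IZR k - 1) by (rewrite <- minus_IZR; apply IZR_le; lia).
  eapply Rle_trans; [|apply Rle_abs]. nra.
- assert (hz : IZR k + 1 <= IZR n) by (rewrite <- plus_IZR; apply IZR_le; lia).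
  rewrite <- Rabs_Ropp. eapply Rle_trans; [|apply Rle_abs]. nra.
Qed.

Lemma fold_id (l x : R) : 0 < l -> 0 <= x <= l -> fold l x = x.
Proof.
intros hl hx. apply Rle_antisym.
- eapply Rle_trans; [apply (fold_le l x 0 hl)|].
  rewrite Rmult_0_r, Rminus_0_r, Rabs_right; lra.
- unfold fold. set (k := Int_part _).
  destruct (Z_lt_le_dec k 1) as [h|h].
  + assert (IZR k <= 0) by (apply IZR_le; lia).
    eapply Rle_trans; [|apply Rle_abs]. nra.
  + assert (1 <= IZR k) by (apply IZR_le; lia).
    rewrite <- Rabs_Ropp. eapply Rle_trans; [|apply Rle_abs]. nra.
Qed.

Lemma fold_opp (l x : R) : 0 < l -> fold l (- x) = fold l x.
Proof.
intros hl.
assert (h : forall y, fold l (- y) <= fold l y).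
{ intros y. unfold fold at 2. rewrite <- Rabs_Ropp.
  set (k := Int_part _). replace (- (y - 2 * l * IZR k)) with (- y - 2 * l * IZR (- k)).
  - apply fold_le, hl.
  - rewrite opp_IZR. ring. }
apply Rle_antisym; [apply h|]. generalize (h (- x)). now rewrite Ropp_involutive.
Qed.

Lemma fold_period (l x : R) : 0 < l -> fold l (x + 2 * l) = fold l x.
Proof.
intros hl. apply Rle_antisym.
- unfold fold at 2. set (k := Int_part _).
  replace (x - 2 * l * IZR k) with (x + 2 * l - 2 * l * IZR (k + 1)).
  + apply fold_le, hl.
  + rewrite plus_IZR. ring.
- unfold fold at 2. set (k := Int_part _).
  replace (x + 2 * l - 2 * l * IZR k) with (x - 2 * l * IZR (k - 1)).
  + apply fold_le, hl.
  + rewrite minus_IZR. ring.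
Qed.

Lemma fold_cont (l : R) : 0 < l -> cont (fold l).
Proof.
intros hl x. apply continuity_pt_filterlim. intros e he.
exists e. split; [exact he|]. intros y [_ hy]. simpl in *. unfold R_dist in *.
assert (h : forall s t, fold l s - fold l t <= Rabs (s - t)).
{ intros s t. generalize (fold_le l s (Int_part (t / (2 * l) + 1 / 2)) hl).
  unfold fold at 3. set (k := Int_part _). intros h.
  replace (s - 2 * l * IZR k) with ((s - t) + (t - 2 * l * IZR k)) in h by ring.
  generalize (Rabs_triang (s - t) (t - 2 * l * IZR k)). lra. }
eapply Rle_lt_trans; [|exact hy]. apply Rabs_le.
generalize (h y x) (h x y). rewrite (Rabs_minus_sym x y). lra.
Qed.

Definition even_periodic (l : R) (f : R -> R) : Prop :=
  (forall x, f (- x) = f x) /\ (forall x, f (x + 2 * l) = f x).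

Lemma even_periodic_fold (l : R) (f : R -> R) (x : R) :
  even_periodic l f -> f x = f (fold l x).
Proof.
intros [he hp].
assert (hn : forall n y, f (y + 2 * l * INR n) = f y).
{ induction n as [|n IH]; intros y.
  - simpl. f_equal. ring.
  - rewrite S_INR. replace (y + 2 * l * (INR n + 1)) with (y + 2 * l * INR n + 2 * l) by ring.
    now rewrite hp. }
assert (hz : forall n y, f (y + 2 * l * IZR n) = f y).
{ intros n y. destruct (Z_lt_le_dec n 0) as [h|h].
  - rewrite <- (hn (Z.to_nat (- n)) (y + 2 * l * IZR n)). f_equal.
    rewrite INR_IZR_INZ, Z2Nat.id by lia. rewrite opp_IZR. ring.
  - rewrite <- (hn (Z.to_nat n) y). f_equal.
    rewrite INR_IZR_INZ, Z2Nat.id by lia. ring. }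
unfold fold. set (k := Int_part _).
assert (ha : forall y, f (Rabs y) = f y).
{ intros y. unfold Rabs. destruct Rcase_abs; auto. }
rewrite ha, <- (hz (- k)%Z x), opp_IZR. f_equal. ring.
Qed.

Lemma even_periodic_comp_fold (l : R) (f : R -> R) :
  0 < l -> even_periodic l (fun x => f (fold l x)).
Proof.
intros hl. split; intros x; [rewrite fold_opp|rewrite fold_period]; auto.
Qed.

Lemma cont_bounded_on (f : R -> R) (X : R) : 0 <= X -> cont f ->
  exists b, forall x, 0 <= x <= X -> Rabs (f x) <= b.
Proof.
intros hX hc.
destruct (continuity_ab_maj (fun x => Rabs (f x)) 0 X) as [M [hM _]]; [lra| |].
- intros x _. apply continuity_pt_comp with (f2 := Rabs).
  + apply continuity_pt_filterlim, hc.
  + apply Rcontinuity_abs.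
- exists (Rabs (f M)). exact hM.
Qed.

Lemma even_periodic_bounded (l : R) (f : R -> R) :
  0 < l -> cont f -> even_periodic l f -> exists b, forall x, Rabs (f x) <= b.
Proof.
intros hl hc hf.
destruct (cont_bounded_on f l ltac:(lra) hc) as [b hb].
exists b. intros x. rewrite (even_periodic_fold l f x hf). apply hb, fold_bounds, hl.
Qed.

Lemma derivs2_reflect (c : R) (f f1 f2 : R -> R) :
  derivs2 f f1 f2 ->
  derivs2 (fun x => f (c - x)) (fun x => - f1 (c - x)) (fun x => f2 (c - x)).
Proof.
intros hd x.
assert (hc : is_derive (fun x => c - x) x (-1)) by (auto_derive; trivial; ring).
destruct (hd (c - x)) as [h1 h2]. split.
- replace (- f1 (c - x)) with (-1 * f1 (c - x)) by ring.
  apply (is_derive_comp f (fun x => c - x) x (f1 (c - x)) (-1)); assumption.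
- replace (f2 (c - x)) with (- (-1 * f2 (c - x))) by ring.
  apply (is_derive_opp (fun x => f1 (c - x))).
  apply (is_derive_comp f1 (fun x => c - x) x (f2 (c - x)) (-1)); assumption.
Qed.

(** Gronwall applied to [p ^ 2 + p1 ^ 2 + g ^ 2]; the constant [g ^ 2] is included so that the
    forcing term [2 * p1 * g] is dominated by the energy itself. *)
Lemma energy_growth (p p1 p2 : R -> R) (k g X : R) :
  0 <= k -> 0 <= g -> derivs2 p p1 p2 ->
  (forall x, 0 <= x <= X -> Rabs (p2 x) <= k * Rabs (p x) + g) ->
  forall x, 0 <= x <= X ->
    p x ^ 2 + p1 x ^ 2 <= (p 0 ^ 2 + p1 0 ^ 2 + g ^ 2) * exp ((k + 2) * x).
Proof.
intros hk hg hd hle x hx.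
assert (h : p x ^ 2 + p1 x ^ 2 + g ^ 2 <= (p 0 ^ 2 + p1 0 ^ 2 + g ^ 2) * exp ((k + 2) * x)).
{ apply (exp_growth (fun x => p x ^ 2 + p1 x ^ 2 + g ^ 2)
   (fun x => 2 * p x * p1 x + 2 * p1 x * p2 x) (k + 2) X); [| |exact hx].
  - intros t _. destruct (hd t) as [h1 h2].
    replace (2 * p t * p1 t + 2 * p1 t * p2 t) with
      ((INR 2 * p1 t * p t ^ 1 + INR 2 * p2 t * p1 t ^ 1) + 0) by (simpl; ring).
    apply (is_derive_plus (fun x => p x ^ 2 + p1 x ^ 2) (fun _ => g ^ 2)).
    + apply (is_derive_plus (fun x => p x ^ 2) (fun x => p1 x ^ 2));
      apply is_derive_pow; assumption.
    + apply is_derive_Reals, derivable_pt_lim_const.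
  - intros t ht. specialize (hle t ht).
    rewrite <- (pow2_abs (p t)), <- (pow2_abs (p1 t)).
    assert (2 * p t * p1 t <= 2 * (Rabs (p t) * Rabs (p1 t))).
    { rewrite <- Rabs_mult. generalize (Rle_abs (p t * p1 t)). lra. }
    assert (p1 t * p2 t <= Rabs (p1 t) * (k * Rabs (p t) + g)).
    { eapply Rle_trans; [apply Rle_abs|]. rewrite Rabs_mult.
      apply Rmult_le_compat_l; [apply Rabs_pos|exact hle]. }
    set (P := Rabs (p t)) in *. set (P' := Rabs (p1 t)) in *.
    generalize (pow2_ge_0 (P - P')) (pow2_ge_0 (P' - g)). intros s1 s2.
    assert (k * (2 * (P * P')) <= k * (P ^ 2 + P' ^ 2)).
    { apply Rmult_le_compat_l; [exact hk|]. lra. }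
    assert (0 <= k * g ^ 2) by (generalize (pow2_ge_0 g); nra).
    nra. }
generalize (pow2_ge_0 g). lra.
Qed.

Lemma linear_ivp_unique (Q p p1 : R -> R) (q0 x0 : R) :
  derivs2 p p1 (fun x => Q x * p x) -> (forall x, Rabs (Q x) <= q0) ->
  p x0 = 0 -> p1 x0 = 0 -> forall x, p x = 0.
Proof.
intros hd hq h0 h1.
assert (hq0 : 0 <= q0) by (generalize (hq 0) (Rabs_pos (Q 0)); lra).
assert (key : forall c f f1 f2, derivs2 f f1 f2 -> f 0 = 0 -> f1 0 = 0 ->
  (forall x, Rabs (f2 x) <= q0 * Rabs (f x)) -> 0 <= c -> f c = 0).
{ intros c f f1 f2 hf e0 e1 hle hc.
  assert (h : f c ^ 2 + f1 c ^ 2 <= (f 0 ^ 2 + f1 0 ^ 2 + 0 ^ 2) * exp ((q0 + 2) * c)).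
  { apply (energy_growth f f1 f2 q0 0 c); auto; try lra.
    intros x _. generalize (hle x). lra. }
  rewrite e0, e1 in h.
  replace ((0 ^ 2 + 0 ^ 2 + 0 ^ 2) * exp ((q0 + 2) * c)) with 0 in h by ring.
  generalize (pow2_ge_0 (f c)) (pow2_ge_0 (f1 c)). intros.
  apply Rsqr_0_uniq. unfold Rsqr. nra. }
assert (hle : forall x, Rabs (Q x * p x) <= q0 * Rabs (p x)).
{ intros x. rewrite Rabs_mult. apply Rmult_le_compat_r; auto using Rabs_pos. }
intros x.
generalize (derivs2_reflect x0 _ _ _ hd). intros hr.
destruct (Rle_dec x x0).
- replace x with (x0 - (x0 - x)) by ring.
  apply (key (x0 - x) _ _ _ hr); try lra.
  + now rewrite Rminus_0_r.
  + rewrite Rminus_0_r, h1. ring.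
  + intros t. apply hle.
(* To the right of [x0], two reflections amount to a translation that moves the initial point to
   [0]. *)
- replace x with (x0 - (0 - (x - x0))) by ring.
  apply (key (x - x0) _ _ _ (derivs2_reflect 0 _ _ _ hr)); try lra.
  + now rewrite !Rminus_0_r.
  + rewrite !Rminus_0_r, h1. ring.
  + intros t. apply hle.
Qed.

(* Uniqueness for the initial value problem makes a solution with vanishing slope
   at [0] and [l] symmetric about both points, hence even and periodic. *)
Lemma even_periodic_bvp (l : R) (Q g : R -> R) :
  0 < l -> cont Q -> even_periodic l Q -> cont g -> even_periodic l g ->
  (forall p p1, derivs2 p p1 (fun x => Q x * p x) -> p1 0 = 0 -> p1 l = 0 ->
    p 0 = 0) ->
  exists p p1, derivs2 p p1 (fun x => Q x * p x + g x) /\ even_periodic l p /\ p1 0 = 0 /\ p1 l = 0.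
Proof.
intros hl hQ hQe hg hge huniq.
destruct (even_periodic_bounded l Q hl hQ hQe) as [q0 hq0].
destruct (even_periodic_bounded l g hl hg hge) as [g0 hg0].
assert (h00 : forall x, Rabs ((fun _ : R => 0) x) <= 0) by (intros; rewrite Rabs_R0; lra).
destruct (linear_ivp_exists Q g q0 g0 0 hQ hg hq0 hg0) as [y [y1 [hy [hy0 hy1]]]].
destruct (linear_ivp_exists Q (fun _ => 0) q0 0 1 hQ) as [e [e1 [he [he0 he1]]]]; auto.
{ intros x. apply continuous_const. }
(* Shooting: [y] and [e] both leave [0] with slope [0], and [c] is chosen so that [y + c * e] also
   has slope [0] at [l]. This fails only if [e] solves the homogeneous problem, which [huniq] rules
   out because [e 0 = 1]. *)
assert (he1l : e1 l <> 0).
{ intros h. assert (e 0 = 0); [|lra]. apply (huniq e e1); auto.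
  revert he. apply derivs2_ext; auto. intros; ring. }
set (c := - y1 l / e1 l).
set (p := fun x => 1 * y x + c * e x). set (p1 := fun x => 1 * y1 x + c * e1 x).
assert (hp : derivs2 p p1 (fun x => Q x * p x + g x)).
{ generalize (derivs2_comb 1 c _ _ _ _ _ _ hy he). apply derivs2_ext; auto.
  intros x. unfold p. ring. }
assert (hp10 : p1 0 = 0) by (unfold p1; rewrite hy1, he1; ring).
assert (hp1l : p1 l = 0) by (unfold p1, c; field; exact he1l).
assert (hrefl : forall c, p1 c = 0 -> (forall x, Q (2 * c - x) = Q x) ->
  (forall x, g (2 * c - x) = g x) -> forall x, p (2 * c - x) = p x).
{ intros b hb hQb hgb x. apply Rminus_diag_uniq.
  generalize (derivs2_comb 1 (-1) _ _ _ _ _ _ (derivs2_reflect (2 * b) _ _ _ hp) hp).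
  intros hd.
  assert (hd' : derivs2 (fun x => p (2 * b - x) - p x)
    (fun x => 1 * - p1 (2 * b - x) + -1 * p1 x)
    (fun x => Q x * (p (2 * b - x) - p x))).
  { revert hd. apply derivs2_ext; auto.
    - intros; ring.
    - intros t. rewrite hQb, hgb. ring. }
  apply (linear_ivp_unique Q _ _ q0 b hd' hq0);
  replace (2 * b - b) with b by ring.
  - ring.
  - rewrite hb. ring. }
exists p, p1. split; [exact hp|]. split; [split|split; assumption].
- intros x. replace (- x) with (2 * 0 - x) by ring. apply hrefl; auto.
  + intros t. replace (2 * 0 - t) with (- t) by ring. apply hQe.
  + intros t. replace (2 * 0 - t) with (- t) by ring. apply hge.
- assert (hev : forall x, p (- x) = p x).
  { intros t. replace (- t) with (2 * 0 - t) by ring. apply hrefl; auto.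
    + intros z. replace (2 * 0 - z) with (- z) by ring. apply hQe.
    + intros z. replace (2 * 0 - z) with (- z) by ring. apply hge. }
  intros x. rewrite <- (hev x). replace (x + 2 * l) with (2 * l - - x) by ring.
  apply hrefl; auto.
  + intros t. destruct hQe as [h1 h2]. replace (2 * l - t) with (- t + 2 * l) by ring.
    now rewrite h2, h1.
  + intros t. destruct hge as [h1 h2]. replace (2 * l - t) with (- t + 2 * l) by ring.
    now rewrite h2, h1.
Qed.

(** * Uniform linear estimates *)

Lemma sinh_nonneg (x : R) : 0 <= x -> 0 <= sinh x.
Proof.
intros hx. unfold sinh.
destruct (Req_dec x 0) as [->|hne]; [rewrite Ropp_0; lra|].
assert (exp (- x) < exp x) by (apply exp_increasing; lra). lra.
Qed.

Lemma sinh_lt_cosh (x : R) : sinh x < cosh x.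
Proof. unfold sinh, cosh. generalize (exp_pos (- x)). lra. Qed.

Lemma cosh_half_exp (x : R) : exp x / 2 <= cosh x.
Proof. unfold cosh. generalize (exp_pos (- x)). lra. Qed.

Lemma cosh_le (x y : R) : 0 <= x <= y -> cosh x <= cosh y.
Proof.
intros h. apply (derive_ge0_le cosh sinh); [lra| |].
- intros t _. apply is_derive_Reals, derivable_pt_lim_cosh.
- intros t ht. apply sinh_nonneg. lra.
Qed.

Lemma exp_ge_1_plus (x : R) : 0 <= x -> 1 + x <= exp x.
Proof.
intros hx. destruct (Req_dec x 0) as [->|h]; [rewrite exp_0; lra|].
left. apply exp_ineq1. lra.
Qed.

(* Comparable to [exp (- (beta * x))] on [[0, l]], but with vanishing slope at [l]. *)
Definition zeta (beta l x : R) : R := cosh (beta * (l - x)) / cosh (beta * l).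

Definition zeta1 (beta l x : R) : R :=
  - (beta * sinh (beta * (l - x)) / cosh (beta * l)).

Lemma cosh_pos (x : R) : 0 < cosh x.
Proof. generalize (cosh_ge1 x). lra. Qed.

Lemma zeta_derivs2 (beta l : R) :
  derivs2 (zeta beta l) (zeta1 beta l) (fun x => beta ^ 2 * zeta beta l x).
Proof.
generalize (derivs2_comb (/ cosh (beta * l)) 0 _ _ _ _ _ _
  (derivs2_reflect l _ _ _ (cosh_derivs2 beta)) (cosh_derivs2 beta)).
generalize (cosh_pos (beta * l)). intros hc.
apply derivs2_ext; intros x; unfold zeta, zeta1; field; lra.
Qed.

Lemma zeta_pos (beta l x : R) : 0 < zeta beta l x.
Proof. apply Rdiv_lt_0_compat; apply cosh_pos. Qed.

Lemma zeta_le1 (beta l x : R) : 0 <= beta -> 0 <= x <= l -> zeta beta l x <= 1.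
Proof.
intros hb hx. apply Rmult_le_reg_r with (cosh (beta * l)); [apply cosh_pos|].
unfold zeta. generalize (cosh_pos (beta * l)). intros.
replace (cosh (beta * (l - x)) / cosh (beta * l) * cosh (beta * l))
  with (cosh (beta * (l - x))) by (field; lra).
rewrite Rmult_1_l. apply cosh_le. split; nra.
Qed.

Lemma exp_le_zeta (beta l x : R) : 0 <= beta -> 0 <= l ->
  exp (- (beta * x)) <= 2 * zeta beta l x.
Proof.
intros hb hl. apply Rmult_le_reg_r with (cosh (beta * l)); [apply cosh_pos|].
unfold zeta. generalize (cosh_pos (beta * l)). intros.
replace (2 * (cosh (beta * (l - x)) / cosh (beta * l)) * cosh (beta * l))
  with (2 * cosh (beta * (l - x))) by (field; lra).
assert (cosh (beta * l) <= exp (beta * l)).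
{ unfold cosh. enough (exp (- (beta * l)) <= exp (beta * l)) by lra.
  destruct (Req_dec (beta * l) 0) as [->|hne]; [rewrite Ropp_0; lra|].
  left. apply exp_increasing. nra. }
generalize (cosh_half_exp (beta * (l - x))). intros h2.
replace (beta * (l - x)) with (- (beta * x) + beta * l) in h2 at 1 by ring.
rewrite exp_plus in h2. generalize (exp_pos (- (beta * x))). nra.
Qed.

Lemma zeta1_0 (beta l : R) : 0 < beta -> - beta <= zeta1 beta l 0.
Proof.
intros hb. unfold zeta1. rewrite Rminus_0_r. apply Ropp_le_contravar.
apply Rmult_le_reg_r with (cosh (beta * l)); [apply cosh_pos|].
generalize (cosh_pos (beta * l)) (sinh_lt_cosh (beta * l)). intros.
replace (beta * sinh (beta * l) / cosh (beta * l) * cosh (beta * l))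
  with (beta * sinh (beta * l)) by (field; lra).
nra.
Qed.

Lemma zeta1_l (beta l : R) : zeta1 beta l l = 0.
Proof.
unfold zeta1. rewrite Rminus_diag, Rmult_0_r, sinh_0. unfold Rdiv. ring.
Qed.

Lemma zeta_l (beta l : R) : zeta beta l l = / cosh (beta * l).
Proof.
unfold zeta. rewrite Rminus_diag, Rmult_0_r, cosh_0. unfold Rdiv. ring.
Qed.

Lemma exp_derivs2 (b l : R) :
  derivs2 (fun x => exp (b * (x - l))) (fun x => b * exp (b * (x - l)))
    (fun x => b ^ 2 * exp (b * (x - l))).
Proof.
intros x. split; auto_derive; trivial; unfold Rminus; ring.
Qed.

(** [Z] is a supersolution: where [s * p - Z] is positive with [s = 1] or [s = -1], its second
    derivative is at least [Q * (s * p - Z) > 0], and the maximum principle applies. *)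
Lemma comparison (Q p p1 p2 Z Z1 Z2 : R -> R) (x0 l : R) :
  x0 < l -> derivs2 p p1 p2 -> derivs2 Z Z1 Z2 ->
  (forall x, x0 <= x <= l -> 0 < Q x) ->
  (forall x, x0 <= x <= l -> Rabs (p2 x - Q x * p x) <= Q x * Z x - Z2 x) ->
  (Rabs (p x0) <= Z x0 \/ Rabs (p1 x0) <= - Z1 x0) -> Rabs (p1 l) <= Z1 l ->
  forall x, x0 <= x <= l -> Rabs (p x) <= Z x.
Proof.
intros hl hp hZ hQ hle h0 h1 x hx.
assert (key : forall s, s = 1 \/ s = -1 -> s * p x - Z x <= 0).
{ intros s hs.
  assert (hsabs : forall y, s * y <= Rabs y /\ - Rabs y <= s * y).
  { intros y. unfold Rabs. destruct Rcase_abs; destruct hs as [-> | ->]; lra. }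
  generalize (derivs2_comb s (-1) _ _ _ _ _ _ hp hZ). intros hd.
  replace (s * p x - Z x) with (s * p x + -1 * Z x) by ring.
  apply (max_principle (fun x => s * p x + -1 * Z x) _ _ x0 l hl
    (fun x _ => hd x)); [| | |exact hx].
  - intros y hy hpos. specialize (hle y hy). specialize (hQ y hy).
    generalize (proj2 (hsabs (p2 y - Q y * p y))). nra.
  - destruct h0 as [h0|h0].
    + left. generalize (proj1 (hsabs (p x0))). lra.
    + right. generalize (proj2 (hsabs (p1 x0))). lra.
  - generalize (proj1 (hsabs (p1 l))). lra. }
generalize (key 1 (or_introl eq_refl)) (key (-1) (or_intror eq_refl)).
intros. apply Rabs_le. lra.
Qed.

(** The response must have the same shape as the forcing, so that a localised forcing stays
    localised. A slope of size [S] at [l] is tolerated because the homoclinic is not exactly flat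
    there, so the base state violates the Neumann condition slightly. *)
Definition fast_bound (Q : R -> R) (beta l C0 : R) : Prop :=
  forall p p1 p2 S T, 0 <= S -> 0 <= T -> derivs2 p p1 p2 ->
    (forall x, 0 <= x <= l -> Rabs (p2 x - Q x * p x) <= S + T * zeta beta l x) ->
    p1 0 = 0 -> Rabs (p1 l) <= S ->
    forall x, 0 <= x <= l -> Rabs (p x) <= C0 * (S + T * zeta beta l x).

(* The localised part [T * zeta] of the forcing only enters with a factor [k],
   because [zeta] has integral of order [1] in [xi], that is, of order [k] in
   the slow variable [k * xi]. *)
Definition slow_bound (beta l k c CK : R) : Prop :=
  forall q q1 q2 S T, 0 <= S -> 0 <= T -> derivs2 q q1 q2 ->
    (forall x, 0 <= x <= l ->
      Rabs (q2 x - k ^ 2 * c * q x) <= k ^ 2 * (S + T * zeta beta l x)) ->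
    q1 0 = 0 -> q1 l = 0 ->
    forall x, 0 <= x <= l -> Rabs (q x) <= CK * (S + k * T).

(** The barrier is a constant for [S], a negative multiple of [zeta] for the localised forcing, and
    a [cosh]. Since [k * l = lam] is fixed, the [cosh] part ranges between constants that depend on
    neither [k] nor [l]. *)
Lemma slow_estimate (lam beta c : R) :
  0 < lam -> 0 < beta -> 0 < c ->
  exists CK k0, 1 <= CK /\ 0 < k0 /\
    forall k l, 0 < k <= k0 -> k * l = lam -> slow_bound beta l k c CK.
Proof.
intros hlam hbeta hc.
set (r := sqrt c). assert (hr : 0 < r) by (apply sqrt_lt_R0; exact hc).
assert (hrc : r ^ 2 = c) by (apply pow2_sqrt; lra).
set (sh := sinh (r * lam)).
assert (hsh : 0 < sh).
{ unfold sh, sinh. enough (exp (- (r * lam)) < exp (r * lam)) by lra.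
  apply exp_increasing. assert (0 < r * lam) by nra. lra. }
set (ch := cosh (r * lam)). assert (hch : 0 < ch) by apply cosh_pos.
(* Chosen so that [K * r * sh = 2 / beta]: the slope of the [cosh] term at [0] then compensates that
   of the [zeta] term, which is at worst as if [zeta1] were [- beta]. *)
set (K := 2 / (beta * r * sh)).
assert (hbrs : 0 < beta * r * sh).
{ apply Rmult_lt_0_compat; [apply Rmult_lt_0_compat|]; assumption. }
assert (hK : 0 < K) by (apply Rdiv_lt_0_compat; lra).
assert (hic : 0 < / c) by (apply Rinv_0_lt_compat; exact hc).
assert (hKc : 0 < K * ch) by (apply Rmult_lt_0_compat; assumption).
exists (1 + / c + K * ch), (beta / (2 * r)).
split; [lra|]. split; [apply Rdiv_lt_0_compat; lra|].
intros k l hk hkl q q1 q2 S T hS hT hd hle h0 h1 x hx.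
assert (hl : 0 < l) by nra.
(* The coefficient [2] in front of the [zeta] term of the barrier leaves room to lose
   [2 * (k * r) ^ 2 / beta ^ 2], which must stay below [1]. *)
assert (hkr : (k * r) ^ 2 <= beta ^ 2 / 4).
{ assert (hkr : k * r <= beta / 2).
  { apply Rle_trans with (beta / (2 * r) * r).
    - apply Rmult_le_compat_r; lra.
    - right. field. lra. }
  assert (0 < k * r) by nra.
  apply Rle_trans with ((beta / 2) ^ 2); [apply pow_incr; lra|right; field]. }
(* The [cosh] term solves the homogeneous equation and corrects the slope of the
   [zeta] term at [0]. *)
set (Z := fun x => 1 * (/ c * S) + 1 * (- (2 * k ^ 2 * T / beta ^ 2) * zeta beta l x
  + (K * k * T) * cosh (k * r * (l - x)))).
generalize (derivs2_comb 1 1 _ _ _ _ _ _ (derivs2_const (/ c * S))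
  (derivs2_comb (- (2 * k ^ 2 * T / beta ^ 2)) (K * k * T) _ _ _ _ _ _
    (zeta_derivs2 beta l) (derivs2_reflect l _ _ _ (cosh_derivs2 (k * r))))).
intros hZ.
assert (hkk : 0 < k ^ 2) by nra.
assert (hKk : 0 <= K * k * T) by (apply Rmult_le_pos; nra).
assert (hbb : 0 <= 2 * k ^ 2 * T / beta ^ 2).
{ apply Rmult_le_pos; [nra|]. left. apply Rinv_0_lt_compat. nra. }
assert (hb : Rabs (q x) <= Z x).
{ apply (comparison (fun _ => k ^ 2 * c) q q1 q2 Z _ _ 0 l hl hd hZ); [| | | |exact hx].
  - intros; nra.
  - intros y hy. eapply Rle_trans; [apply hle, hy|]. unfold Z. simpl.
    set (z := zeta beta l y). assert (hz : 0 < z) by apply zeta_pos.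
    set (Y := cosh (k * r * (l - y))). rewrite <- hrc.
    match goal with |- _ <= ?rhs => replace rhs with
      (k ^ 2 * S + k ^ 2 * T * z * (2 - 2 * (k * r) ^ 2 / beta ^ 2)) end.
    + assert (2 * (k * r) ^ 2 / beta ^ 2 <= 1).
      { apply Rmult_le_reg_r with (beta ^ 2); [nra|].
        replace (2 * (k * r) ^ 2 / beta ^ 2 * beta ^ 2) with (2 * (k * r) ^ 2)
          by (field; lra). nra. }
      assert (0 <= k ^ 2 * T * z) by (apply Rmult_le_pos; nra). nra.
    + field. split; lra.
  - right. rewrite h0, Rabs_R0, Rminus_0_r.
    replace (k * r * l) with (r * lam) by (rewrite <- hkl; ring). fold sh.
    generalize (zeta1_0 beta l hbeta). set (z1 := zeta1 beta l 0). intros hz1.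
    match goal with |- _ <= ?rhs => replace rhs with
      (2 * k ^ 2 * T / beta ^ 2 * (z1 + beta)) end.
    + apply Rmult_le_pos; lra.
    + unfold K. field. repeat split; lra.
  - replace (sinh (k * r * (l - l))) with 0.
    + rewrite h1, Rabs_R0, zeta1_l. right. ring.
    + rewrite Rminus_diag, Rmult_0_r, sinh_0. reflexivity. }
eapply Rle_trans; [exact hb|]. unfold Z.
assert (hY : cosh (k * r * (l - x)) <= ch).
{ unfold ch. rewrite <- hkl. replace (r * (k * l)) with (k * r * l) by ring.
  apply cosh_le. assert (0 < k * r) by nra. split; nra. }
generalize (zeta_pos beta l x). intros hz.
assert (0 <= 2 * k ^ 2 * T / beta ^ 2 * zeta beta l x) by (apply Rmult_le_pos; lra).
assert (K * k * T * cosh (k * r * (l - x)) <= K * k * T * ch)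
  by (apply Rmult_le_compat_l; lra).
assert (0 <= k * T) by nra.
assert (0 <= / c * (k * T)) by (apply Rmult_le_pos; lra).
assert (0 <= K * ch * S) by (apply Rmult_le_pos; lra).
nra.
Qed.

(** [Q] may be negative near [0], where no maximum principle holds. The kernel element [phi]
    replaces it: its Wronskian with [p] controls [p 0], [Phi] serving as the integral of [phi]. The
    energy estimate carries this bound up to [x0], and comparison covers [[x0, l]]. The Wronskian
    brings in the unknown end value [P], which is absorbed at the end thanks to the decay of
    [zeta]. *)
Lemma linearized_estimate (Q phi phi1 Phi : R -> R) (beta q0 C x0 : R) :
  0 < beta -> 0 < x0 ->
  (forall x, 0 <= x -> Rabs (Q x) <= q0) -> (forall x, x0 <= x -> 2 * beta ^ 2 <= Q x) ->
  derivs2 phi phi1 (fun x => Q x * phi x) -> (forall x, is_derive Phi x (phi x)) ->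
  phi 0 = 0 -> 0 < phi1 0 ->
  (forall x, 0 <= x -> 0 <= phi x <= C /\ Rabs (phi1 x) <= C /\ Rabs (Phi x) <= C) ->
  exists C0 l0, 1 <= C0 /\ 0 < l0 /\
    forall l, l0 <= l -> fast_bound Q beta l C0.
Proof.
intros hbeta hx0 hq0 hQ hphi hPhi hphi0 hphi10 hC.
assert (hC0 : 0 <= C) by (generalize (hC 0); lra).
assert (hq0' : 0 <= q0) by (generalize (hq0 0) (Rabs_pos (Q 0)); lra).
set (c1 := 3 * C / phi1 0).
assert (hc1 : 0 <= c1).
{ apply Rmult_le_pos; [lra|]. left. now apply Rinv_0_lt_compat. }
set (E := exp ((q0 + 2) * x0)).
assert (hE : 1 <= E).
{ unfold E. eapply Rle_trans; [|apply exp_ge_1_plus]; nra. }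
set (c2 := E * (c1 + 1)). assert (hc2 : 1 <= c2) by (unfold c2; nra).
(* With this choice [1 <= e0 * zeta beta l x] for [0 <= x <= x0], which turns uniform bounds near
   the pulse into localised ones. *)
set (e0 := 2 * exp (beta * x0)).
assert (he0 : 1 <= e0).
{ unfold e0. generalize (exp_ge_1_plus (beta * x0)). nra. }
set (c3 := e0 * c2). assert (hc3 : 1 <= c3) by (unfold c3; nra).
assert (hib : 0 < / beta) by now apply Rinv_0_lt_compat.
set (ib := / beta) in *.
set (c4 := 2 * (ib ^ 2 + c3 + ib)).
assert (hc4 : 0 <= c4) by (unfold c4; nra).
(* For [l] at least [4 * c3 / beta], [cosh (beta * l)] is at least [2 * c3], as the absorption of
   [P] requires. *)
exists (1 + ib ^ 2 + ib + c3 * (1 + c4)), (Rmax (x0 + 1) (4 * c3 * ib)).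
split; [nra|]. split; [apply Rlt_le_trans with (x0 + 1); [lra|apply Rmax_l]|].
intros l hl p p1 p2 S T hS hT hp hle hp10 hp1l.
assert (hlx : x0 + 1 <= l) by (eapply Rle_trans; [apply Rmax_l|exact hl]).
assert (hlc : 4 * c3 * ib <= l) by (eapply Rle_trans; [apply Rmax_r|exact hl]).
clear hl.
assert (hle2 : forall x, 0 <= x <= l -> Rabs (p2 x - Q x * p x) <= S + T).
{ intros x hx. eapply Rle_trans; [apply hle, hx|].
  generalize (zeta_le1 beta l x ltac:(lra) hx). nra. }
set (P := Rabs (p l)). assert (hP : 0 <= P) by apply Rabs_pos.
(* [p1 * phi - p * phi1] has derivative [(p2 - Q * p) * phi], and [phi] vanishes
   at [0]: comparing the end points of [[0, l]] bounds [p 0]. *)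
assert (hp0 : Rabs (p 0) <= c1 * (S + T + P)).
{ assert (hW : Rabs ((p1 l * phi l - p l * phi1 l) - (p1 0 * phi 0 - p 0 * phi1 0))
    <= (S + T) * Phi l - (S + T) * Phi 0).
  { apply (abs_increment_le (fun x => p1 x * phi x - p x * phi1 x)
      (fun x => (p2 x * phi x + p1 x * phi1 x) - (p1 x * phi1 x + p x * (Q x * phi x)))
      (fun x => (S + T) * Phi x) (fun x => (S + T) * phi x)); [lra| | |].
    - intros t _. destruct (hp t) as [g1 g2]. destruct (hphi t) as [g3 g4].
      apply (is_derive_minus (fun x => p1 x * phi x) (fun x => p x * phi1 x)).
      + apply (is_derive_mult p1 phi); auto. intros; apply Rmult_comm.
      + apply (is_derive_mult p phi1); auto. intros; apply Rmult_comm.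
    - intros t _. apply is_derive_scal, hPhi.
    - intros t ht. replace (p2 t * phi t + p1 t * phi1 t - (p1 t * phi1 t + p t * (Q t * phi t)))
        with ((p2 t - Q t * p t) * phi t) by ring.
      destruct (hC t) as [[g1 g2] _]; [lra|].
      rewrite Rabs_mult, (Rabs_right (phi t)) by lra.
      apply Rmult_le_compat_r; auto. }
  destruct (hC l) as [[g1 g2] [g3 g4]]; [lra|].
  destruct (hC 0) as [_ [_ g5]]; [lra|].
  apply Rabs_le_between in g4. apply Rabs_le_between in g5.
  rewrite hp10, hphi0 in hW.
  assert (hb : phi1 0 * Rabs (p 0) <= 3 * C * (S + T + P)).
  { rewrite <- (Rabs_right (phi1 0)) by lra. rewrite <- Rabs_mult.
    replace (phi1 0 * p 0) with ((p1 l * phi l - p l * phi1 l - (0 * 0 - p 0 * phi1 0))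
      + (- (p1 l * phi l) + p l * phi1 l)) by ring.
    eapply Rle_trans; [apply Rabs_triang|].
    generalize (Rabs_triang (- (p1 l * phi l)) (p l * phi1 l)).
    rewrite Rabs_Ropp, !Rabs_mult. fold P.
    rewrite (Rabs_right (phi l)) by lra.
    generalize (Rabs_pos (p1 l)) (Rabs_pos (phi1 l)). intros.
    assert (Rabs (p1 l) * phi l <= S * C) by (apply Rmult_le_compat; lra).
    assert (P * Rabs (phi1 l) <= P * C) by (apply Rmult_le_compat; lra).
    assert ((S + T) * Phi l <= (S + T) * C) by (apply Rmult_le_compat_l; lra).
    assert (- ((S + T) * Phi 0) <= (S + T) * C) by nra.
    nra. }
  apply Rmult_le_reg_l with (phi1 0); [exact hphi10|].
  eapply Rle_trans; [exact hb|]. right. unfold c1. field. lra. }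
assert (hnear : forall x, 0 <= x <= x0 -> Rabs (p x) <= c2 * (S + T + P)).
{ intros x hx.
  assert (h : p x ^ 2 + p1 x ^ 2 <=
     (p 0 ^ 2 + p1 0 ^ 2 + (S + T) ^ 2) * exp ((q0 + 2) * x)).
  { apply (energy_growth p p1 p2 q0 (S + T) x); auto; try lra.
    intros y hy.
    replace (p2 y) with ((p2 y - Q y * p y) + Q y * p y) by ring.
    eapply Rle_trans; [apply Rabs_triang|]. rewrite Rabs_mult.
    assert (Rabs (Q y) * Rabs (p y) <= q0 * Rabs (p y)).
    { apply Rmult_le_compat_r; [apply Rabs_pos|apply hq0; lra]. }
    generalize (hle2 y). lra. }
  assert (hex : exp ((q0 + 2) * x) <= E).
  { unfold E. destruct (Req_dec x x0) as [->|hne]; [lra|].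
    left. apply exp_increasing. nra. }
  rewrite hp10, <- (pow2_abs (p 0)), <- (pow2_abs (p x)) in h.
  generalize (Rabs_pos (p 0)) (Rabs_pos (p x)) (pow2_ge_0 (p1 x)). intros g1 g2 g3.
  set (a0 := Rabs (p 0)) in *. set (ax := Rabs (p x)) in *.
  assert (h3 : ax ^ 2 <= ((a0 + (S + T)) * E) ^ 2).
  { assert (0 <= a0 ^ 2 + 0 ^ 2 + (S + T) ^ 2) by nra.
    apply Rle_trans with ((a0 ^ 2 + 0 ^ 2 + (S + T) ^ 2) * E).
    - eapply Rle_trans; [|apply Rmult_le_compat_l; [assumption|exact hex]]. lra.
    - rewrite Rpow_mult_distr.
      assert (E <= E ^ 2) by nra.
      assert (0 <= a0 * (S + T)) by nra.
      apply Rmult_le_compat; nra. }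
  assert (h4 : ax <= (a0 + (S + T)) * E).
  { assert (0 <= (a0 + (S + T)) * E) by nra.
    apply Rsqr_incr_0; [unfold Rsqr; nra|lra|lra]. }
  eapply Rle_trans; [exact h4|]. unfold c2. nra. }
set (Rr := c3 * (S + T + P)).
assert (hfar : forall x, x0 <= x <= l -> Rabs (p x) <=
   ib ^ 2 * (S + T * zeta beta l x) + Rr * zeta beta l x + S * ib).
{ intros x hx.
  (* The constant pays for [S], the [zeta] term for the localised forcing and the value at [x0], and
     the growing exponential for the slope at [l]. The bound [2 * beta ^ 2 <= Q] leaves
     [Q - beta ^ 2 >= beta ^ 2] on the terms of rate [beta]. *)
  set (Z := fun x => 1 * (ib ^ 2 * S) + 1 * ((ib ^ 2 * T + Rr) * zeta beta l x
     + (S * ib) * exp (beta * (x - l)))).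
  generalize (derivs2_comb 1 1 _ _ _ _ _ _ (derivs2_const (ib ^ 2 * S))
    (derivs2_comb (ib ^ 2 * T + Rr) (S * ib) _ _ _ _ _ _
    (zeta_derivs2 beta l) (exp_derivs2 beta l))).
  intros hZ.
  assert (hRr : 0 <= Rr) by (unfold Rr; nra).
  assert (hibT : 0 <= ib ^ 2 * T) by nra.
  assert (hibS : 0 <= S * ib) by nra.
  assert (hib2 : ib ^ 2 * beta ^ 2 = 1) by (unfold ib; field; lra).
  assert (h : Rabs (p x) <= Z x).
  { apply (comparison Q p p1 p2 Z _ _ x0 l ltac:(lra) hp hZ); [| | | |exact hx].
    - intros y hy. generalize (hQ y). nra.
    - intros y hy. eapply Rle_trans; [apply hle; lra|].
      unfold Z. simpl Rmult.
      generalize (zeta_pos beta l y) (exp_pos (beta * (y - l))) (hQ y ltac:(lra)).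
      set (z := zeta beta l y). set (e := exp _). set (Qy := Q y). intros hz he hQy.
      assert (g1 : 0 <= (Qy - 2 * beta ^ 2) * (ib ^ 2 * S)).
      { apply Rmult_le_pos; nra. }
      assert (g2 : 0 <= (Qy - 2 * beta ^ 2) * (ib ^ 2 * T * z)).
      { apply Rmult_le_pos; [lra|]. apply Rmult_le_pos; lra. }
      assert (g3 : 0 <= (Qy - beta ^ 2) * (Rr * z)).
      { apply Rmult_le_pos; nra. }
      assert (g4 : 0 <= (Qy - beta ^ 2) * (S * ib * e)).
      { apply Rmult_le_pos; [nra|]. apply Rmult_le_pos; lra. }
      assert (g5 : 2 * beta ^ 2 * (ib ^ 2 * S) = 2 * S) by (rewrite <- (Rmult_1_r (2 * S)), <- hib2; ring).
      assert (g6 : beta ^ 2 * (ib ^ 2 * T * z) = T * z) by (rewrite <- (Rmult_1_r (T * z)), <- hib2; ring).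
      lra.
    - left. eapply Rle_trans; [apply hnear; lra|]. unfold Z.
      generalize (exp_le_zeta beta l x0 ltac:(lra) ltac:(lra)) (exp_pos (beta * (x0 - l))).
      set (z := zeta beta l x0). intros hz he.
      assert (hez : 1 <= e0 * z).
      { unfold e0. assert (g : exp (beta * x0) * exp (- (beta * x0)) = 1).
        { rewrite <- exp_plus, Rplus_opp_r. apply exp_0. }
        generalize (exp_pos (beta * x0)). nra. }
      assert (hz0 : 0 < z) by apply zeta_pos.
      assert (c2 * (S + T + P) <= Rr * z).
      { unfold Rr, c3.
        replace (e0 * c2 * (S + T + P) * z) with (c2 * (S + T + P) * (e0 * z)) by ring.
        assert (0 <= c2 * (S + T + P)) by nra. nra. }
      assert (0 <= ib ^ 2 * S) by nra.
      assert (0 <= ib ^ 2 * T * z) by nra.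
      assert (0 <= S * ib * exp (beta * (x0 - l))) by nra. lra.
    - rewrite zeta1_l. replace (exp (beta * (l - l))) with 1
        by (rewrite Rminus_diag, Rmult_0_r, exp_0; reflexivity).
      eapply Rle_trans; [exact hp1l|]. right. unfold ib. field. lra. }
  eapply Rle_trans; [exact h|]. unfold Z.
  assert (exp (beta * (x - l)) <= 1).
  { rewrite <- exp_0. destruct (Req_dec x l) as [->|hne].
    - rewrite Rminus_diag, Rmult_0_r. lra.
    - left. apply exp_increasing. nra. }
  assert (S * ib * exp (beta * (x - l)) <= S * ib * 1) by (apply Rmult_le_compat_l; lra).
  lra. }
(* [c3 * zeta] is at most [1 / 2] at [l], which absorbs [P]. *)
assert (hPle : P <= c4 * (S + T)).
{ generalize (hfar l ltac:(lra)). fold P. rewrite zeta_l.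
  assert (hch : 2 * c3 <= cosh (beta * l)).
  { generalize (cosh_half_exp (beta * l)) (exp_ge_1_plus (beta * l)).
    assert (beta * (4 * c3 * ib) = 4 * c3) by (unfold ib; field; lra).
    assert (beta * (4 * c3 * ib) <= beta * l) by (apply Rmult_le_compat_l; lra).
    lra. }
  assert (hz1 : / cosh (beta * l) <= 1).
  { rewrite <- Rinv_1. apply Rinv_le_contravar; lra. }
  assert (hz2 : c3 * / cosh (beta * l) <= 1 / 2).
  { apply Rmult_le_reg_r with (cosh (beta * l)); [lra|].
    rewrite Rmult_assoc, Rinv_l; lra. }
  assert (hz0 : 0 < / cosh (beta * l)) by (apply Rinv_0_lt_compat; lra).
  set (z := / cosh (beta * l)) in *. unfold Rr. intros h.
  assert (c3 * (S + T + P) * z <= c3 * (S + T) + P / 2) by nra.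
  assert (0 <= ib ^ 2 * T) by nra.
  assert (ib ^ 2 * (S + T * z) <= ib ^ 2 * (S + T)) by nra.
  assert (0 <= T * ib) by nra.
  unfold c4. lra. }
intros x hx. generalize (zeta_pos beta l x) (zeta_le1 beta l x ltac:(lra) hx).
set (z := zeta beta l x) in *. intros hz hz1.
assert (hSz : (S + T) * z <= S + T * z) by nra.
assert (hSTP : S + T + P <= (1 + c4) * (S + T)) by lra.
assert (hTz : 0 <= T * z) by nra.
assert (hc34 : 0 <= c3 * (1 + c4)) by nra.
destruct (Rle_dec x x0) as [hxx|hxx].
- eapply Rle_trans; [apply hnear; lra|].
  apply Rle_trans with (c3 * (1 + c4) * (S + T * z)); [|nra].
  assert (hez : 1 <= e0 * z).
  { unfold e0. assert (g : exp (beta * x0) * exp (- (beta * x0)) = 1).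
    { rewrite <- exp_plus, Rplus_opp_r. apply exp_0. }
    generalize (exp_le_zeta beta l x ltac:(lra) ltac:(lra)). fold z. intros g2.
    assert (exp (- (beta * x0)) <= exp (- (beta * x))).
    { destruct (Req_dec x x0) as [->|hne]; [lra|]. left. apply exp_increasing. nra. }
    generalize (exp_pos (beta * x0)). nra. }
  assert (S + T <= e0 * (S + T * z)) by nra.
  unfold c3. apply Rle_trans with (c2 * ((1 + c4) * (S + T))).
  + apply Rmult_le_compat_l; lra.
  + replace (e0 * c2 * (1 + c4) * (S + T * z)) with (c2 * ((1 + c4) * (e0 * (S + T * z)))) by ring.
    apply Rmult_le_compat_l; [lra|]. apply Rmult_le_compat_l; lra.
- eapply Rle_trans; [apply hfar; lra|]. fold z. unfold Rr.
  assert (c3 * (S + T + P) * z <= c3 * (1 + c4) * (S + T * z)).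
  { replace (c3 * (1 + c4) * (S + T * z)) with (c3 * ((1 + c4) * (S + T * z))) by ring.
    rewrite Rmult_assoc. apply Rmult_le_compat_l; [lra|].
    apply Rle_trans with ((1 + c4) * (S + T) * z); [apply Rmult_le_compat_r; lra|].
    rewrite Rmult_assoc. apply Rmult_le_compat_l; lra. }
  assert (0 <= ib * (T * z)) by nra. nra.
Qed.

(** * The homoclinic orbit *)

Definition hom_den (A x : R) : R :=
  2 * sqrt (1 - A) + sqrt (2 * A) * cosh (sqrt (2 - 3 * A) * x).

(** With [a = sqrt (1 - A)], [m ^ 2 = 2 - 3 * A] and [y = hom - a], the zero energy relation is [y'
    ^ 2 = y ^ 2 * (m ^ 2 + 2 * a * y + y ^ 2 / 2)]. For [r = 1 / y] it becomes [r' ^ 2 = m ^ 2 * r ^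
    2 + 2 * a * r + 1 / 2], which is solved by an affine function of [cosh (m * x)]. *)
Definition hom (A x : R) : R := sqrt (1 - A) - 2 * (2 - 3 * A) / hom_den A x.

Definition hom1 (A x : R) : R :=
  2 * (2 - 3 * A) *
    (sqrt (2 * A) * (sqrt (2 - 3 * A) * sinh (sqrt (2 - 3 * A) * x)))
    / hom_den A x ^ 2.

Lemma sqrt_facts (A : R) (hA0 : 0 < A) (hA1 : A < 2 / 3) :
  0 < sqrt (1 - A) /\ 0 < sqrt (2 * A) /\ 0 < sqrt (2 - 3 * A) /\
  sqrt (1 - A) ^ 2 = 1 - A /\ sqrt (2 * A) ^ 2 = 2 * A /\
  sqrt (2 - 3 * A) ^ 2 = 2 - 3 * A /\ sqrt (2 * A) < 2 * sqrt (1 - A).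
Proof.
assert (h1 : 0 < sqrt (1 - A)) by (apply sqrt_lt_R0; lra).
assert (h2 : 0 < sqrt (2 * A)) by (apply sqrt_lt_R0; lra).
assert (h3 : 0 < sqrt (2 - 3 * A)) by (apply sqrt_lt_R0; lra).
assert (e1 : sqrt (1 - A) ^ 2 = 1 - A) by (apply pow2_sqrt; lra).
assert (e2 : sqrt (2 * A) ^ 2 = 2 * A) by (apply pow2_sqrt; lra).
assert (e3 : sqrt (2 - 3 * A) ^ 2 = 2 - 3 * A) by (apply pow2_sqrt; lra).
repeat split; auto. apply Rnot_le_lt. intros h. nra.
Qed.

Lemma hom_den_lower (A : R) (hA0 : 0 < A) (hA1 : A < 2 / 3) (x : R) :
  2 * sqrt (1 - A) + sqrt (2 * A) <= hom_den A x /\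
  sqrt (2 * A) * cosh (sqrt (2 - 3 * A) * x) <= hom_den A x /\ 0 < hom_den A x.
Proof.
destruct (sqrt_facts A hA0 hA1) as [h1 [h2 _]]. unfold hom_den.
generalize (cosh_ge1 (sqrt (2 - 3 * A) * x)). repeat split; nra.
Qed.

Lemma hom_derivs2 (A : R) (hA0 : 0 < A) (hA1 : A < 2 / 3) :
  derivs2 (hom A) (hom1 A) (fun x => hom A x ^ 3 - hom A x + A * sqrt (1 - A)).
Proof.
destruct (sqrt_facts A hA0 hA1) as [h1 [h2 [h3 [e1 [e2 [e3 _]]]]]].
set (a := sqrt (1 - A)) in *. set (b := sqrt (2 * A)) in *.
set (m := sqrt (2 - 3 * A)) in *.
intros x. destruct (hom_den_lower A hA0 hA1 x) as [_ [_ hD]].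
assert (hd : derivs2 (hom_den A) (fun x => b * (m * sinh (m * x)))
   (fun x => b * (m ^ 2 * cosh (m * x)))).
{ generalize (derivs2_comb 1 b _ _ _ _ _ _ (derivs2_const (2 * a)) (cosh_derivs2 m)).
  apply derivs2_ext; intros y; unfold hom_den; fold a b m; ring. }
destruct (hd x) as [d1 d2]. split.
- unfold hom, hom1. fold a b m.
  replace (2 * (2 - 3 * A) * (b * (m * sinh (m * x))) / hom_den A x ^ 2) with
    (0 - (2 * (2 - 3 * A)) * (- (b * (m * sinh (m * x))) / hom_den A x ^ 2)) by (field; lra).
  apply (is_derive_minus (fun _ => a) (fun x => (2 * (2 - 3 * A)) / hom_den A x)).
  + apply is_derive_Reals, derivable_pt_lim_const.
  + unfold Rdiv at 1. apply is_derive_scal.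
    apply is_derive_inv; [exact d1|lra].
- unfold hom1. fold b m.
  set (D := hom_den A x) in *.
  set (s := sinh (m * x)) in *. set (c := cosh (m * x)) in *.
  assert (hs : s ^ 2 = c ^ 2 - 1).
  { unfold s, c, sinh, cosh.
    assert (e : exp (m * x) * exp (- (m * x)) = 1).
    { rewrite <- exp_plus, Rplus_opp_r. apply exp_0. }
    nra. }
  assert (hDc : b * c = D - 2 * a) by (unfold D, hom_den; fold a b m c; ring).
  set (M := m ^ 2) in *.
  assert (eA : A = 1 - a ^ 2) by lra.
  assert (eM : 2 - 3 * A = M) by lra.
  (* The square of the derivative of the denominator is a polynomial in the denominator, so all
     hyperbolic functions disappear and the equation becomes a rational identity in [D] and [a]. *)
  assert (hnum : (b * (m * s)) ^ 2 = M * (D ^ 2 - 4 * a * D + 2 * M)).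
  { transitivity (M * (b ^ 2 * s ^ 2)); [unfold M; ring|]. rewrite hs.
    transitivity (M * ((b * c) ^ 2 - b ^ 2)); [ring|]. rewrite hDc, e2.
    f_equal. nra. }
  assert (hnum2 : b * (M * c) = M * (D - 2 * a)) by (rewrite <- hDc; ring).
  replace (hom A x ^ 3 - hom A x + A * a) with
    ((2 * (2 - 3 * A) * (b * (M * c)) * D ^ 2
     - 2 * (2 - 3 * A) * (b * (m * s)) * (2 * (b * (m * s)) * D ^ 1)) / (D ^ 2) ^ 2).
  + apply (is_derive_div (fun x => 2 * (2 - 3 * A) * (b * (m * sinh (m * x))))
      (fun x => hom_den A x ^ 2)).
    * apply is_derive_scal. exact d2.
    * replace (2 * (b * (m * s)) * D ^ 1) with (INR 2 * (b * (m * s)) * D ^ 1)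
        by (simpl; ring).
      apply is_derive_pow. exact d1.
    * fold D. apply pow_nonzero. lra.
  + transitivity (2 * M * (b * (M * c) * D - 2 * (b * (m * s)) ^ 2) / D ^ 3).
    { rewrite eM. field. lra. }
    rewrite hnum, hnum2. unfold hom. fold D a. rewrite eM, eA.
    assert (eM2 : M = 3 * a ^ 2 - 1) by lra.
    rewrite eM2. field. lra.
Qed.

Lemma hom_even (A x : R) : hom A (- x) = hom A x.
Proof.
unfold hom, hom_den. replace (sqrt (2 - 3 * A) * - x) with (- (sqrt (2 - 3 * A) * x)) by ring.
unfold cosh at 1. rewrite Ropp_involutive, Rplus_comm with (r1 := exp (- _)). reflexivity.
Qed.

Lemma hom1_0 (A : R) : hom1 A 0 = 0.
Proof. unfold hom1. rewrite Rmult_0_r, sinh_0. unfold Rdiv. ring. Qed.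

Lemma hom_0 (A : R) (hA0 : 0 < A) (hA1 : A < 2 / 3) : hom A 0 = sqrt (2 * A) - sqrt (1 - A).
Proof.
destruct (sqrt_facts A hA0 hA1) as [h1 [h2 [h3 [e1 [e2 [e3 _]]]]]].
unfold hom, hom_den. rewrite Rmult_0_r, cosh_0, Rmult_1_r.
set (a := sqrt (1 - A)) in *. set (b := sqrt (2 * A)) in *.
replace (2 * (2 - 3 * A)) with ((2 * a - b) * (2 * a + b)) by nra.
field. lra.
Qed.

Lemma hom1_pos (A : R) (hA0 : 0 < A) (hA1 : A < 2 / 3) (x : R) : 0 < x -> 0 < hom1 A x.
Proof.
intros hx. destruct (sqrt_facts A hA0 hA1) as [h1 [h2 [h3 _]]]. destruct (hom_den_lower A hA0 hA1 x) as [_ [_ hD]].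
assert (hs : 0 < sinh (sqrt (2 - 3 * A) * x)).
{ unfold sinh. assert (0 < sqrt (2 - 3 * A) * x) by nra.
  assert (exp (- (sqrt (2 - 3 * A) * x)) < exp (sqrt (2 - 3 * A) * x)) by (apply exp_increasing; lra).
  lra. }
unfold hom1. apply Rdiv_lt_0_compat; [|nra].
apply Rmult_lt_0_compat; [lra|]. apply Rmult_lt_0_compat; [lra|].
apply Rmult_lt_0_compat; lra.
Qed.

Lemma hom_range (A : R) (hA0 : 0 < A) (hA1 : A < 2 / 3) (x : R) : - sqrt (1 - A) <= hom A x <= sqrt (1 - A).
Proof.
destruct (sqrt_facts A hA0 hA1) as [h1 [h2 [h3 [e1 [e2 [e3 _]]]]]]. destruct (hom_den_lower A hA0 hA1 x) as [d1 [_ hD]].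
unfold hom. assert (0 < 2 * (2 - 3 * A) / hom_den A x) by (apply Rdiv_lt_0_compat; lra).
split; [|lra].
set (a := sqrt (1 - A)) in *. set (b := sqrt (2 * A)) in *.
assert (2 * (2 - 3 * A) / hom_den A x <= 2 * a); [|lra].
apply Rmult_le_reg_r with (hom_den A x); [lra|].
replace (2 * (2 - 3 * A) / hom_den A x * hom_den A x) with (2 * (2 - 3 * A)) by (field; lra).
assert (2 * a * (2 * a + b) <= 2 * a * hom_den A x) by (apply Rmult_le_compat_l; lra).
assert (0 < a * b) by nra. nra.
Qed.

Lemma hom_decay (A : R) (hA0 : 0 < A) (hA1 : A < 2 / 3) : exists C, 0 < C /\ forall x, 0 <= x ->
  0 <= sqrt (1 - A) - hom A x <= C * exp (- (sqrt (2 - 3 * A) * x)) /\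
  Rabs (hom1 A x) <= C * exp (- (sqrt (2 - 3 * A) * x)).
Proof.
destruct (sqrt_facts A hA0 hA1) as [h1 [h2 [h3 [e1 [e2 [e3 _]]]]]].
set (b := sqrt (2 * A)) in *. set (m := sqrt (2 - 3 * A)) in *.
(* [/ hom_den] is at most [2 / b * exp (- (m * x))], and the remaining factors are at most [4] for
   [hom] and [8] for [hom1]. *)
exists (16 / b). split; [apply Rdiv_lt_0_compat; lra|]. intros x hx.
destruct (hom_den_lower A hA0 hA1 x) as [_ [d2 hD]]. fold b m in d2.
assert (hm : m < 2) by nra.
set (E := exp (- (m * x))). assert (hE : 0 < E) by apply exp_pos.
assert (hc : / cosh (m * x) <= 2 * E).
{ apply Rmult_le_reg_r with (cosh (m * x)); [apply cosh_pos|].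
  rewrite Rinv_l by (generalize (cosh_pos (m * x)); lra).
  generalize (cosh_half_exp (m * x)). intros hh.
  assert (e : exp (m * x) * E = 1).
  { unfold E. rewrite <- exp_plus, Rplus_opp_r. apply exp_0. }
  nra. }
generalize (cosh_pos (m * x)) (sinh_lt_cosh (m * x)). set (c := cosh (m * x)) in *.
intros hc0 hsc.
assert (hs0 : 0 <= sinh (m * x)) by (apply sinh_nonneg; nra).
set (s := sinh (m * x)) in *.
assert (hib : 0 < / b) by (apply Rinv_0_lt_compat; lra).
assert (hDi : / hom_den A x <= / b * (2 * E)).
{ apply Rle_trans with (/ (b * c)).
  - apply Rinv_le_contravar; nra.
  - rewrite Rinv_mult. apply Rmult_le_compat_l; lra. }
assert (hDi0 : 0 < / hom_den A x) by (apply Rinv_0_lt_compat; lra).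
split.
- unfold hom.
  replace (sqrt (1 - A) - (sqrt (1 - A) - 2 * (2 - 3 * A) / hom_den A x))
    with (2 * (2 - 3 * A) * / hom_den A x) by (unfold Rdiv; ring).
  unfold Rdiv. split; [nra|].
  apply Rle_trans with (4 * / hom_den A x); [apply Rmult_le_compat_r; lra|]. nra.
- unfold hom1. fold b m s.
  rewrite Rabs_right.
  + replace (2 * (2 - 3 * A) * (b * (m * s)) / hom_den A x ^ 2) with
      ((2 * (2 - 3 * A)) * m * (b * s * / hom_den A x) * / hom_den A x) by (field; lra).
    assert (g : b * s * / hom_den A x <= 1).
    { apply Rmult_le_reg_r with (hom_den A x); [lra|].
      rewrite Rmult_assoc, Rinv_l by lra. nra. }
    assert (g0 : 0 <= b * s * / hom_den A x) by (apply Rmult_le_pos; nra).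
    assert (g1 : 2 * (2 - 3 * A) * m <= 8) by nra.
    set (q := b * s * / hom_den A x) in *.
    assert (g2 : 2 * (2 - 3 * A) * m * q <= 8).
    { assert (0 <= 2 * (2 - 3 * A) * m) by nra. nra. }
    unfold Rdiv. apply Rle_trans with (8 * / hom_den A x); [apply Rmult_le_compat_r; lra|]. nra.
  + apply Rle_ge, Rmult_le_pos.
    * apply Rmult_le_pos; [lra|]. apply Rmult_le_pos; nra.
    * left. apply Rinv_0_lt_compat. nra.
Qed.

(** The cubic is not globally Lipschitz, but both solutions are bounded on [[0, x]], where their
    difference solves a linear equation with bounded coefficient. *)
Lemma cubic_ivp_unique (mu : R) (f f1 g g1 : R -> R) :
  derivs2 f f1 (fun x => f x ^ 3 - f x + mu) ->
  derivs2 g g1 (fun x => g x ^ 3 - g x + mu) ->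
  f 0 = g 0 -> f1 0 = g1 0 -> forall x, 0 <= x -> f x = g x.
Proof.
intros hf hg h0 h1 x hx.
destruct (cont_bounded_on f x hx (derivs2_cont _ _ _ hf)) as [bf hbf].
destruct (cont_bounded_on g x hx (derivs2_cont _ _ _ hg)) as [bg hbg].
generalize (derivs2_comb 1 (-1) _ _ _ _ _ _ hf hg). intros hd.
assert (hbf0 : 0 <= bf) by (generalize (hbf 0) (Rabs_pos (f 0)); lra).
assert (hbg0 : 0 <= bg) by (generalize (hbg 0) (Rabs_pos (g 0)); lra).
assert (h : (1 * f x + -1 * g x) ^ 2 + (1 * f1 x + -1 * g1 x) ^ 2 <=
  ((1 * f 0 + -1 * g 0) ^ 2 + (1 * f1 0 + -1 * g1 0) ^ 2 + 0 ^ 2)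
  * exp ((bf * bf + bf * bg + bg * bg + 1 + 2) * x)).
{ apply (energy_growth _ _ _ (bf * bf + bf * bg + bg * bg + 1) 0 x) with (1 := ltac:(nra) : 0 <= bf * bf + bf * bg + bg * bg + 1) (3 := hd); try lra.
  intros y hy. specialize (hbf y hy). specialize (hbg y hy).
  replace (1 * (f y ^ 3 - f y + mu) + -1 * (g y ^ 3 - g y + mu)) with
    ((f y * f y + f y * g y + g y * g y + -1) * (1 * f y + -1 * g y)) by ring.
  rewrite Rabs_mult, Rplus_0_r. apply Rmult_le_compat_r; [apply Rabs_pos|].
  eapply Rle_trans; [apply Rabs_triang|]. rewrite Rabs_m1. apply Rplus_le_compat_r.
  eapply Rle_trans; [apply Rabs_triang|].
  eapply Rle_trans; [apply Rplus_le_compat_r, Rabs_triang|]. rewrite !Rabs_mult.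
  generalize (Rabs_pos (f y)) (Rabs_pos (g y)). intros.
  apply Rplus_le_compat; [apply Rplus_le_compat|]; apply Rmult_le_compat; lra. }
rewrite h0, h1 in h.
replace (((1 * g 0 + -1 * g 0) ^ 2 + (1 * g1 0 + -1 * g1 0) ^ 2 + 0 ^ 2)
  * exp ((bf * bf + bf * bg + bg * bg + 1 + 2) * x)) with 0 in h by ring.
generalize (pow2_ge_0 (1 * f x + -1 * g x)) (pow2_ge_0 (1 * f1 x + -1 * g1 x)). intros.
assert (e : 1 * f x + -1 * g x = 0); [|lra].
apply Rsqr_0_uniq. unfold Rsqr. nra.
Qed.

Lemma even_derive_0 (f : R -> R) (d : R) :
  (forall x, f (- x) = f x) -> is_derive f 0 d -> d = 0.
Proof.
intros he hd.
assert (h : is_derive f 0 (- d)).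
{ apply is_derive_ext with (f := fun x => f (- x)); [exact he|].
  replace (- d) with (-1 * d) by ring.
  apply (is_derive_comp f (fun x => - x) 0 d (-1)).
  - now rewrite Ropp_0.
  - auto_derive; trivial. }
apply is_derive_unique in hd. apply is_derive_unique in h. lra.
Qed.

Lemma even_homoclinic_hom (A : R) (hA0 : 0 < A) (hA1 : A < 2 / 3) :
  even_homoclinic (A * sqrt (1 - A)) (sqrt (1 - A)) (hom A).
Proof.
assert (hlim : is_lim (hom A) p_infty (sqrt (1 - A))).
{ destruct (hom_decay A hA0 hA1) as [C [hC hdec]].
  destruct (sqrt_facts A hA0 hA1) as [_ [_ [hm _]]].
  apply is_lim_spec. intros e. simpl.
  exists (Rmax 0 (C / (e * sqrt (2 - 3 * A)))). intros x hx.
  assert (hx0 : 0 < x) by (eapply Rle_lt_trans; [apply Rmax_l|exact hx]).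
  assert (hx1 : C / (e * sqrt (2 - 3 * A)) < x) by (eapply Rle_lt_trans; [apply Rmax_r|exact hx]).
  destruct (hdec x) as [h1 _]; [lra|]. set (m := sqrt (2 - 3 * A)) in *.
  destruct e as [e he]. simpl in *.
  assert (h2 : C < e * (m * x)).
  { apply Rmult_lt_compat_r with (r := e * m) in hx1; [|nra].
    replace (C / (e * m) * (e * m)) with C in hx1 by (field; lra). lra. }
  assert (h3 : exp (m * x) * exp (- (m * x)) = 1).
  { rewrite <- exp_plus, Rplus_opp_r. apply exp_0. }
  generalize (exp_ge_1_plus (m * x)) (exp_pos (- (m * x))). intros h4 h5.
  assert (0 < m * x) by nra.
  assert (C * exp (- (m * x)) < e).
  { assert (C < e * exp (m * x)) by nra. nra. }
  rewrite Rabs_left1; lra. }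
destruct (derivs2_twice_derivable _ _ _ (hom_derivs2 A hA0 hA1)) as [htd hD2].
split; [split; [exact htd|]|split; [|split; [|split]]].
- intros x. rewrite hD2. ring.
- exists 0, 1. intros h.
  assert (h2 : hom A 0 < hom A 1); [|lra].
  destruct (mvt_strict (hom A) (hom1 A) 0 1) as [c [hc e]]; [lra| |].
  + intros; now apply hom_derivs2.
  + generalize (hom1_pos A hA0 hA1 c). nra.
- apply is_lim_ext with (f := fun x => hom A (- x)); [intros; apply hom_even|].
  apply (is_lim_comp (hom A) Ropp m_infty (sqrt (1 - A)) p_infty); [exact hlim| |].
  + apply (is_lim_opp (fun x => x) m_infty m_infty). apply is_lim_id.
  + exists 0. intros; discriminate.
- exact hlim.
- intros; apply hom_even.
Qed.

(** Evenness forces slope [0] at [0], so zero energy makes [f 0 - a] a root of [G]. Each root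
    determines the orbit through the initial value problem, and only one of them belongs to a
    nonconstant orbit tending to [a]. *)
Lemma even_homoclinic_unique (A : R) (hA0 : 0 < A) (hA1 : A < 2 / 3) (f : R -> R) :
  even_homoclinic (A * sqrt (1 - A)) (sqrt (1 - A)) f -> f = hom A.
Proof.
intros [[htd heq] [hnc [_ [hlim hev]]]].
destruct (sqrt_facts A hA0 hA1) as [ha [hb [hm [e1 [e2 [e3 hab]]]]]].
set (mu := A * sqrt (1 - A)) in *.
assert (hf : derivs2 f (Derive f) (fun x => f x ^ 3 - f x + mu)).
{ intros x. destruct (htd x) as [h1 h2]. simpl in h1, h2. split.
  - apply Derive_correct. exact h1.
  - replace (f x ^ 3 - f x + mu) with (Derive_n f 2 x) by (generalize (heq x); lra).
    apply Derive_correct. exact h2. }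
assert (hf10 : Derive f 0 = 0) by (apply (even_derive_0 f); [exact hev|apply hf]).
set (a := sqrt (1 - A)) in *. set (b := sqrt (2 * A)) in *. set (f1 := Derive f) in *.
assert (eA : A = 1 - a ^ 2) by lra.
(* [f1 ^ 2 - G (f - a)] is conserved; a nonzero value is incompatible with
   [f] tending to [a]. *)
set (G := fun y => (2 - 3 * A) * y ^ 2 + 2 * a * y ^ 3 + y ^ 4 / 2).
assert (hconst : forall x, f1 x ^ 2 - G (f x - a) = f1 0 ^ 2 - G (f 0 - a)).
{ assert (hH : forall x, is_derive (fun x => f1 x ^ 2 - G (f x - a)) x 0).
  { intros x. destruct (hf x) as [h1 h2].
    replace 0 with ((INR 2 * (f x ^ 3 - f x + mu) * f1 x ^ 1) -
      (f1 x * (2 * (2 - 3 * A) * (f x - a) + 6 * a * (f x - a) ^ 2 + 2 * (f x - a) ^ 3))).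
    - apply (is_derive_minus (fun x => f1 x ^ 2) (fun x => G (f x - a))).
      + apply is_derive_pow. exact h2.
      + apply (is_derive_comp (fun y => G (y - a)) f x).
        * unfold G. auto_derive; [trivial|]. simpl. field.
        * exact h1.
    - simpl. unfold mu. fold a. rewrite eA. ring. }
  intros x. destruct (Rtotal_order x 0) as [h|[->|h]]; [|reflexivity|].
  - destruct (mvt_strict _ _ x 0 h (fun t _ => hH t)) as [c [_ e]]. simpl in e. lra.
  - destruct (mvt_strict _ _ 0 x h (fun t _ => hH t)) as [c [_ e]]. simpl in e. lra. }
set (E := f1 0 ^ 2 - G (f 0 - a)) in *.
assert (hfar : forall e, 0 < e -> exists X, forall x, X < x -> Rabs (f x - a) < e).
{ intros e he. apply is_lim_spec in hlim. exact (hlim (mkposreal e he)). }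
assert (hGsmall : forall y, Rabs y < 1 -> Rabs (G y) <= 5 * Rabs y).
{ intros y hy. unfold G.
  replace ((2 - 3 * A) * y ^ 2 + 2 * a * y ^ 3 + y ^ 4 / 2) with
    (y * ((2 - 3 * A) * y + 2 * a * y ^ 2 + y ^ 3 / 2)) by field.
  rewrite Rabs_mult, Rmult_comm. apply Rmult_le_compat_r; [apply Rabs_pos|].
  apply Rabs_def2 in hy. assert (a < 1) by nra.
  assert (y ^ 2 <= 1) by nra. assert (-1 <= y ^ 3 <= 1) by nra.
  apply Rabs_le. assert (0 <= 2 * a * y ^ 2 <= 2) by nra.
  assert (-2 <= (2 - 3 * A) * y <= 2) by nra. lra. }
assert (hE : E = 0).
{ destruct (Rtotal_order E 0) as [h|[h|h]]; [exfalso|exact h|exfalso].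
  - destruct (hfar (Rmin 1 (- E / 10))) as [X hX]; [apply Rmin_pos; lra|].
    specialize (hX (X + 1) ltac:(lra)). set (x := X + 1) in *.
    generalize (Rmin_l 1 (- E / 10)) (Rmin_r 1 (- E / 10)). intros.
    generalize (hGsmall (f x - a) ltac:(lra)) (hconst x) (pow2_ge_0 (f1 x)).
    intros g1 g2 g3. apply Rabs_le_between in g1. lra.
  - destruct (hfar (Rmin 1 (E / 10))) as [X hX]; [apply Rmin_pos; lra|].
    generalize (Rmin_l 1 (E / 10)) (Rmin_r 1 (E / 10)). intros.
    (* With slope squared at least [E / 2], the squared increment over a length [N] is at least
       [E / 2 * N ^ 2 = (1 + E) * N > 4], while [f] stays within [1] of [a]. *)
    set (N := 2 / E + 2).
    assert (hN : 2 < N) by (unfold N; assert (0 < 2 / E) by (apply Rdiv_lt_0_compat; lra); lra).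
    assert (hNE : N * E = 2 + 2 * E) by (unfold N; field; lra).
    destruct (mvt_strict f f1 (X + 1) (X + 1 + N)) as [c [hc e]]; [lra| |].
    { intros; apply hf. }
    generalize (hX (X + 1) ltac:(lra)) (hX (X + 1 + N) ltac:(lra)) (hX c ltac:(lra)).
    intros k1 k2 k3.
    generalize (hGsmall (f c - a) ltac:(lra)) (hconst c). intros g1 g2.
    apply Rabs_le_between in g1. apply Rabs_def2 in k1, k2.
    assert (E / 2 <= f1 c ^ 2) by lra.
    replace (X + 1 + N - (X + 1)) with N in e by ring.
    assert (k4 : (f1 c * N) ^ 2 < 4).
    { rewrite <- e. nra. }
    assert (k5 : E / 2 * N ^ 2 <= f1 c ^ 2 * N ^ 2) by (apply Rmult_le_compat_r; nra).
    rewrite Rpow_mult_distr in k4.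
    assert (E / 2 * N ^ 2 = (1 + E) * N) by (transitivity (N * E * N / 2); [field|rewrite hNE; field]).
    nra. }
assert (hf1G : forall x, f1 x ^ 2 = G (f x - a)) by (intros x; generalize (hconst x); lra).
assert (hall : forall g g1, derivs2 g g1 (fun x => g x ^ 3 - g x + mu) ->
  (forall x, g (- x) = g x) -> g1 0 = 0 -> f 0 = g 0 -> forall x, f x = g x).
{ intros g g1 hg hge hg1 hfg x.
  assert (hpos : forall y, 0 <= y -> f y = g y).
  { apply (cubic_ivp_unique mu f f1 g g1); auto. now rewrite hf10, hg1. }
  destruct (Rle_dec 0 x); [auto|]. rewrite <- hev, <- hge. apply hpos. lra. }
generalize (hf1G 0). fold f1 in hf10. rewrite hf10. unfold G. set (y := f 0 - a).
intros hG0.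
(* [G y] is half of this product. Its roots give the constant [a], the homoclinic, and a third value
   excluded below. *)
assert (hfac : y ^ 2 * ((y + 2 * a - b) * (y + 2 * a + b)) = 0).
{ replace ((y + 2 * a - b) * (y + 2 * a + b)) with
    (y ^ 2 + 4 * a * y + 4 * a ^ 2 - b ^ 2) by ring. rewrite e2, eA.
  rewrite eA in hG0. nra. }
apply Rmult_integral in hfac. destruct hfac as [hy|hfac].
{ exfalso. destruct hnc as [x1 [x2 hne]]. apply hne.
  assert (hy0 : y = 0) by nra.
  assert (hc : derivs2 (fun _ => a) (fun _ => 0) (fun _ => a ^ 3 - a + mu)).
  { replace (fun _ : R => a ^ 3 - a + mu) with (fun _ : R => 0).
    - apply derivs2_const.
    - apply functional_extensionality. intros _. unfold mu. fold a. rewrite eA. ring. }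
  assert (hfa : f 0 = a) by (unfold y in hy0; lra).
  rewrite (hall _ _ hc (fun _ => eq_refl) eq_refl hfa x1).
  now rewrite (hall _ _ hc (fun _ => eq_refl) eq_refl hfa x2). }
apply Rmult_integral in hfac. destruct hfac as [hy|hy].
{ apply functional_extensionality.
  apply (hall (hom A) (hom1 A) (hom_derivs2 A hA0 hA1) (hom_even A) (hom1_0 A)).
  rewrite hom_0 by assumption. fold a b. unfold y in hy. lra. }
exfalso.
(* Here [f 0 = - a - b], so on its way to [a] the orbit crosses the level [- a]. There [G] equals
   [- 2 * a ^ 2 * b ^ 2 < 0], although it should be the square [f1 ^ 2]. *)
destruct (hfar a ha) as [X hX].
set (x := Rmax 1 (X + 1)).
assert (hx1 : 1 <= x) by apply Rmax_l. assert (hx2 : X + 1 <= x) by apply Rmax_r.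
specialize (hX x ltac:(lra)). apply Rabs_def2 in hX.
destruct (IVT_gen f 0 x (- a)) as [c [_ hc]].
{ intros t. apply is_derive_continuity_pt with (f1 t). apply hf. }
{ unfold y in hy. rewrite Rmin_left, Rmax_right; lra. }
generalize (hf1G c) (pow2_ge_0 (f1 c)). rewrite hc. unfold G. intros g1 g2.
rewrite eA in g1. assert (0 < a ^ 2) by nra. nra.
Qed.

(** * The fixed point map *)

Definition hom_pot (A x : R) : R := 3 * hom A x ^ 2 - 1.

(** Translation invariance: differentiating the fast equation along [hom] yields the kernel element
    of its linearisation. *)
Lemma hom1_derivs2 (A : R) (hA0 : 0 < A) (hA1 : A < 2 / 3) :
  derivs2 (hom1 A) (fun x => hom A x ^ 3 - hom A x + A * sqrt (1 - A))
    (fun x => hom_pot A x * hom1 A x).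
Proof.
intros x. destruct (hom_derivs2 A hA0 hA1 x) as [h1 h2]. split; [exact h2|].
replace (hom_pot A x * hom1 A x) with
  ((INR 3 * hom1 A x * hom A x ^ 2 - hom1 A x) + 0)
  by (unfold hom_pot; simpl; ring).
apply (is_derive_plus (fun x => hom A x ^ 3 - hom A x) (fun _ => A * sqrt (1 - A))).
- apply (is_derive_minus (fun x => hom A x ^ 3) (hom A)).
  + apply is_derive_pow. exact h1.
  + exact h1.
- apply is_derive_Reals, derivable_pt_lim_const.
Qed.

Lemma abs_le1_pow3 (x : R) : Rabs x <= 1 -> Rabs (x ^ 3) <= 1.
Proof.
intros h. rewrite <- RPow_abs. generalize (Rabs_pos x). intros.
replace 1 with (1 ^ 3) by ring. apply pow_incr. lra.
Qed.

Lemma hom_abs_le1 (A : R) (hA0 : 0 < A) (hA1 : A < 2 / 3) (x : R) : Rabs (hom A x) <= 1.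
Proof.
destruct (sqrt_facts A hA0 hA1) as [h1 [_ [_ [e1 _]]]].
assert (sqrt (1 - A) < 1) by nra.
generalize (hom_range A hA0 hA1 x). intros. apply Rabs_le. lra.
Qed.

(** [linearized_estimate] with [phi = hom1] and [Phi = hom]. The potential tends to
    [m ^ 2 = 2 - 3 * A], and [beta = m / 2] keeps half of it in reserve. The crude decay [Cu / x] of
    the slope is enough: at [x = L / eps] it is of order [eps]. *)
Lemma hom_linear_theory (A : R) (hA0 : 0 < A) (hA1 : A < 2 / 3) :
  exists beta C0 l0 Cu, 0 < beta /\ 1 <= C0 /\ 0 < l0 /\ 0 < Cu /\
  (forall l x, 0 <= l -> 0 <= x -> 0 <= sqrt (1 - A) - hom A x <= Cu * zeta beta l x) /\
  (forall x, 0 < x -> Rabs (hom1 A x) <= Cu / x) /\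
  forall l, l0 <= l -> fast_bound (hom_pot A) beta l C0.
Proof.
destruct (sqrt_facts A hA0 hA1) as [ha [hb [hm [e1 [e2 [e3 hab]]]]]].
destruct (hom_decay A hA0 hA1) as [C [hC hdec]].
set (a := sqrt (1 - A)) in *. set (b := sqrt (2 * A)) in *.
set (m := sqrt (2 - 3 * A)) in *.
assert (ha1 : a < 1) by nra.
assert (hexp : forall x, 0 < x -> exp (- (m * x)) <= / (m * x)).
{ intros x hx. assert (hmx : 0 < m * x) by nra.
  rewrite exp_Ropp. apply Rinv_le_contravar; [exact hmx|].
  generalize (exp_ge_1_plus (m * x)). lra. }
assert (hexp1 : forall x, 0 <= x -> exp (- (m * x)) <= 1).
{ intros x hx. rewrite <- exp_0. destruct (Req_dec x 0) as [->|hne].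
  - rewrite Rmult_0_r, Ropp_0. lra.
  - left. apply exp_increasing. nra. }
(* Beyond [x0] the homoclinic is within [m ^ 2 / 12] of its limit, so [hom_pot] has lost at most
   [6 * m ^ 2 / 12] of its limit [m ^ 2]. *)
set (x0 := 12 * C / m ^ 3).
assert (hm3 : 0 < m ^ 3) by (apply pow_lt; exact hm).
assert (hx0 : 0 < x0) by (apply Rdiv_lt_0_compat; lra).
destruct (linearized_estimate (hom_pot A) (hom1 A)
  (fun x => hom A x ^ 3 - hom A x + A * a) (hom A) (m / 2) 2 (C + 3) x0)
  as [C0 [l0 [hC0 [hl0 hest]]]].
- lra.
- exact hx0.
- intros x _. generalize (hom_abs_le1 A hA0 hA1 x). intros h.
  apply Rabs_le_between in h. unfold hom_pot. apply Rabs_le. nra.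
- intros x hx. destruct (hdec x ltac:(lra)) as [h _].
  replace (2 * (m / 2) ^ 2) with (m ^ 2 / 2) by field.
  assert (hs : C * exp (- (m * x)) <= m ^ 2 / 12).
  { apply Rle_trans with (C * / (m * x0)).
    - apply Rmult_le_compat_l; [lra|]. eapply Rle_trans; [apply hexp; lra|].
      apply Rinv_le_contravar; [nra|]. apply Rmult_le_compat_l; lra.
    - right. unfold x0. field. lra. }
  unfold hom_pot. generalize (hom_range A hA0 hA1 x). fold a. intros hr.
  assert (a ^ 2 - hom A x ^ 2 <= 2 * (a - hom A x)).
  { replace (a ^ 2 - hom A x ^ 2) with ((a + hom A x) * (a - hom A x)) by ring.
    apply Rmult_le_compat_r; lra. }
  lra.
- exact (hom1_derivs2 A hA0 hA1).
- intros x. apply hom_derivs2; assumption.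
- apply hom1_0.
- rewrite hom_0 by assumption. fold a b.
  replace ((b - a) ^ 3 - (b - a) + A * a) with (b / 2 * (2 * a - b) ^ 2).
  + apply Rmult_lt_0_compat; [lra|]. nra.
  + assert (eb : b ^ 2 = 2 * A) by exact e2. assert (eA : A = 1 - a ^ 2) by lra.
    assert (eb2 : b ^ 2 = 2 - 2 * a ^ 2) by lra.
    transitivity (b * b ^ 2 / 2 - 2 * a * b ^ 2 + 2 * a ^ 2 * b); [field|].
    transitivity (b * b ^ 2 - 3 * a * b ^ 2 + 3 * a ^ 2 * b - a ^ 3 - (b - a) + A * a); [|ring].
    rewrite eb2, eA. field.
- intros x hx. destruct (hdec x hx) as [h1 h2].
  assert (hce : C * exp (- (m * x)) <= C) by (generalize (hexp1 x hx); nra).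
  generalize (hom_abs_le1 A hA0 hA1 x). intros h3. split; [split|split].
  + destruct (Req_dec x 0) as [->|hne]; [rewrite hom1_0; lra|].
    left. apply hom1_pos; try assumption. lra.
  + generalize (Rle_abs (hom1 A x)). lra.
  + generalize (abs_le1_pow3 _ h3). intros h4. apply Rabs_le_between in h3, h4.
    apply Rabs_le. assert (0 < A * a < 1) by nra. lra.
  + lra.
- exists (m / 2), C0, l0, (Rmax (2 * C) (C / m)).
  assert (hCm : 0 < C / m) by (apply Rdiv_lt_0_compat; lra).
  generalize (Rmax_l (2 * C) (C / m)) (Rmax_r (2 * C) (C / m)). intros k1 k2.
  split; [lra|]. split; [exact hC0|]. split; [exact hl0|]. split; [lra|].
  split; [|split; [|exact hest]].
  + intros l x hl hx. destruct (hdec x hx) as [h _]. split; [apply h|].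
    apply Rle_trans with (C * exp (- (m / 2 * x))).
    * eapply Rle_trans; [apply h|]. apply Rmult_le_compat_l; [lra|].
      destruct (Req_dec x 0) as [->|hne]; [rewrite !Rmult_0_r; lra|].
      left. apply exp_increasing. nra.
    * apply Rle_trans with (2 * C * zeta (m / 2) l x).
      -- generalize (exp_le_zeta (m / 2) l x ltac:(lra) hl). nra.
      -- apply Rmult_le_compat_r; [left; apply zeta_pos|exact k1].
  + intros x hx. destruct (hdec x ltac:(lra)) as [_ h].
    eapply Rle_trans; [exact h|].
    apply Rle_trans with (C * / (m * x)).
    * apply Rmult_le_compat_l; [lra|]. apply hexp, hx.
    * apply Rle_trans with (C / m / x); [right; field; lra|].
      apply Rmult_le_compat_r; [left; apply Rinv_0_lt_compat; lra|exact k2].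
Qed.

Inductive component := Fast | SlowV | SlowW.

(* The fast component carries [z = u + al v]: this removes from the linearised
   [u]-equation the part of the forcing [A v] that does not decay in [xi]. *)
Definition source (A B1 C1 eps l : R) (F : component * R -> R) (x : R) : R :=
  let al := A / (2 - 3 * A) in
  let v := F (SlowV, x) in
  let u := F (Fast, x) - al * v in
  let q := hom_pot A (fold l x) in
  u ^ 3 - u - q * u + al * ((2 - 3 * A) - q) * v + eps * (B1 * F (SlowW, x) + C1)
  + al * eps ^ 2 * (v - u).

(** Only [source] is evaluated at the old state; the slow equations use the new components. The
    response of [v] to the old [v] thus passes through the localised response of [z] within a single
    step, where the factor [eps] is gained. The coefficient [1 + al] comes from
    [v - u = (1 + al) v - z]. *)
Definition step (A B1 C1 D eps l : R) (F G : component * R -> R) : Prop :=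
  let al := A / (2 - 3 * A) in
  exists z1 v1 w1,
    derivs2 (fun x => G (Fast, x)) z1
      (fun x => hom_pot A (fold l x) * G (Fast, x) + source A B1 C1 eps l F x) /\
    derivs2 (fun x => G (SlowV, x)) v1
      (fun x => eps ^ 2 * (1 + al) * G (SlowV, x) + - eps ^ 2 * G (Fast, x)) /\
    derivs2 (fun x => G (SlowW, x)) w1
      (fun x => (eps / D) ^ 2 * 1 * G (SlowW, x)
        + - (eps / D) ^ 2 * (G (Fast, x) - al * G (SlowV, x))) /\
    z1 0 = 0 /\ z1 l = 0 /\ v1 0 = 0 /\ v1 l = 0 /\ w1 0 = 0 /\ w1 l = 0.

Definition admissible (l : R) (F : component * R -> R) : Prop :=
  forall i, cont (fun x => F (i, x)) /\ even_periodic l (fun x => F (i, x)).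

(** Folding the homoclinic leaves a kink of slope [hom1 A l] at [l], so the fast component is only
    continuous; [admissible] asks for no more than that. *)
Definition base_state (A l : R) (t : component * R) : R :=
  match fst t with
  | Fast => hom A (fold l (snd t)) + A / (2 - 3 * A) * sqrt (1 - A)
  | _ => sqrt (1 - A)
  end.

Lemma cont_plus (f g : R -> R) : cont f -> cont g -> cont (fun x => f x + g x).
Proof. intros hf hg x. apply (continuous_plus f g); auto. Qed.

Lemma cont_mult (f g : R -> R) : cont f -> cont g -> cont (fun x => f x * g x).
Proof. intros hf hg x. apply (continuous_mult f g); auto. Qed.

Lemma cont_const (c : R) : cont (fun _ => c).
Proof. intros x. apply continuous_const. Qed.

Lemma cont_comp (f g : R -> R) : cont f -> cont g -> cont (fun x => f (g x)).
Proof. intros hf hg x. apply (continuous_comp g f); auto. Qed.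

Lemma cont_ext (f g : R -> R) : (forall x, f x = g x) -> cont f -> cont g.
Proof. intros e. apply functional_extensionality in e. now subst. Qed.

Ltac solve_cont := repeat match goal with
  | |- cont (fun _ => ?c) => apply (cont_const c)
  | |- cont (fun x => @?f x + @?g x) => apply (cont_plus f g)
  | |- cont (fun x => @?f x * @?g x) => apply (cont_mult f g)
  | _ => assumption
  end.

Lemma cont_minus_scal (c : R) (f g : R -> R) :
  cont f -> cont g -> cont (fun x => f x - c * g x).
Proof.
intros hf hg. apply cont_ext with (f := fun x => f x + - c * g x); [intros; ring|].
apply cont_plus; [exact hf|]. apply cont_mult; [apply cont_const|exact hg].
Qed.

Lemma hom_cont (A : R) (hA0 : 0 < A) (hA1 : A < 2 / 3) : cont (hom A).
Proof. apply (derivs2_cont _ _ _ (hom_derivs2 A hA0 hA1)). Qed.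

Lemma hom_pot_fold_cont (A l : R) (hA0 : 0 < A) (hA1 : A < 2 / 3) (hl : 0 < l) :
  cont (fun x => hom_pot A (fold l x)).
Proof.
apply (cont_comp (hom_pot A)); [|apply fold_cont, hl].
apply (cont_plus (fun x => 3 * hom A x ^ 2) (fun _ => - (1))); [|apply cont_const].
apply (cont_mult (fun _ => 3)); [apply cont_const|].
apply (cont_mult (hom A) (fun x => hom A x * 1)); [now apply hom_cont|].
apply (cont_mult (hom A) (fun _ => 1)); [now apply hom_cont|apply cont_const].
Qed.

Lemma source_cont (A B1 C1 eps l : R) (hA0 : 0 < A) (hA1 : A < 2 / 3) (hl : 0 < l)
    (F : component * R -> R) :
  admissible l F -> cont (source A B1 C1 eps l F).
Proof.
intros hF. unfold source.
generalize (hom_pot_fold_cont A l hA0 hA1 hl). intros hq.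
assert (hv := proj1 (hF SlowV)). assert (hw := proj1 (hF SlowW)).
set (al := A / (2 - 3 * A)).
assert (hu : cont (fun x => F (Fast, x) - al * F (SlowV, x))).
{ apply cont_minus_scal; [apply hF|exact hv]. }
set (u := fun x => F (Fast, x) - al * F (SlowV, x)) in *.
assert (hnu : cont (fun x => -1 * u x)) by (apply cont_mult; [apply cont_const|exact hu]).
assert (h : cont (fun x => u x * (u x * u x) + -1 * u x
  + hom_pot A (fold l x) * (-1 * u x)
  + al * ((2 - 3 * A) + -1 * hom_pot A (fold l x)) * F (SlowV, x)
  + eps * (B1 * F (SlowW, x) + C1)
  + al * eps ^ 2 * (F (SlowV, x) + -1 * u x))).
{ solve_cont. }
revert h. apply cont_ext. intros x. unfold u. simpl. ring.
Qed.

Lemma source_even_periodic (A B1 C1 eps l : R) (hl : 0 < l) (F : component * R -> R) :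
  admissible l F -> even_periodic l (source A B1 C1 eps l F).
Proof.
intros hF. destruct (hF Fast) as [_ [z1 z2]]. destruct (hF SlowV) as [_ [v1 v2]].
destruct (hF SlowW) as [_ [w1 w2]].
split; intros x; unfold source.
- now rewrite z1, v1, w1, fold_opp.
- now rewrite z2, v2, w2, fold_period.
Qed.

Lemma slow_bvp (l k c : R) (s : R -> R) :
  0 < l -> 0 < k -> 0 < c -> cont s -> even_periodic l s ->
  exists q q1, derivs2 q q1 (fun x => k ^ 2 * c * q x + - k ^ 2 * s x) /\
    even_periodic l q /\ q1 0 = 0 /\ q1 l = 0.
Proof.
intros hl hk hc hs hse.
apply (even_periodic_bvp l (fun _ => k ^ 2 * c) (fun x => - k ^ 2 * s x) hl).
- apply cont_const.
- split; reflexivity.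
- apply cont_mult; [apply cont_const|exact hs].
- destruct hse as [h1 h2]. split; intros x; [rewrite h1|rewrite h2]; reflexivity.
- intros p p1 hp h0 h1.
  assert (h : Rabs (p 0) <= 0).
  { apply (comparison (fun _ => k ^ 2 * c) p p1 _ (fun _ => 0) (fun _ => 0) (fun _ => 0) 0 l hl hp (derivs2_const 0)); try lra.
    - intros. apply Rmult_lt_0_compat; [apply pow_lt|]; assumption.
    - intros. rewrite Rminus_diag, Rabs_R0. lra.
    - right. rewrite h0, Rabs_R0. lra.
    - rewrite h1, Rabs_R0. lra. }
  destruct (Req_dec (p 0) 0) as [|hne]; [assumption|].
  apply Rabs_pos_lt in hne. lra.
Qed.

(** [fast_bound] with [S = T = 0] is the uniqueness needed for shooting. The three problems are then
    solved in triangular order. *)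
Lemma step_exists (A B1 C1 D eps l beta C0 : R) (hA0 : 0 < A) (hA1 : A < 2 / 3)
    (hD : 0 < D) (heps : 0 < eps) (hl : 0 < l) :
  fast_bound (hom_pot A) beta l C0 ->
  forall F, admissible l F -> exists G, admissible l G /\ step A B1 C1 D eps l F G.
Proof.
intros hest F hF. set (al := A / (2 - 3 * A)).
assert (hal : 0 < al) by (apply Rdiv_lt_0_compat; lra).
destruct (even_periodic_bvp l (fun x => hom_pot A (fold l x)) (source A B1 C1 eps l F) hl)
  as [z [z1 [hz [hze [hz0 hzl]]]]].
- now apply hom_pot_fold_cont.
- now apply (even_periodic_comp_fold l (hom_pot A)).
- now apply source_cont.
- now apply source_even_periodic.
- intros p p1 hp h0 h1.
  assert (h : Rabs (p 0) <= C0 * (0 + 0 * zeta beta l 0)).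
  { apply (hest p p1 _ 0 0 (Rle_refl 0) (Rle_refl 0) hp); try lra.
    - intros x hx. rewrite (fold_id l x hl hx), Rminus_diag, Rabs_R0. lra.
    - rewrite h1, Rabs_R0. lra. }
  replace (C0 * (0 + 0 * zeta beta l 0)) with 0 in h by ring.
  destruct (Req_dec (p 0) 0) as [|hne]; [assumption|].
  apply Rabs_pos_lt in hne. lra.
- assert (hzc := derivs2_cont _ _ _ hz).
  destruct (slow_bvp l eps (1 + al) z hl heps ltac:(lra) hzc hze) as [v [v1 [hv [hve [hv0 hvl]]]]].
  assert (hvc := derivs2_cont _ _ _ hv).
  assert (hkD : 0 < eps / D) by now apply Rdiv_lt_0_compat.
  destruct (slow_bvp l (eps / D) 1 (fun x => z x - al * v x) hl hkD ltac:(lra))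
    as [w [w1 [hw [hwe [hw0 hwl]]]]].
  + now apply cont_minus_scal.
  + destruct hze as [k1 k2], hve as [k3 k4].
    split; intros x; [rewrite k1, k3|rewrite k2, k4]; reflexivity.
  + exists (fun t => match fst t with Fast => z (snd t) | SlowV => v (snd t) | SlowW => w (snd t) end).
    split.
    * intros [| |]; split; simpl; auto. exact (derivs2_cont _ _ _ hw).
    * exists z1, v1, w1. simpl. tauto.
Qed.

(** Subtracting the tangent of the cubic at [h] leaves a map whose difference quotient is at most
    [6 * r + 3 * r ^ 2] within distance [r] of [h]. *)
Lemma cubic_lipschitz (h u u' r : R) :
  Rabs h <= 1 -> Rabs (u - h) <= r -> Rabs (u' - h) <= r -> r <= 1 ->
  Rabs ((u ^ 3 - 3 * h ^ 2 * u) - (u' ^ 3 - 3 * h ^ 2 * u')) <= 9 * r * Rabs (u - u').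
Proof.
intros hh hu hu' hr.
set (e := u - h) in *. set (e' := u' - h) in *.
replace ((u ^ 3 - 3 * h ^ 2 * u) - (u' ^ 3 - 3 * h ^ 2 * u')) with
  ((3 * (h * e + h * e') + (e * e + e * e' + e' * e')) * (u - u'))
  by (unfold e, e'; ring).
rewrite Rabs_mult. apply Rmult_le_compat_r; [apply Rabs_pos|].
assert (hr0 : 0 <= r) by (generalize (Rabs_pos e); lra).
assert (hm : forall s t b c, Rabs s <= b -> Rabs t <= c -> - (b * c) <= s * t <= b * c).
{ intros s t b c hs ht. apply Rabs_le_between. rewrite Rabs_mult.
  apply Rmult_le_compat; auto using Rabs_pos. }
generalize (hm _ _ _ _ hh hu) (hm _ _ _ _ hh hu') (hm _ _ _ _ hu hu)
  (hm _ _ _ _ hu hu') (hm _ _ _ _ hu' hu').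
intros. assert (r * r <= r) by nra. apply Rabs_le. lra.
Qed.

(** A change [d] of the old [v] changes the new [z], and through it [w], by a fixed multiple of [d]
    that need not be small. Measuring these two in units of a large [Lam] makes the change look
    small, and the new [v] gains [eps] anyway. *)
Definition weight (Lam : R) (t : component * R) : R :=
  match fst t with SlowV => 1 | _ => Lam end.

Lemma pot_gap (A l beta Cu x : R) (hA0 : 0 < A) (hA1 : A < 2 / 3) :
  0 <= sqrt (1 - A) - hom A x <= Cu * zeta beta l x ->
  Rabs ((2 - 3 * A) - hom_pot A x) <= 6 * Cu * zeta beta l x.
Proof.
intros h.
destruct (sqrt_facts A hA0 hA1) as [ha [_ [_ [e1 _]]]].
generalize (hom_range A hA0 hA1 x). set (a := sqrt (1 - A)) in *. intros hr.
assert (ha1 : a < 1) by nra.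
replace (2 - 3 * A - hom_pot A x) with (3 * (a + hom A x) * (a - hom A x))
  by (unfold hom_pot; ring_simplify; lra).
rewrite Rabs_mult, !Rabs_right by lra.
apply Rle_trans with (6 * (a - hom A x)); [apply Rmult_le_compat_r; lra|]. lra.
Qed.

(** The uniform part of the Lipschitz bound is small with [r] and [eps]; the part of order 1 carries
    the factor [zeta], since it stems from the deviation of the potential from its limit
    [2 - 3 * A]. Here [r] bounds the distance of [u] to [hom] when the state lies in the ball of
    radius [rho]. *)
Lemma source_difference (A B1 C1 eps l beta Cu Lam rho r d : R)
    (hA0 : 0 < A) (hA1 : A < 2 / 3) (F F' : component * R -> R) (x : R) :
  let al := A / (2 - 3 * A) in
  0 < eps -> 0 <= Lam -> (Lam + al) * rho <= r -> r <= 1 -> 0 <= d ->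
  0 < l -> 0 <= x <= l ->
  0 <= sqrt (1 - A) - hom A x <= Cu * zeta beta l x ->
  (forall t, Rabs (F t - base_state A l t) <= rho * weight Lam t) ->
  (forall t, Rabs (F' t - base_state A l t) <= rho * weight Lam t) ->
  (forall t, Rabs (F t - F' t) <= d * weight Lam t) ->
  Rabs (source A B1 C1 eps l F x - source A B1 C1 eps l F' x) <=
    (9 * r * (Lam + al) + eps * Rabs B1 * Lam + al * eps ^ 2 * (1 + Lam + al)) * d
    + 6 * al * Cu * d * zeta beta l x.
Proof.
intros al heps hLam hr hr1 hd hl hx hgap hF hF' hFF.
assert (hal : 0 < al) by (apply Rdiv_lt_0_compat; lra).
unfold source. cbv zeta. fold al. rewrite (fold_id l x hl hx).
assert (hu : forall H, (forall t, Rabs (H t - base_state A l t) <= rho * weight Lam t) ->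
  Rabs (H (Fast, x) - al * H (SlowV, x) - hom A x) <= r).
{ intros H hH. generalize (hH (Fast, x)) (hH (SlowV, x)).
  unfold base_state, weight; simpl. fold al. rewrite (fold_id l x hl hx).
  set (a := sqrt (1 - A)). intros k1 k2.
  apply Rabs_le_between in k1, k2.
  assert (- (al * (rho * 1)) <= al * (H (SlowV, x) - a) <= al * (rho * 1)).
  { split; [rewrite Ropp_mult_distr_r|]; apply Rmult_le_compat_l; lra. }
  apply Rabs_le. lra. }
assert (h1 := hu F hF). assert (h2 := hu F' hF'). clear hu hF hF'.
assert (hz := hFF (Fast, x)). assert (hv := hFF (SlowV, x)). assert (hw := hFF (SlowW, x)).
unfold weight in hz, hv, hw. simpl in hz, hv, hw.
set (z := F (Fast, x)) in *. set (z' := F' (Fast, x)) in *.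
set (v := F (SlowV, x)) in *. set (v' := F' (SlowV, x)) in *.
set (w := F (SlowW, x)) in *. set (w' := F' (SlowW, x)) in *.
set (u := z - al * v) in *. set (u' := z' - al * v') in *.
assert (huu : Rabs (u - u') <= (Lam + al) * d).
{ replace (u - u') with ((z - z') + - (al * (v - v'))) by (unfold u, u'; ring).
  eapply Rle_trans; [apply Rabs_triang|]. rewrite Rabs_Ropp, Rabs_mult, (Rabs_right al) by lra.
  assert (al * Rabs (v - v') <= al * (d * 1)) by (apply Rmult_le_compat_l; lra). lra. }
assert (hc := cubic_lipschitz (hom A x) u u' r (hom_abs_le1 A hA0 hA1 x) h1 h2 hr1).
assert (hr0 : 0 <= r) by (generalize (Rabs_pos (u - hom A x)); lra).
assert (hgap2 := pot_gap A l beta Cu x hA0 hA1 hgap).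
set (g := (2 - 3 * A) - hom_pot A x) in *.
(* As [- u - hom_pot * u = - 3 * hom ^ 2 * u], the linear terms combine with the cube into the
   expression treated by [cubic_lipschitz]. *)
match goal with |- Rabs ?e <= _ => replace e with
  (((u ^ 3 - 3 * hom A x ^ 2 * u) - (u' ^ 3 - 3 * hom A x ^ 2 * u'))
   + al * (g * (v - v')) + eps * (B1 * (w - w')) + al * eps ^ 2 * ((v - v') + - (u - u'))) end.
2: { unfold hom_pot. ring. }
assert (ha2 : 0 <= al * eps ^ 2) by (apply Rmult_le_pos; [lra|apply pow2_ge_0]).
eapply Rle_trans; [apply Rabs_triang|].
eapply Rle_trans; [apply Rplus_le_compat_r, Rabs_triang|].
eapply Rle_trans; [apply Rplus_le_compat_r, Rplus_le_compat_r, Rabs_triang|].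
rewrite (Rabs_mult al), (Rabs_mult g), (Rabs_mult eps), (Rabs_mult B1), (Rabs_mult (al * eps ^ 2)).
rewrite (Rabs_right al), (Rabs_right eps), (Rabs_right (al * eps ^ 2)) by lra.
generalize (Rabs_triang (v - v') (- (u - u'))). rewrite Rabs_Ropp. intros htri.
generalize (Rabs_pos g) (Rabs_pos (v - v')) (Rabs_pos B1) (zeta_pos beta l x). intros p1 p2 p3 p4.
assert (t1 : 9 * r * Rabs (u - u') <= 9 * r * ((Lam + al) * d)) by (apply Rmult_le_compat_l; lra).
assert (t2 : al * (Rabs g * Rabs (v - v')) <= al * (6 * Cu * zeta beta l x * (d * 1))).
{ apply Rmult_le_compat_l; [lra|]. apply Rmult_le_compat; lra. }
assert (t3 : eps * (Rabs B1 * Rabs (w - w')) <= eps * (Rabs B1 * (d * Lam))).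
{ apply Rmult_le_compat_l; [lra|]. apply Rmult_le_compat_l; lra. }
assert (t4 : al * eps ^ 2 * Rabs (v - v' + - (u - u')) <= al * eps ^ 2 * (d * 1 + (Lam + al) * d)).
{ apply Rmult_le_compat_l; lra. }
lra.
Qed.

(** For [v] the profile [S + T * zeta] of the fast response is retained, so that [T] gains [eps].
    For [w] a uniform bound suffices, because [w] re-enters [source] only with the factor
    [eps * B1]. *)
Lemma step_difference (A B1 C1 D eps l beta C0 CK S T : R)
    (hA0 : 0 < A) (hA1 : A < 2 / 3) (F F' G G' : component * R -> R) :
  let al := A / (2 - 3 * A) in
  0 < eps -> 0 < D -> 0 < l -> 0 < beta -> 0 <= S -> 0 <= T -> 0 <= C0 ->
  fast_bound (hom_pot A) beta l C0 -> slow_bound beta l eps (1 + al) CK ->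
  slow_bound beta l (eps / D) 1 CK ->
  step A B1 C1 D eps l F G -> step A B1 C1 D eps l F' G' ->
  (forall x, 0 <= x <= l ->
    Rabs (source A B1 C1 eps l F x - source A B1 C1 eps l F' x) <= S + T * zeta beta l x) ->
  let V := CK * (C0 * S + eps * (C0 * T)) in
  forall x, 0 <= x <= l ->
    Rabs (G (Fast, x) - G' (Fast, x)) <= C0 * (S + T) /\
    Rabs (G (SlowV, x) - G' (SlowV, x)) <= V /\
    Rabs (G (SlowW, x) - G' (SlowW, x)) <= CK * (C0 * (S + T) + al * V).
Proof.
intros al heps hD hl hb hS hT hC0 hfast hsv hsw
  [z1 [v1 [w1 [hz [hv [hw [hz0 [hzl [hv0 [hvl [hw0 hwl]]]]]]]]]]]
  [z1' [v1' [w1' [hz' [hv' [hw' [hz0' [hzl' [hv0' [hvl' [hw0' hwl']]]]]]]]]]] hsrc V.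
fold al in hv, hw, hv', hw'.
assert (hal : 0 < al) by (apply Rdiv_lt_0_compat; lra).
assert (dz := derivs2_minus _ _ _ _ _ _ hz hz').
assert (dv := derivs2_minus _ _ _ _ _ _ hv hv').
assert (dw := derivs2_minus _ _ _ _ _ _ hw hw').
assert (ez : forall x, 0 <= x <= l ->
  Rabs (G (Fast, x) - G' (Fast, x)) <= C0 * (S + T * zeta beta l x)).
{ apply (hfast _ _ _ S T hS hT dz).
  - intros x hx. rewrite (fold_id l x hl hx).
    eapply Rle_trans; [|apply hsrc, hx]. right. f_equal. ring.
  - now rewrite hz0, hz0', Rminus_diag.
  - now rewrite hzl, hzl', Rminus_diag, Rabs_R0. }
assert (ez1 : forall x, 0 <= x <= l -> Rabs (G (Fast, x) - G' (Fast, x)) <= C0 * (S + T)).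
{ intros x hx. eapply Rle_trans; [apply ez, hx|]. apply Rmult_le_compat_l; [exact hC0|].
  generalize (zeta_le1 beta l x ltac:(lra) hx). nra. }
assert (hC0S : 0 <= C0 * S) by nra. assert (hC0T : 0 <= C0 * T) by nra.
assert (ev : forall x, 0 <= x <= l -> Rabs (G (SlowV, x) - G' (SlowV, x)) <= V).
{ apply (hsv _ _ _ (C0 * S) (C0 * T) hC0S hC0T dv).
  - intros x hx.
    match goal with |- Rabs ?e <= _ => replace e with
      (- (eps ^ 2 * (G (Fast, x) - G' (Fast, x)))) by ring end.
    rewrite Rabs_Ropp, Rabs_mult, (Rabs_right (eps ^ 2)) by (apply Rle_ge, pow2_ge_0).
    apply Rmult_le_compat_l; [apply pow2_ge_0|].
    eapply Rle_trans; [apply ez, hx|]. right. ring.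
  - now rewrite hv0, hv0', Rminus_diag.
  - now rewrite hvl, hvl', Rminus_diag. }
assert (hV : 0 <= V).
{ eapply Rle_trans; [apply Rabs_pos|apply (ev 0); lra]. }
assert (hSw : 0 <= C0 * (S + T) + al * V) by nra.
assert (ew : forall x, 0 <= x <= l ->
  Rabs (G (SlowW, x) - G' (SlowW, x)) <= CK * ((C0 * (S + T) + al * V) + eps / D * 0)).
{ apply (hsw _ _ _ _ 0 hSw (Rle_refl 0) dw).
  - intros x hx.
    match goal with |- Rabs ?e <= _ => replace e with
      (- ((eps / D) ^ 2 * ((G (Fast, x) - G' (Fast, x))
        + - (al * (G (SlowV, x) - G' (SlowV, x)))))) by ring end.
    rewrite Rabs_Ropp, Rabs_mult, (Rabs_right ((eps / D) ^ 2)) by (apply Rle_ge, pow2_ge_0).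
    apply Rmult_le_compat_l; [apply pow2_ge_0|].
    eapply Rle_trans; [apply Rabs_triang|].
    rewrite Rabs_Ropp, Rabs_mult, (Rabs_right al) by lra.
    assert (al * Rabs (G (SlowV, x) - G' (SlowV, x)) <= al * V)
      by (apply Rmult_le_compat_l; [lra|auto]).
    generalize (ez1 x hx). lra.
  - now rewrite hw0, hw0', Rminus_diag.
  - now rewrite hwl, hwl', Rminus_diag. }
intros x hx. split; [auto|]. split; [auto|].
generalize (ew x hx). now rewrite Rmult_0_r, Rplus_0_r.
Qed.

(** Measures how far the base state is from being a fixed point. Its fast residual and its slope at
    [l] are bounded by [S]; its slow residual contains [hom - sqrt (1 - A)], which is of order 1 but
    localised, whence [eps * Cu]. *)
Lemma step_base (A B1 C1 D eps l beta C0 Cu CK : R)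
    (hA0 : 0 < A) (hA1 : A < 2 / 3) (G : component * R -> R) :
  let al := A / (2 - 3 * A) in
  0 < eps <= 1 -> 1 <= D -> 0 < l -> 0 < beta -> 0 <= C0 -> 0 < Cu -> 0 <= CK ->
  (forall x, 0 <= x -> 0 <= sqrt (1 - A) - hom A x <= Cu * zeta beta l x) ->
  fast_bound (hom_pot A) beta l C0 -> slow_bound beta l eps (1 + al) CK ->
  slow_bound beta l (eps / D) 1 CK ->
  step A B1 C1 D eps l (base_state A l) G ->
  forall S, eps * (Rabs B1 + Rabs C1 + 2 * al) <= S -> Rabs (hom1 A l) <= S ->
  let V := CK * (C0 * S + eps * Cu) in
  forall x, 0 <= x <= l ->
    Rabs (G (Fast, x) - base_state A l (Fast, x)) <= C0 * S /\
    Rabs (G (SlowV, x) - base_state A l (SlowV, x)) <= V /\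
    Rabs (G (SlowW, x) - base_state A l (SlowW, x)) <= CK * (C0 * S + al * V + eps * Cu).
Proof.
intros al heps hD hl hb hC0 hCu hCK hgap hfast hsv hsw
  [z1 [v1 [w1 [hz [hv [hw [hz0 [hzl [hv0 [hvl [hw0 hwl]]]]]]]]]]] S hS hS2 V.
fold al in hv, hw.
destruct (sqrt_facts A hA0 hA1) as [ha [_ [_ [e1 _]]]].
set (a := sqrt (1 - A)) in *.
assert (ha1 : a < 1) by nra.
assert (hal : 0 < al) by (apply Rdiv_lt_0_compat; lra).
assert (halA : al * (2 - 3 * A) = A) by (unfold al; field; lra).
assert (hS0 : 0 <= S) by (generalize (Rabs_pos (hom1 A l)); lra).
assert (hzeta : forall x, 0 <= x <= l -> 0 < zeta beta l x <= 1).
{ intros x hx. split; [apply zeta_pos|apply zeta_le1; lra]. }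
assert (dz := derivs2_minus _ _ _ _ _ _ hz (hom_derivs2 A hA0 hA1)).
assert (dz' := derivs2_minus _ _ _ _ _ _ dz (derivs2_const (al * a))).
assert (ez0 : forall x, 0 <= x <= l ->
  Rabs (G (Fast, x) - hom A x - al * a) <= C0 * (S + 0 * zeta beta l x)).
{ apply (hfast _ _ _ S 0 hS0 (Rle_refl 0) dz').
  - intros x hx. unfold source, base_state. simpl fst. simpl snd. cbv zeta beta iota.
    fold al a. rewrite (fold_id l x hl hx).
    match goal with |- Rabs ?e <= _ => replace e with
      (eps * (B1 * a + C1) + al * eps ^ 2 * (a - hom A x)
        + (al * (2 - 3 * A) - A) * a) by ring end.
    rewrite halA, Rminus_diag, Rmult_0_l, Rplus_0_r, Rmult_0_l, Rplus_0_r.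
    eapply Rle_trans; [|exact hS].
    generalize (hom_range A hA0 hA1 x). fold a. intros hr.
    eapply Rle_trans; [apply Rabs_triang|].
    rewrite !Rabs_mult, (Rabs_right eps), (Rabs_right al), (Rabs_right (eps ^ 2)),
      (Rabs_right (a - hom A x)) by (try apply Rle_ge, pow2_ge_0; lra).
    assert (Rabs (B1 * a + C1) <= Rabs B1 + Rabs C1).
    { eapply Rle_trans; [apply Rabs_triang|]. rewrite Rabs_mult, (Rabs_right a) by lra.
      generalize (Rabs_pos B1). nra. }
    assert (eps * Rabs (B1 * a + C1) <= eps * (Rabs B1 + Rabs C1)) by (apply Rmult_le_compat_l; lra).
    assert (eps ^ 2 <= eps) by nra.
    assert (al * eps ^ 2 * (a - hom A x) <= al * eps * 2).
    { apply Rmult_le_compat; try lra. apply Rmult_le_pos; [lra|apply pow2_ge_0].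
      apply Rmult_le_compat_l; lra. }
    lra.
  - rewrite hz0, hom1_0. ring.
  - rewrite hzl. replace (0 - hom1 A l - 0) with (- hom1 A l) by ring. now rewrite Rabs_Ropp. }
assert (ez : forall x, 0 <= x <= l -> Rabs (G (Fast, x) - hom A x - al * a) <= C0 * S).
{ intros x hx. generalize (ez0 x hx). now rewrite Rmult_0_l, Rplus_0_r. }
assert (hC0S : 0 <= C0 * S) by nra.
assert (dv := derivs2_minus _ _ _ _ _ _ hv (derivs2_const a)).
assert (ev : forall x, 0 <= x <= l -> Rabs (G (SlowV, x) - a) <= V).
{ apply (hsv _ _ _ (C0 * S) Cu hC0S ltac:(lra) dv).
  - intros x hx.
    match goal with |- Rabs ?e <= _ => replace e with
      (- (eps ^ 2 * ((G (Fast, x) - hom A x - al * a) + (hom A x - a)))) by ring end.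
    rewrite Rabs_Ropp, Rabs_mult, (Rabs_right (eps ^ 2)) by (apply Rle_ge, pow2_ge_0).
    apply Rmult_le_compat_l; [apply pow2_ge_0|].
    eapply Rle_trans; [apply Rabs_triang|].
    generalize (ez x hx) (hgap x ltac:(lra)). intros k1 k2.
    rewrite (Rabs_left1 (hom A x - a)); lra.
  - rewrite hv0. ring.
  - rewrite hvl. ring. }
assert (hV : 0 <= V).
{ eapply Rle_trans; [apply Rabs_pos|apply (ev 0); lra]. }
assert (dw := derivs2_minus _ _ _ _ _ _ hw (derivs2_const a)).
assert (hSw : 0 <= C0 * S + al * V) by nra.
assert (ew : forall x, 0 <= x <= l ->
  Rabs (G (SlowW, x) - a) <= CK * ((C0 * S + al * V) + eps / D * Cu)).
{ apply (hsw _ _ _ _ Cu hSw ltac:(lra) dw).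
  - intros x hx.
    match goal with |- Rabs ?e <= _ => replace e with
      (- ((eps / D) ^ 2 * ((G (Fast, x) - hom A x - al * a)
        + - (al * (G (SlowV, x) - a)) + (hom A x - a)))) by ring end.
    rewrite Rabs_Ropp, Rabs_mult, (Rabs_right ((eps / D) ^ 2)) by (apply Rle_ge, pow2_ge_0).
    apply Rmult_le_compat_l; [apply pow2_ge_0|].
    eapply Rle_trans; [apply Rabs_triang|].
    eapply Rle_trans; [apply Rplus_le_compat_r, Rabs_triang|].
    generalize (ez x hx) (hgap x ltac:(lra)). intros k1 k2.
    rewrite Rabs_Ropp, Rabs_mult, (Rabs_right al), (Rabs_left1 (hom A x - a)) by lra.
    assert (al * Rabs (G (SlowV, x) - a) <= al * V)
      by (apply Rmult_le_compat_l; [lra|auto]).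
    lra.
  - rewrite hw0. ring.
  - rewrite hwl. ring. }
intros x hx. unfold base_state; simpl. fold al a. rewrite (fold_id l x hl hx).
split; [|split].
- replace (G (Fast, x) - (hom A x + al * a)) with (G (Fast, x) - hom A x - al * a) by ring. auto.
- auto.
- eapply Rle_trans; [apply ew, hx|]. apply Rmult_le_compat_l; [exact hCK|].
  apply Rplus_le_compat_l. apply Rmult_le_compat_r; [lra|].
  apply Rmult_le_reg_r with D; [lra|].
  replace (eps / D * D) with eps by (field; lra). nra.
Qed.

Lemma base_admissible (A l : R) (hA0 : 0 < A) (hA1 : A < 2 / 3) (hl : 0 < l) :
  admissible l (base_state A l).
Proof.
assert (hs : admissible l (fun _ => sqrt (1 - A))).
{ intros i. split; [apply cont_const|split; reflexivity]. }
intros [| |]; try exact (hs SlowV).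
unfold base_state; simpl. split.
- apply cont_plus; [|apply cont_const].
  apply (cont_comp (hom A)); [now apply hom_cont|now apply fold_cont].
- apply (even_periodic_comp_fold l (fun y => hom A y + A / (2 - 3 * A) * sqrt (1 - A)) hl).
Qed.

Lemma admissible_bound (l Lam c : R) (F G : component * R -> R) :
  0 < l -> admissible l F -> admissible l G ->
  (forall x, 0 <= x <= l ->
    Rabs (F (Fast, x) - G (Fast, x)) <= c * Lam /\
    Rabs (F (SlowV, x) - G (SlowV, x)) <= c /\
    Rabs (F (SlowW, x) - G (SlowW, x)) <= c * Lam) ->
  forall t, Rabs (F t - G t) <= c * weight Lam t.
Proof.
intros hl hF hG h [i x].
rewrite (even_periodic_fold l (fun x => F (i, x)) x (proj2 (hF i))).
rewrite (even_periodic_fold l (fun x => G (i, x)) x (proj2 (hG i))).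
destruct (h (fold l x) (fold_bounds l x hl)) as [h1 [h2 h3]].
destruct i; unfold weight; simpl; auto. now rewrite Rmult_1_r.
Qed.

Lemma admissible_closed (l Lam : R) (s : nat -> component * R -> R) (F : component * R -> R) :
  0 <= Lam -> (forall n, admissible l (s n)) ->
  (forall e, 0 < e -> exists N : nat, forall n, (N <= n)%nat ->
      forall t, Rabs (s n t - F t) <= e * weight Lam t) -> admissible l F.
Proof.
intros hLam hs hlim i.
assert (hw : forall t, 0 <= weight Lam t) by (intros [[| |] x]; unfold weight; simpl; lra).
assert (heq : forall x y, (forall n, s n (i, x) = s n (i, y)) -> F (i, x) = F (i, y)).
{ intros x y hxy. apply Rminus_diag_uniq.
  destruct (Req_dec (F (i, x) - F (i, y)) 0) as [|hne]; [assumption|exfalso].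
  apply Rabs_pos_lt in hne.
  assert (h : Rabs (F (i, x) - F (i, y)) <= 0); [|lra].
  apply le_of_le_eps_mult with (weight Lam (i, x) + weight Lam (i, y)).
  - generalize (hw (i, x)) (hw (i, y)). lra.
  - intros e he. destruct (hlim e he) as [N hN].
    generalize (hN N (le_n _) (i, x)) (hN N (le_n _) (i, y)). rewrite (hxy N). intros h1 h2.
    replace (F (i, x) - F (i, y)) with
      (- (s N (i, y) - F (i, x)) + (s N (i, y) - F (i, y))) by ring.
    eapply Rle_trans; [apply Rabs_triang|]. rewrite Rabs_Ropp. lra. }
split; [|split].
- apply cont_locally_uniform_limit with (s := fun n x => s n (i, x)) (w := fun x => weight Lam (i, x)).
  + intros n. apply (hs n i).
  + intros x. unfold weight. apply continuous_const.
  + intros x. apply hw.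
  + intros e he. destruct (hlim e he) as [N hN]. exists N. intros n hn x. now apply hN.
- intros x. apply heq. intros n. apply (hs n i).
- intros x. apply heq. intros n. apply (hs n i).
Qed.

(** The constants must be fixed in the order [Lam], [K3], [K2], threshold: the Lipschitz constant
    depends on the radius of the ball, which depends on the residual of the base state. *)
Lemma pulse_exists (A B1 C1 D L : R) (hA0 : 0 < A) (hA1 : A < 2 / 3)
    (hD : 1 < D) (hL : 0 < L) :
  exists eps0 K, 0 < eps0 /\ 0 < K /\ forall eps, 0 < eps < eps0 ->
  exists u v w u1 v1 w1,
    derivs2 u u1 (fun x => u x ^ 3 - u x + (A * v x + eps * B1 * w x + eps * C1)) /\
    derivs2 v v1 (fun x => eps ^ 2 * (v x - u x)) /\
    derivs2 w w1 (fun x => (eps / D) ^ 2 * (w x - u x)) /\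
    even_periodic (L / eps) u /\ even_periodic (L / eps) v /\
    even_periodic (L / eps) w /\
    forall x, 0 <= x <= L / eps ->
      Rabs (u x - hom A x) <= K * eps /\ Rabs (v x - sqrt (1 - A)) <= K * eps /\
      Rabs (w x - sqrt (1 - A)) <= K * eps.
Proof.
destruct (hom_linear_theory A hA0 hA1)
  as [beta [C0 [l0 [Cu [hb [hC0 [hl0 [hCu [hgap [hslope hfast]]]]]]]]]].
set (al := A / (2 - 3 * A)).
assert (hal : 0 < al) by (apply Rdiv_lt_0_compat; lra).
assert (hLD : 0 < L / D) by (apply Rdiv_lt_0_compat; lra).
destruct (slow_estimate L beta (1 + al) hL hb ltac:(lra)) as [CKv [kv [hCKv [hkv hsv]]]].
destruct (slow_estimate (L / D) beta 1 hLD hb ltac:(lra)) as [CKw [kw [hCKw [hkw hsw]]]].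
set (CK := CKv + CKw). assert (hCK : 1 <= CK) by (unfold CK; lra).
set (Tq := 6 * al * Cu). assert (hTq : 0 < Tq) by (unfold Tq; nra).
(* Half of [Lam] must dominate the order 1 responses: [C0 * Tq] in [z], and [CK] times it, plus the
   contribution of [v], in [w]. *)
set (Lam := 4 * CK * (C0 * Tq + al + 1)).
assert (hC0Tq : 0 < C0 * Tq) by nra.
assert (hLam : 4 <= Lam) by (unfold Lam; nra).
(* [eps * K1] bounds the fast residual and slope defect of the base state; [eps * V1] and [eps * W1]
   are the resulting bounds of [step_base] on the slow components. *)
set (K1 := Rabs B1 + Rabs C1 + 2 * al + Cu / L).
assert (hCuL : 0 < Cu / L) by (apply Rdiv_lt_0_compat; lra).
generalize (Rabs_pos B1) (Rabs_pos C1). intros hB1 hC1.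
assert (hK1 : 0 < K1) by (unfold K1; lra).
assert (hC0K1 : 0 < C0 * K1) by nra.
set (V1 := CK * (C0 * K1 + Cu)). assert (hV1 : 0 < V1) by (unfold V1; nra).
set (W1 := CK * (C0 * K1 + al * V1 + Cu)).
assert (halV1 : 0 < al * V1) by nra.
assert (hW1 : 0 < W1) by (unfold W1; nra).
set (K3 := C0 * K1 + V1 + W1). assert (hK3 : 0 < K3) by (unfold K3; lra).
(* [eps * K2] is the uniform part of the Lipschitz bound of [source] on a ball of radius
   [2 * K3 * eps]. *)
set (K2 := 9 * (Lam + al) ^ 2 * (2 * K3) + Rabs B1 * Lam + al * (1 + Lam + al)).
assert (hK2 : 0 <= K2).
{ unfold K2. assert (0 <= (Lam + al) ^ 2 * K3) by (apply Rmult_le_pos; nra). nra. }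
(* Each summand [t] encodes one smallness condition [eps * t <= 1], all of which follow from
   [eps < / N]. *)
set (N := 1 + / kv + / kw + l0 / L + (Lam + al) * (2 * K3) + 4 * CK * C0 * (K2 + Tq)).
assert (n1 : 0 < / kv) by now apply Rinv_0_lt_compat.
assert (n2 : 0 < / kw) by now apply Rinv_0_lt_compat.
assert (n3 : 0 < l0 / L) by (apply Rdiv_lt_0_compat; lra).
assert (n4 : 0 < (Lam + al) * (2 * K3)) by nra.
assert (n5 : 0 < 4 * CK * C0 * (K2 + Tq)).
{ apply Rmult_lt_0_compat; [|lra]. nra. }
assert (hN : 0 < N) by (unfold N; lra).
exists (/ N), ((Lam + al) * (2 * K3)).
split; [now apply Rinv_0_lt_compat|]. split; [exact n4|].
intros eps [heps heN].
assert (hsmall : forall t, t <= N -> eps * t <= 1).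
{ intros t ht. apply Rle_trans with (eps * N); [apply Rmult_le_compat_l; lra|].
  rewrite <- (Rinv_l N) by lra. apply Rmult_le_compat_r; lra. }
assert (he1 : eps <= 1) by (generalize (hsmall 1); unfold N; lra).
assert (hek : forall k, 0 < k -> / k <= N -> eps <= k).
{ intros k hk hkN. generalize (hsmall _ hkN). intros h.
  apply Rmult_le_reg_r with (/ k); [now apply Rinv_0_lt_compat|]. now rewrite Rinv_r by lra. }
assert (hekv : eps <= kv) by (apply hek; unfold N; lra).
assert (hekw : eps <= kw) by (apply hek; unfold N; lra).
set (l := L / eps). assert (hl : 0 < l) by (apply Rdiv_lt_0_compat; lra).
assert (hll : l0 <= l).
{ generalize (hsmall (l0 / L) ltac:(unfold N; lra)). intros h.
  replace l0 with (eps * (l0 / L) * l) by (unfold l; field; lra). nra. }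
assert (he4 : eps * ((Lam + al) * (2 * K3)) <= 1) by (apply hsmall; unfold N; lra).
assert (he5 : eps * (4 * CK * C0 * (K2 + Tq)) <= 1) by (apply hsmall; unfold N; lra).
clear hsmall hek n1 n2 n3 heN hN. clearbody N. clear N.
assert (hF := hfast l hll).
assert (hkl : eps * l = L) by (unfold l; field; lra).
assert (hklD : eps / D * l = L / D) by (unfold l; field; lra).
assert (hSV : slow_bound beta l eps (1 + al) CK).
{ intros q q1 q2 S T hS hT hd hq h0 h1 x hx.
  apply Rle_trans with (CKv * (S + eps * T)).
  - apply (hsv eps l (conj heps hekv) hkl q q1 q2 S T); auto.
  - apply Rmult_le_compat_r; [nra|]. unfold CK. lra. }
assert (heD : 0 < eps / D <= kw).
{ split; [apply Rdiv_lt_0_compat; lra|].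
  apply Rle_trans with eps; [|exact hekw].
  apply Rmult_le_reg_r with D; [lra|].
  replace (eps / D * D) with eps by (field; lra). nra. }
assert (hSW : slow_bound beta l (eps / D) 1 CK).
{ intros q q1 q2 S T hS hT hd hq h0 h1 x hx.
  apply Rle_trans with (CKw * (S + eps / D * T)).
  - apply (hsw (eps / D) l heD hklD q q1 q2 S T); auto.
  - apply Rmult_le_compat_r; [nra|]. unfold CK. lra. }
assert (hgap' : forall x, 0 <= x -> 0 <= sqrt (1 - A) - hom A x <= Cu * zeta beta l x).
{ intros x hx. apply hgap; lra. }
assert (hbase := base_admissible A l hA0 hA1 hl).
assert (hwt : forall t, 0 <= weight Lam t) by (intros [[| |] x]; unfold weight; simpl; lra).
(* Twice the displacement [K3 * eps] of the base state: with contraction factor [1 / 2] the ball is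
   mapped into itself. *)
set (rho := 2 * K3 * eps). assert (hrho : 0 < rho) by (unfold rho; nra).
set (P := fun F => admissible l F /\
  forall t, Rabs (F t - base_state A l t) <= rho * weight Lam t).
set (Rel := fun F G => admissible l G /\ step A B1 C1 D eps l F G).
assert (hPb : P (base_state A l)).
{ split; [exact hbase|]. intros t. rewrite Rminus_diag, Rabs_R0.
  apply Rmult_le_pos; [lra|apply hwt]. }
assert (hinit : forall G, Rel (base_state A l) G ->
  forall t, Rabs (G t - base_state A l t) <= K3 * eps * weight Lam t).
{ intros G [hG hs]. apply admissible_bound with l; auto. intros x hx.
  destruct (step_base A B1 C1 D eps l beta C0 Cu CK hA0 hA1 G (conj heps he1)
    ltac:(lra) hl hb ltac:(lra) hCu ltac:(lra) hgap' hF hSV hSW hs (eps * K1)) with (x := x)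
    as [k1 [k2 k3]]; [| |exact hx|].
  - fold al. apply Rmult_le_compat_l; [lra|]. unfold K1. lra.
  - eapply Rle_trans; [apply hslope, hl|].
    apply Rle_trans with (eps * (Cu / L)); [right; unfold l; field; lra|].
    apply Rmult_le_compat_l; [lra|]. unfold K1. lra.
  - fold al in k3.
    replace (CK * (C0 * (eps * K1) + eps * Cu)) with (eps * V1) in k2, k3 by (unfold V1; ring).
    replace (CK * (C0 * (eps * K1) + al * (eps * V1) + eps * Cu)) with (eps * W1) in k3
      by (unfold W1; ring).
    assert (0 < eps * V1) by nra. assert (0 < eps * W1) by nra.
    assert (0 < eps * (C0 * K1)) by nra.
    assert (K3 * eps = eps * (C0 * K1) + eps * V1 + eps * W1) by (unfold K3; ring).
    assert (K3 * eps <= K3 * eps * Lam) by nra.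
    repeat split; lra. }
assert (hcontr : forall F F' G G' d, P F -> P F' -> Rel F G -> Rel F' G' -> 0 <= d ->
    (forall t, Rabs (F t - F' t) <= d * weight Lam t) ->
    forall t, Rabs (G t - G' t) <= 1 / 2 * d * weight Lam t).
{ intros F F' G G' d [hFa hFb] [hFa' hFb'] [hG hs] [hG' hs'] hd hFF.
  apply admissible_bound with l; auto. intros x hx.
  set (r := (Lam + al) * rho).
  assert (hr : r <= 1) by (unfold r, rho; lra).
  assert (her : 0 <= eps * K2 * d) by (apply Rmult_le_pos; [nra|lra]).
  assert (hTd : 0 <= Tq * d) by nra.
  assert (hV : CK * (C0 * (eps * K2 * d) + eps * (C0 * (Tq * d))) <= 1 / 4 * d).
  { replace (CK * (C0 * (eps * K2 * d) + eps * (C0 * (Tq * d)))) with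
      (eps * (4 * CK * C0 * (K2 + Tq)) / 4 * d) by field.
    apply Rmult_le_compat_r; lra. }
  destruct (step_difference A B1 C1 D eps l beta C0 CK (eps * K2 * d) (Tq * d) hA0 hA1 F F' G G'
    heps ltac:(lra) hl hb her hTd ltac:(lra) hF hSV hSW hs hs') with (x := x)
    as [k1 [k2 k3]]; [|exact hx|].
  - intros y hy.
    eapply Rle_trans; [apply (source_difference A B1 C1 eps l beta Cu Lam rho r d hA0 hA1 F F' y);
      auto; try lra; [unfold r, al; lra|apply hgap'; lra]|].
    fold al. apply Rplus_le_compat; [|unfold Tq; right; ring].
    apply Rmult_le_compat_r; [exact hd|].
    assert (al * eps ^ 2 * (1 + Lam + al) <= al * eps * (1 + Lam + al)).
    { apply Rmult_le_compat_r; [lra|]. apply Rmult_le_compat_l; [lra|]. nra. }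
    unfold r, rho, K2. lra.
  - fold al in k3.
    assert (hz : C0 * (eps * K2 * d) <= 1 / 4 * d).
    { eapply Rle_trans; [|exact hV].
      assert (0 <= C0 * (eps * K2 * d)) by (apply Rmult_le_pos; lra).
      assert (0 <= eps * (C0 * (Tq * d))) by (apply Rmult_le_pos; [lra|apply Rmult_le_pos; lra]).
      nra. }
    assert (hCKd : 0 <= (CK - 1) * (C0 * Tq * d)) by (apply Rmult_le_pos; nra).
    assert (hLd : 1 / 2 * d * Lam = 2 * (CK * (C0 * Tq * d)) + 2 * CK * al * d + 2 * CK * d)
      by (unfold Lam; field).
    assert (g0 : 0 <= C0 * Tq * d) by nra.
    assert (g1 : 0 <= CK * al * d) by (apply Rmult_le_pos; nra).
    assert (g2 : d <= CK * d) by nra.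
    repeat split; [lra|lra|].
    eapply Rle_trans; [exact k3|].
    apply Rle_trans with (CK * (1 / 4 * d + C0 * Tq * d + al * (1 / 4 * d))).
    + apply Rmult_le_compat_l; [lra|].
      assert (al * (CK * (C0 * (eps * K2 * d) + eps * (C0 * (Tq * d)))) <= al * (1 / 4 * d))
        by (apply Rmult_le_compat_l; lra).
      lra.
    + assert (0 <= CK * (C0 * Tq * d)) by nra. lra. }
destruct (weighted_banach (component * R) (weight Lam) P Rel (base_state A l) (K3 * eps) (1 / 2))
  as [F [[hFa hFb] [_ [z1 [v1 [w1 [hz [hv [hw _]]]]]]]]]; auto.
- lra.
- nra.
- intros G [hG1 hG2].
  destruct (step_exists A B1 C1 D eps l beta C0 hA0 hA1 ltac:(lra) heps hl hF G hG1)
    as [G' [hG' hs]].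
  exists G'. split; [|split; assumption]. split; [exact hG'|]. intros t.
  destruct (step_exists A B1 C1 D eps l beta C0 hA0 hA1 ltac:(lra) heps hl hF _ hbase)
    as [H [hH hsH]].
  assert (k1 := hcontr G (base_state A l) G' H rho (conj hG1 hG2) hPb (conj hG' hs)
    (conj hH hsH) ltac:(lra) hG2 t).
  assert (k2 := hinit H (conj hH hsH) t).
  replace (G' t - base_state A l t) with ((G' t - H t) + (H t - base_state A l t)) by ring.
  eapply Rle_trans; [apply Rabs_triang|]. unfold rho in *. lra.
- intros s F hs hlim. split.
  + apply admissible_closed with Lam s; auto; [lra|]. intros n. apply hs.
  + intros t. apply Rminus_le.
    apply le_of_le_eps_mult with (weight Lam t); [apply hwt|]. intros e he.
    destruct (hlim e he) as [N hN]. specialize (hN N (le_n _) t).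
    destruct (hs N) as [_ h2]. specialize (h2 t).
    replace (F t - base_state A l t) with
      (- (s N t - F t) + (s N t - base_state A l t)) by ring.
    assert (h3 := Rabs_triang (- (s N t - F t)) (s N t - base_state A l t)).
    rewrite Rabs_Ropp in h3. lra.
- assert (halA : al * (2 - 3 * A) = A) by (unfold al; field; lra).
  fold al in hv, hw.
  exists (fun x => 1 * F (Fast, x) + - al * F (SlowV, x)), (fun x => F (SlowV, x)),
    (fun x => F (SlowW, x)), (fun x => 1 * z1 x + - al * v1 x), v1, w1.
  split; [|split; [|split; [|split; [|split; [|split]]]]].
  + generalize (derivs2_comb 1 (- al) _ _ _ _ _ _ hz hv). apply derivs2_ext; auto.
    intros x. unfold source. fold al. cbv zeta.
    replace (A * F (SlowV, x)) with (al * (2 - 3 * A) * F (SlowV, x))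
      by (rewrite halA; reflexivity).
    ring.
  + revert hv. apply derivs2_ext; auto. intros x. ring.
  + revert hw. apply derivs2_ext; auto. intros x. ring.
  + destruct (hFa Fast) as [_ [p1 p2]], (hFa SlowV) as [_ [p3 p4]].
    split; intros x; [rewrite p1, p3|rewrite p2, p4]; reflexivity.
  + apply (hFa SlowV).
  + apply (hFa SlowW).
  + intros x hx.
    assert (k1 := hFb (Fast, x)). assert (k2 := hFb (SlowV, x)). assert (k3 := hFb (SlowW, x)).
    unfold base_state, weight in k1, k2, k3. simpl in k1, k2, k3. fold al in k1.
    rewrite (fold_id l x hl hx) in k1. set (a := sqrt (1 - A)) in *.
    replace ((Lam + al) * (2 * K3) * eps) with (rho * Lam + al * rho) by (unfold rho; ring).
    assert (0 < al * rho) by now apply Rmult_lt_0_compat.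
    assert (0 <= rho * (Lam - 1)) by (apply Rmult_le_pos; lra).
    split; [|split; lra].
    replace (1 * F (Fast, x) + - al * F (SlowV, x) - hom A x) with
      ((F (Fast, x) - (hom A x + al * a)) + - (al * (F (SlowV, x) - a))) by ring.
    eapply Rle_trans; [apply Rabs_triang|]. rewrite Rabs_Ropp, Rabs_mult, (Rabs_right al) by lra.
    assert (al * Rabs (F (SlowV, x) - a) <= al * (rho * 1)) by (apply Rmult_le_compat_l; lra).
    lra.
Qed.

(** * Fast transition and assembly *)

Lemma constant_state_iff (mu c : R) : constant_state mu c <-> c - c ^ 3 - mu = 0.
Proof.
destruct (derivs2_twice_derivable _ _ _ (derivs2_const c)) as [h1 h2].
split.
- intros [_ h]. specialize (h 0). rewrite h2 in h. lra.
- intros h. split; [exact h1|]. intros xi. rewrite h2. lra.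
Qed.

Lemma hom_lt (A x y : R) (hA0 : 0 < A) (hA1 : A < 2 / 3) :
  0 <= x < y -> hom A x < hom A y.
Proof.
intros h. destruct (mvt_strict (hom A) (hom1 A) x y) as [c [hc e]]; [lra| |].
- intros t _. now apply hom_derivs2.
- generalize (hom1_pos A hA0 hA1 c ltac:(lra)). nra.
Qed.

Lemma hom_le (A x y : R) (hA0 : 0 < A) (hA1 : A < 2 / 3) :
  0 <= x <= y -> hom A x <= hom A y.
Proof.
intros h. destruct (Req_dec x y) as [->|hne]; [lra|].
left. apply hom_lt; lra.
Qed.

(** On [x >= 0] the homoclinic crosses the level [a - delta] once, with positive slope. Closeness of
    slopes keeps [u] increasing around the crossing; elsewhere [hom] stays away from the level and
    closeness of values decides. *)
Lemma crossing_stable (A : R) (hA0 : 0 < A) (hA1 : A < 2 / 3) :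
  let a := sqrt (1 - A) in
  exists delta M eta, 0 < delta /\ 0 < M /\ 0 < eta /\
    (forall c, constant_state (A * a) c -> Rabs (c - a) < delta -> c = a) /\
    forall l u u1, M < l -> (forall x, is_derive u x (u1 x)) ->
    (forall x, 0 <= x <= l -> Rabs (u x - hom A x) <= eta) ->
    (forall x, 0 <= x <= M -> Rabs (u1 x - hom1 A x) <= eta) ->
    exists x2, 0 < x2 <= M /\
      forall x, 0 <= x <= l -> (delta <= Rabs (u x - a) <-> x <= x2).
Proof.
intros a.
destruct (sqrt_facts A hA0 hA1) as [ha [hb [_ [e1 [_ [_ hab]]]]]].
fold a in ha, e1, hab. set (b := sqrt (2 * A)) in *.
(* The first bound keeps the other roots of the constant state equation out of the neighbourhood;
   the second is half of the depth [2 * a - b] of the excursion at [0]. *)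
set (delta := Rmin ((2 - 3 * A) / (6 * a)) ((2 * a - b) / 2)).
assert (hd1 : delta <= (2 - 3 * A) / (6 * a)) by apply Rmin_l.
assert (hd2 : delta <= (2 * a - b) / 2) by apply Rmin_r.
assert (hd : 0 < delta).
{ apply Rmin_pos; [apply Rdiv_lt_0_compat|]; lra. }
clearbody delta.
assert (hrange : forall x, hom A x <= a) by (intros; now apply hom_range).
assert (hh0 : hom A 0 = b - a) by now apply hom_0.
assert (hX : exists X, 0 < X /\ a - delta < hom A X).
{ destruct (even_homoclinic_hom A hA0 hA1) as [_ [_ [_ [hlim _]]]].
  apply is_lim_spec in hlim. destruct (hlim (mkposreal delta hd)) as [X hX].
  exists (Rmax 1 (X + 1)). generalize (Rmax_l 1 (X + 1)) (Rmax_r 1 (X + 1)). intros.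
  split; [lra|]. specialize (hX (Rmax 1 (X + 1)) ltac:(lra)). simpl in hX.
  apply Rabs_def2 in hX. unfold a. lra. }
destruct hX as [X [hX0 hX]].
destruct (IVT_gen (hom A) 0 X (a - delta)) as [xs [hxs exs]].
{ intros t. apply is_derive_continuity_pt with (hom1 A t). now apply hom_derivs2. }
{ rewrite hh0, Rmin_left, Rmax_right; lra. }
rewrite Rmin_left, Rmax_right in hxs by lra.
assert (hxs0 : 0 < xs).
{ destruct (Req_dec xs 0) as [e|]; [|lra]. rewrite e, hh0 in exs. lra. }
destruct (continuity_ab_min (hom1 A) (xs / 2) (2 * xs)) as [xm [hxm hxmi]]; [lra| |].
{ intros t _. eapply is_derive_continuity_pt. now apply (hom_derivs2 A hA0 hA1). }
assert (hk : 0 < hom1 A xm) by (apply hom1_pos; try assumption; lra).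
set (k := hom1 A xm) in *.
assert (hlo : hom A (xs / 2) < a - delta) by (rewrite <- exs; apply hom_lt; lra).
assert (hhi : a - delta < hom A (2 * xs)) by (rewrite <- exs; apply hom_lt; lra).
(* The two gaps keep [u] on the correct side of the level outside [[xs / 2, 2 * xs]], [k] keeps its
   slope positive inside, and [delta] prevents it from leaving the neighbourhood of [a] from
   above. *)
set (eta := Rmin (Rmin ((a - delta) - hom A (xs / 2)) (hom A (2 * xs) - (a - delta)))
  (Rmin k delta) / 2).
assert (heta : 0 < eta).
{ unfold eta. apply Rdiv_lt_0_compat; [|lra]. repeat apply Rmin_pos; lra. }
assert (heta2 : 2 * eta <= (a - delta) - hom A (xs / 2) /\
  2 * eta <= hom A (2 * xs) - (a - delta) /\ 2 * eta <= k /\ 2 * eta <= delta).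
{ assert (h : 2 * eta = Rmin (Rmin ((a - delta) - hom A (xs / 2)) (hom A (2 * xs) - (a - delta)))
    (Rmin k delta)) by (unfold eta; field).
  rewrite h. repeat split.
  - eapply Rle_trans; apply Rmin_l.
  - eapply Rle_trans; [apply Rmin_l|apply Rmin_r].
  - eapply Rle_trans; [apply Rmin_r|apply Rmin_l].
  - eapply Rle_trans; apply Rmin_r. }
clearbody eta.
exists delta, (2 * xs), eta.
split; [exact hd|]. split; [lra|]. split; [exact heta|]. split.
- intros c hc hca. apply constant_state_iff in hc.
  assert (hfac : (c - a) * ((c - a) ^ 2 + 3 * a * (c - a) + (2 - 3 * A)) = 0).
  { transitivity (- (c - c ^ 3 - A * a)); [|lra].
    assert (eA : A = 1 - a ^ 2) by lra. rewrite eA. ring. }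
  apply Rmult_integral in hfac. destruct hfac as [h|h]; [lra|exfalso].
  assert (h2 : 6 * a * delta <= 2 - 3 * A).
  { apply Rmult_le_compat_l with (r := 6 * a) in hd1; [|lra].
    replace (6 * a * ((2 - 3 * A) / (6 * a))) with (2 - 3 * A) in hd1 by (field; lra). lra. }
  apply Rabs_def2 in hca. generalize (pow2_ge_0 (c - a)). nra.
- intros l u u1 hl hu hclose hclose1.
  assert (hmid : forall x, xs / 2 <= x <= 2 * xs -> 0 < u1 x).
  { intros x hx. generalize (hclose1 x ltac:(lra)) (hxm x hx). intros h1 h2.
    apply Rabs_le_between in h1. lra. }
  assert (hmono : forall x y, xs / 2 <= x -> x < y -> y <= 2 * xs -> u x < u y).
  { intros x y h1 h2 h3. destruct (mvt_strict u u1 x y h2) as [c [hc e]].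
    - intros; apply hu.
    - generalize (hmid c ltac:(lra)). nra. }
  assert (hul := hclose (xs / 2) ltac:(lra)). assert (hur := hclose (2 * xs) ltac:(lra)).
  apply Rabs_le_between in hul, hur.
  destruct (IVT_gen u (xs / 2) (2 * xs) (a - delta)) as [x2 [hx2 ex2]].
  { intros t. now apply is_derive_continuity_pt with (u1 t). }
  { rewrite Rmin_left, Rmax_right; lra. }
  rewrite Rmin_left, Rmax_right in hx2 by lra.
  exists x2. split; [lra|]. intros x hx.
  assert (hux := hclose x hx). apply Rabs_le_between in hux.
  assert (hxa := hrange x).
  split.
  + intros h. apply Rnot_lt_le. intros hlt.
    assert (h2 : a - delta < u x).
    { destruct (Rle_dec x (2 * xs)) as [hle|hgt].
      - rewrite <- ex2. apply hmono; lra.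
      - generalize (hom_le A (2 * xs) x hA0 hA1 ltac:(lra)). lra. }
    assert (Rabs (u x - a) < delta) by (apply Rabs_def1; lra). lra.
  + intros h.
    assert (h2 : u x <= a - delta).
    { destruct (Rle_dec (xs / 2) x) as [hle|hgt].
      - destruct (Req_dec x x2) as [->|hne]; [lra|].
        rewrite <- ex2. left. apply hmono; lra.
      - generalize (hom_le A x (xs / 2) hA0 hA1 ltac:(lra)). lra. }
    rewrite Rabs_left1; lra.
Qed.

(** The second derivatives differ by at most [8 * d + d], and both slopes vanish at [0]. The linear
    growth in [x] is harmless because the result is applied only up to the fixed [M]. *)
Lemma derivative_close (A l d : R) (hA0 : 0 < A) (hA1 : A < 2 / 3)
    (u u1 f : R -> R) :
  derivs2 u u1 (fun x => u x ^ 3 - u x + f x) -> u1 0 = 0 -> d <= 1 ->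
  (forall x, 0 <= x <= l ->
    Rabs (u x - hom A x) <= d /\ Rabs (f x - A * sqrt (1 - A)) <= d) ->
  forall x, 0 <= x <= l -> Rabs (u1 x - hom1 A x) <= 9 * d * x.
Proof.
intros hu h0 hd hclose x hx.
assert (hdiff := derivs2_minus _ _ _ _ _ _ hu (hom_derivs2 A hA0 hA1)).
replace (u1 x - hom1 A x) with ((u1 x - hom1 A x) - (u1 0 - hom1 A 0))
  by (rewrite h0, hom1_0; ring).
replace (9 * d * x) with (9 * d * x - 9 * d * 0) by ring.
apply (abs_increment_le (fun x => u1 x - hom1 A x)
  (fun x => u x ^ 3 - u x + f x - (hom A x ^ 3 - hom A x + A * sqrt (1 - A)))
  (fun x => 9 * d * x) (fun _ => 9 * d)); [lra| | |].
- intros t _. apply hdiff.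
- intros t _. auto_derive; [trivial|ring].
- intros t ht. destruct (hclose t ltac:(lra)) as [h1 h2].
  assert (hh := hom_abs_le1 A hA0 hA1 t).
  set (h := hom A t) in *. set (e := u t - h) in *.
  replace (u t ^ 3 - u t + f t - (h ^ 3 - h + A * sqrt (1 - A))) with
    ((3 * (h * h) + 3 * (h * e) + e * e - 1) * e + (f t - A * sqrt (1 - A)))
    by (unfold e; ring).
  eapply Rle_trans; [apply Rabs_triang|]. rewrite Rabs_mult.
  assert (hr : Rabs (3 * (h * h) + 3 * (h * e) + e * e - 1) <= 8).
  { apply Rabs_le_between in hh. assert (he : Rabs e <= 1) by lra.
    apply Rabs_le_between in he. apply Rabs_le. nra. }
  assert (Rabs (3 * (h * h) + 3 * (h * e) + e * e - 1) * Rabs e <= 8 * d)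
    by (apply Rmult_le_compat; auto using Rabs_pos).
  lra.
Qed.

Definition steady (eps A B C D : R) (u v w : R -> R) : Prop :=
  exists u1 u2 v1 v2 w1 w2,
    derivs2 u u1 u2 /\ derivs2 v v1 v2 /\ derivs2 w w1 w2 /\
    forall x, eps ^ 2 * u2 x + u x - u x ^ 3 - (A * v x + B * w x + C) = 0 /\
      v2 x + u x - v x = 0 /\ D ^ 2 * w2 x + u x - w x = 0.

Lemma steady_stationary (eps A B C D : R) (u v w : R -> R) :
  steady eps A B C D u v w -> stationary_solution eps A B C D u v w.
Proof.
intros [u1 [u2 [v1 [v2 [w1 [w2 [hu [hv [hw heq]]]]]]]]] tau theta _ _.
destruct (derivs2_twice_derivable _ _ _ hu) as [hu1 hu2].
destruct (derivs2_twice_derivable _ _ _ hv) as [hv1 hv2].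
destruct (derivs2_twice_derivable _ _ _ hw) as [hw1 hw2].
assert (hc : forall f, twice_derivable f -> classical (fun x _ => f x)).
{ intros f hf. split; [intros _; exact hf|].
  intros x t. apply ex_derive_const. }
repeat (split; [apply hc; assumption|]).
intros x t. unfold d_t, d_xx. rewrite !Derive_const, hu2, hv2, hw2.
destruct (heq x) as [h1 [h2 h3]]. repeat split; lra.
Qed.

(** The cubic is odd, so only the constant [C] breaks the symmetry. This reduces the lower sign to
    the upper one with [C1] negated. *)
Lemma steady_opp (eps A B C D : R) (u v w : R -> R) :
  steady eps A B (- C) D u v w ->
  steady eps A B C D (fun x => - u x) (fun x => - v x) (fun x => - w x).
Proof.
intros [u1 [u2 [v1 [v2 [w1 [w2 [hu [hv [hw heq]]]]]]]]].
assert (hopp : forall f f1 f2, derivs2 f f1 f2 ->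
  derivs2 (fun x => - f x) (fun x => - f1 x) (fun x => - f2 x)).
{ intros f f1 f2 hf. generalize (derivs2_comb (-1) 0 _ _ _ _ _ _ hf hf).
  apply derivs2_ext; intros; ring. }
do 6 eexists. split; [apply hopp, hu|]. split; [apply hopp, hv|]. split; [apply hopp, hw|].
intros x. destruct (heq x) as [h1 [h2 h3]]. simpl. simpl in h1, h2, h3. repeat split; lra.
Qed.

Lemma derivs2_scale (eps : R) (f f1 f2 : R -> R) : eps <> 0 -> derivs2 f f1 f2 ->
  derivs2 (fun x => f (x / eps)) (fun x => f1 (x / eps) / eps)
    (fun x => f2 (x / eps) / eps ^ 2).
Proof.
intros he hd x. destruct (hd (x / eps)) as [h1 h2].
assert (hs : is_derive (fun x => x / eps) x (/ eps)) by (auto_derive; [trivial|field; exact he]).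
split.
- replace (f1 (x / eps) / eps) with (/ eps * f1 (x / eps)) by (unfold Rdiv; ring).
  apply (is_derive_comp f (fun x => x / eps)); assumption.
- replace (f2 (x / eps) / eps ^ 2) with (/ eps * (/ eps * f2 (x / eps))) by (field; exact he).
  apply is_derive_ext with (f := fun x => / eps * f1 (x / eps)).
  { intros t. apply Rmult_comm. }
  apply is_derive_scal.
  apply (is_derive_comp f1 (fun x => x / eps)); assumption.
Qed.

Lemma one_fast_transition_opp (mu delta M eps L : R) (u : R -> R) :
  one_fast_transition mu delta M eps L u ->
  one_fast_transition (- mu) delta M eps L (fun x => - u x).
Proof.
intros [hM [c [x1 [x2 [hc [hiso [h1 [h2 [h3 h]]]]]]]]].
split; [exact hM|]. exists (- c), x1, x2. split; [|split; [|repeat (split; [assumption|])]].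
- apply constant_state_iff in hc. apply constant_state_iff. lra.
- intros c' hc' hd. enough (- c' = c) by lra. apply hiso.
  + apply constant_state_iff in hc'. apply constant_state_iff. lra.
  + replace (- c' - c) with (- (c' - - c)) by ring. now rewrite Rabs_Ropp.
- intros xi hxi. replace (- u (eps * xi) - - c) with (- (u (eps * xi) - c)) by ring.
  rewrite Rabs_Ropp. now apply h.
Qed.

(** [delta] and [M] come before the remaining parameters, so that the same values serve for both
    [C1] and [- C1], that is, for both signs. *)
Lemma positive_pulse (A : R) (hA0 : 0 < A) (hA1 : A < 2 / 3) :
  exists delta M, 0 < delta /\
  forall B1 C1 D L, 1 < D -> 0 < L ->
  exists eps0 K, 0 < eps0 /\ 0 < K /\ forall eps, 0 < eps < eps0 ->
  exists u v w, steady eps A (eps * B1) (eps * C1) D u v w /\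
    periodic (2 * L) u /\ periodic (2 * L) v /\ periodic (2 * L) w /\
    one_fast_transition (A * sqrt (1 - A)) delta M eps L u /\
    (forall x, - L <= x <= L ->
       Rabs (v x - sqrt (1 - A)) <= K * eps /\ Rabs (w x - sqrt (1 - A)) <= K * eps) /\
    (forall xi, - (L / eps) <= xi <= L / eps -> Rabs (u (eps * xi) - hom A xi) <= K * eps).
Proof.
destruct (crossing_stable A hA0 hA1) as [delta [M [eta [hdelta [hM [heta [hiso hcross]]]]]]].
set (a := sqrt (1 - A)) in *.
destruct (sqrt_facts A hA0 hA1) as [ha [_ [_ [e1 _]]]]. fold a in ha, e1.
assert (ha1 : a < 1) by nra.
exists delta, M. split; [exact hdelta|].
intros B1 C1 D L hD hL.
destruct (pulse_exists A B1 C1 D L hA0 hA1 hD hL) as [eps1 [K [heps1 [hK hpulse]]]].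
fold a in hpulse.
generalize (Rabs_pos B1) (Rabs_pos C1). intros hB hC.
(* [eps * K2] bounds both the distance of [u] to [hom] and that of the coupling term to its frozen
   value [A * a], as [derivative_close] requires. *)
set (K2 := K + A * K + Rabs B1 * (1 + K) + Rabs C1).
assert (hKB : 0 <= Rabs B1 * (1 + K)) by (apply Rmult_le_pos; lra).
assert (hAK : 0 < A * K) by (apply Rmult_lt_0_compat; lra).
assert (hK2 : 0 < K2) by (unfold K2; lra).
set (N := 1 + / eps1 + K2 + M / L + K / eta + 9 * K2 * M / eta).
assert (n1 : 0 < / eps1) by now apply Rinv_0_lt_compat.
assert (n2 : 0 < M / L) by now apply Rdiv_lt_0_compat.
assert (n3 : 0 < K / eta) by now apply Rdiv_lt_0_compat.
assert (hKM : 0 < K2 * M) by now apply Rmult_lt_0_compat.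
assert (n4 : 0 < 9 * K2 * M / eta) by (apply Rdiv_lt_0_compat; lra).
assert (hN : 0 < N) by (unfold N; lra).
exists (/ N), K. split; [now apply Rinv_0_lt_compat|]. split; [exact hK|].
intros eps [heps heN].
assert (heN2 : eps * N < 1).
{ rewrite <- (Rinv_l N) by lra. now apply Rmult_lt_compat_r. }
assert (hsmall : forall t, t <= N -> eps * t < 1).
{ intros t ht. apply Rle_lt_trans with (eps * N); [apply Rmult_le_compat_l; lra|exact heN2]. }
assert (he1 : eps < 1) by (generalize (hsmall 1); unfold N; lra).
assert (hee : eps < eps1).
{ assert (h := hsmall (/ eps1) ltac:(unfold N; lra)).
  apply Rmult_lt_reg_r with (/ eps1); [exact n1|]. now rewrite (Rinv_r eps1) by lra. }
assert (heK2 : eps * K2 < 1) by (apply hsmall; unfold N; lra).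
assert (heM : eps * (M / L) < 1) by (apply hsmall; unfold N; lra).
assert (heK : eps * (K / eta) < 1) by (apply hsmall; unfold N; lra).
assert (heKM : eps * (9 * K2 * M / eta) < 1) by (apply hsmall; unfold N; lra).
clear hsmall heN heN2. clearbody N. clear N hN.
set (l := L / eps).
assert (hl : 0 < l) by now apply Rdiv_lt_0_compat.
assert (hMl : M < l).
{ apply Rmult_lt_reg_r with (eps / L); [now apply Rdiv_lt_0_compat|].
  replace (l * (eps / L)) with 1 by (unfold l; field; lra).
  replace (M * (eps / L)) with (eps * (M / L)) by (field; lra). exact heM. }
destruct (hpulse eps (conj heps hee)) as [u [v [w [u1 [v1 [w1
  [hu [hv [hw [[ue up] [[ve vp] [[we wp] hclose]]]]]]]]]]]].
fold l in up, vp, wp, hclose.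
assert (hu10 : u1 0 = 0) by (apply (even_derive_0 u); [exact ue|apply hu]).
assert (hu1c : forall x, 0 <= x <= l -> Rabs (u1 x - hom1 A x) <= 9 * (eps * K2) * x).
{ apply (derivative_close A l (eps * K2) hA0 hA1 u u1 _ hu hu10); [lra|].
  intros x hx. destruct (hclose x hx) as [h1 [h2 h3]]. fold a. split.
  - eapply Rle_trans; [exact h1|]. rewrite Rmult_comm. apply Rmult_le_compat_l; [lra|].
    unfold K2. lra.
  - replace (A * v x + eps * B1 * w x + eps * C1 - A * a) with
      (A * (v x - a) + eps * (B1 * w x + C1)) by ring.
    eapply Rle_trans; [apply Rabs_triang|].
    rewrite !Rabs_mult, (Rabs_right A), (Rabs_right eps) by lra.
    assert (hKe : K * eps <= K) by (rewrite <- (Rmult_1_r K) at 2; apply Rmult_le_compat_l; lra).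
    assert (hwx : Rabs (w x) <= 1 + K).
    { apply Rabs_le_between in h3. apply Rabs_le. lra. }
    assert (Rabs (B1 * w x + C1) <= Rabs B1 * (1 + K) + Rabs C1).
    { eapply Rle_trans; [apply Rabs_triang|]. rewrite Rabs_mult.
      apply Rplus_le_compat_r, Rmult_le_compat_l; assumption. }
    assert (A * Rabs (v x - a) <= A * (K * eps)) by (apply Rmult_le_compat_l; lra).
    assert (eps * Rabs (B1 * w x + C1) <= eps * (Rabs B1 * (1 + K) + Rabs C1))
      by (apply Rmult_le_compat_l; lra).
    assert (0 < K * eps) by now apply Rmult_lt_0_compat.
    unfold K2. lra. }
destruct (hcross l u u1 hMl (fun x => proj1 (hu x))) as [x2 [hx2 hx2c]].
{ intros x hx. eapply Rle_trans; [apply (hclose x hx)|].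
  apply Rmult_le_reg_r with (/ eta); [now apply Rinv_0_lt_compat|].
  rewrite Rinv_r by lra. apply Rle_trans with (eps * (K / eta)); [right; unfold Rdiv; ring|lra]. }
{ intros x hx. eapply Rle_trans; [apply hu1c; lra|].
  apply Rle_trans with (9 * (eps * K2) * M).
  - apply Rmult_le_compat_l; [|lra]. assert (0 < eps * K2) by now apply Rmult_lt_0_compat. lra.
  - apply Rmult_le_reg_r with (/ eta); [now apply Rinv_0_lt_compat|].
    rewrite Rinv_r by lra. apply Rle_trans with (eps * (9 * K2 * M / eta)); [right; unfold Rdiv; ring|lra]. }
assert (habs : forall (f : R -> R) x, (forall x, f (- x) = f x) -> f (Rabs x) = f x).
{ intros f x hf. unfold Rabs. destruct Rcase_abs; auto. }
assert (hell : eps * l = L) by (unfold l; field; lra).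
assert (hin : forall xi, - l <= xi <= l -> 0 <= Rabs xi <= l).
{ intros xi hxi. split; [apply Rabs_pos|]. apply Rabs_le. exact hxi. }
assert (hper : forall f : R -> R, (forall x, f (x + 2 * l) = f x) ->
  periodic (2 * L) (fun x => f (x / eps))).
{ intros f hf x. rewrite <- (hf (x / eps)). f_equal. unfold l. field. lra. }
assert (heps0 : eps <> 0) by lra.
exists (fun x => u (x / eps)), (fun x => v (x / eps)), (fun x => w (x / eps)).
split; [|split; [|split; [|split; [|split; [|split]]]]]; auto.
- do 6 eexists. split; [exact (derivs2_scale eps _ _ _ heps0 hu)|].
  split; [exact (derivs2_scale eps _ _ _ heps0 hv)|].
  split; [exact (derivs2_scale eps _ _ _ heps0 hw)|].
  intros x. simpl. repeat split; field; lra.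
- split; [exact hMl|]. exists a, (- x2), x2.
  split; [|split; [exact hiso|]].
  + apply constant_state_iff. assert (eA : A = 1 - a ^ 2) by lra. rewrite eA. ring.
  + split; [lra|]. split; [lra|]. split; [lra|].
    fold l. intros xi hxi.
    replace (eps * xi / eps) with xi by (field; lra).
    rewrite <- (habs u xi ue), (hx2c (Rabs xi) (hin xi hxi)). apply Rabs_le_between.
- intros x hx.
  assert (hxl : - l <= x / eps <= l).
  { unfold l. split.
    - apply Rmult_le_reg_r with eps; [exact heps|].
      replace (- (L / eps) * eps) with (- L) by (field; lra).
      replace (x / eps * eps) with x by (field; lra). lra.
    - apply Rmult_le_compat_r; [left; now apply Rinv_0_lt_compat|lra]. }
  destruct (hclose _ (hin _ hxl)) as [_ [h2 h3]].
  rewrite (habs v _ ve) in h2. rewrite (habs w _ we) in h3. split; assumption.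
- fold l. intros xi hxi. replace (eps * xi / eps) with xi by (field; lra).
  destruct (hclose _ (hin _ hxi)) as [h1 _].
  rewrite (habs u _ ue), (habs (hom A) _ (hom_even A)) in h1. exact h1.
Qed.

Theorem theorem1 (A B1 C1 D L : R)
    (hA0 : 0 < A) (hA1 : A < 2 / 3) (hD : 1 < D) (hL : 0 < L) :
  exists uh : R -> R,
    unique (even_homoclinic (A * sqrt (1 - A)) (sqrt (1 - A))) uh /\
    exists eps0 K delta M : R,
      0 < eps0 /\ 0 < delta /\
      forall eps, 0 < eps < eps0 ->
      forall s, s = 1 \/ s = -1 ->
      exists u v w : R -> R,
        stationary_solution eps A (eps * B1) (eps * C1) D u v w /\
        periodic (2 * L) u /\ periodic (2 * L) v /\ periodic (2 * L) w /\
        one_fast_transition (A * (s * sqrt (1 - A))) delta M eps L u /\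
        (forall x, - L <= x <= L ->
           Rabs (v x - s * sqrt (1 - A)) <= K * eps /\
           Rabs (w x - s * sqrt (1 - A)) <= K * eps) /\
        (forall xi, - (L / eps) <= xi <= L / eps ->
           Rabs (u (eps * xi) - s * uh xi) <= K * eps).
Proof.
exists (hom A). split.
{ split; [now apply even_homoclinic_hom|].
  intros f hf. symmetry. now apply even_homoclinic_unique. }
destruct (positive_pulse A hA0 hA1) as [delta [M [hdelta hpulse]]].
destruct (hpulse B1 C1 D L hD hL) as [ep [Kp [hep [hKp hplus]]]].
destruct (hpulse B1 (- C1) D L hD hL) as [em [Km [hem [hKm hminus]]]].
exists (Rmin ep em), (Kp + Km), delta, M.
split; [now apply Rmin_pos|]. split; [exact hdelta|].
intros eps [heps hlt] s hs.
assert (hp : eps < ep) by (eapply Rlt_le_trans; [exact hlt|apply Rmin_l]).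
assert (hm : eps < em) by (eapply Rlt_le_trans; [exact hlt|apply Rmin_r]).
assert (hKpe : 0 < Kp * eps) by now apply Rmult_lt_0_compat.
assert (hKme : 0 < Km * eps) by now apply Rmult_lt_0_compat.
destruct hs as [-> | ->].
- destruct (hplus eps (conj heps hp)) as [u [v [w [h1 [h2 [h3 [h4 [h5 [h6 h7]]]]]]]]].
  exists u, v, w. rewrite !Rmult_1_l.
  split; [now apply steady_stationary|]. repeat (split; [assumption|]). split.
  + intros x hx. destruct (h6 x hx). split; lra.
  + intros xi hxi. specialize (h7 xi hxi). rewrite Rmult_1_l. lra.
- destruct (hminus eps (conj heps hm)) as [u [v [w [h1 [h2 [h3 [h4 [h5 [h6 h7]]]]]]]]].
  assert (hopp : forall y z, Rabs (y - z) <= Km * eps -> Rabs (- y - -1 * z) <= (Kp + Km) * eps).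
  { intros y z h. replace (- y - -1 * z) with (- (y - z)) by ring. rewrite Rabs_Ropp. lra. }
  exists (fun x => - u x), (fun x => - v x), (fun x => - w x).
  split; [|split; [|split; [|split; [|split; [|split]]]]].
  + apply steady_stationary, steady_opp. now rewrite Ropp_mult_distr_r.
  + intros x. now rewrite h2.
  + intros x. now rewrite h3.
  + intros x. now rewrite h4.
  + replace (A * (-1 * sqrt (1 - A))) with (- (A * sqrt (1 - A))) by ring.
    now apply one_fast_transition_opp.
  + intros x hx. destruct (h6 x hx). split; now apply hopp.
  + intros xi hxi. apply hopp, h7, hxi.
Qed.
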